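(* Let $S_\Sigma$ be the polynomial ring over $\mathbb{C}$ in the $18$ variables $p_1,p_2,p_3,p_4,q_1,q_2,q_3,r,u$, $s_{ij}$ $(1\le i\le j\le3)$, $t_1,t_2,t_3$. Let $I_\Sigma\subset S_\Sigma$ be the ideal generated by the nine polynomials (left-hand side minus right-hand side) appearing in the equations defining $\Sigma^{14}_{\mathbb A}$, and set $R_\Sigma:=S_\Sigma/I_\Sigma$. The following assertions hold: (1) $I_\Sigma$ is a Gorenstein ideal of codimension four. (2) $I_\Sigma$ is a prime ideal; thus $\Sigma^{14}_{\mathbb A}$ is irreducible and reduced. (3) $\Sigma^{14}_{\mathbb A}$ and $\Sigma^{14}_{\mathbb A}\cap\{p_1=0\}$ are normal. (4) $R_\Sigma$ is a UFD.
   Context: We work over $\mathbb{C}$. In $\mathbb{A}^{18}$ take coordinates $\bm p={}^t(p_1,p_2,p_3)$, $p_4$, $\bm q={}^t(q_1,q_2,q_3)$, $r$, $u$, the entries $s_{ij}$ ($i\le j$) of a symmetric $3\times3$ matrix $S=(s_{ij})$, and $\bm t={}^t(t_1,t_2,t_3)$. Let $A=\begin{pmatrix}0&-q_3&q_2\\ q_3&0&-q_1\\ -q_2&q_1&0\end{pmatrix}$, let $I$ be the $3\times3$ identity and $S^\dagger$ the adjoint (adjugate) matrix of $S$. $\Sigma^{14}_{\mathbb A}\subset\mathbb{A}^{18}$ is the affine scheme defined by the nine equations ${}^t\bm p\bm q=0$; $(rI+AS)\bm p=-p_4A\bm t$ (three equations); ${}^t\bm pS\bm p+p_4\,{}^t\bm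 p\bm t=0$; $u\bm p=(rI-AS)A\bm t$ (three equations); $up_4=-(r^2+{}^t\bm qS^\dagger\bm q)$. An ideal $J$ of a polynomial ring $R$ is called Gorenstein of codimension $c$ if it has codimension $c$ and $R/J$ is a Gorenstein ring. *)

(* Defs.v *)
From HB Require Import structures.
From mathcomp Require Import all_boot all_order all_algebra.
From mathcomp Require Import perm generic_quotient ring_quotient ring.
From mathcomp Require Import boolp classical_sets reals.
From mathcomp Require Import complex mpoly.

Set Implicit Arguments.
Unset Strict Implicit.
Unset Printing Implicit Defensive.

Import GRing.Theory.
Local Open Scope ring_scope.
Local Open Scope quotient_scope.

(* MathComp's [idealr A] and [prime_idealr A] are boolean predicates and are
   proper by definition; classical logic ([`[< _ >]]) makes the boolean
   restriction harmless. *)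

Section IdealSpan.
Variable A : comNzRingType.

Definition ideal_span (s : seq A) : {pred A} :=
  fun x => `[< exists c : 'I_(size s) -> A, x = \sum_i c i * s`_i >].

Lemma ideal_spanP (s : seq A) x :
  reflect (exists c : 'I_(size s) -> A, x = \sum_i c i * s`_i)
          (x \in ideal_span s).
Proof. exact: asboolP. Qed.

Lemma ideal_span_closed (s : seq A) (B : nzRingType) (f : {rmorphism A -> B}) :
  (forall x, x \in s -> f x = 0) -> idealr_closed (ideal_span s).
Proof.
move=> fs; split.
- apply/ideal_spanP; exists (fun=> 0); rewrite big1// => i _.
  by rewrite mul0r.
- apply/ideal_spanP => -[c /(congr1 f)/eqP].
  rewrite rmorph1 rmorph_sum /= big1 ?oner_eq0// => i _.
  by rewrite rmorphM (fs s`_i) ?mulr0// mem_nth.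
- move=> a u v /ideal_spanP[c ->] /ideal_spanP[c' ->].
  apply/ideal_spanP; exists (fun i => a * c i + c' i).
  rewrite mulr_sumr -big_split /=; apply: eq_bigr => i _.
  by rewrite mulrDl mulrA.
Qed.

End IdealSpan.

(* [0 \notin S] is required so that the localization is a nonzero ring. *)
Record mult_set (A : nzRingType) := MultSet {
  mult_set_pred :> {pred A};
  mult_set1 : 1 \in mult_set_pred;
  mult_setM : {in mult_set_pred &, forall x y, x * y \in mult_set_pred};
  mult_set0 : 0 \notin mult_set_pred
}.

Module Localization.
Section Localization.
Variables (A : comNzRingType) (S : mult_set A).

Definition preloc := {x : A * A | x.2 \in S}.
HB.instance Definition _ := Choice.on preloc.

Definition num (x : preloc) : A := (val x).1.
Definition den (x : preloc) : A := (val x).2.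
Lemma denP x : den x \in S. Proof. exact: (valP x). Qed.

Definition mk (a s : A) (sS : s \in S) : preloc :=
  exist (fun x : A * A => x.2 \in S) (a, s) sS.

Definition equiv : rel preloc := fun x y =>
  `[< exists2 u, u \in S & u * (num x * den y - num y * den x) = 0 >].

Lemma equivP x y :
  reflect (exists2 u, u \in S & u * (num x * den y - num y * den x) = 0)
          (equiv x y).
Proof. exact: asboolP. Qed.

Lemma equiv_refl : reflexive equiv.
Proof. by move=> x; apply/equivP; exists 1; [exact: mult_set1 | ring]. Qed.

Lemma equiv_sym : ssrbool.symmetric equiv.
Proof.
by move=> x y; apply/equivP/equivP => -[u uS e]; exists u => //;
  rewrite -[RHS]oppr0 -[in RHS]e; ring.
Qed.

Lemma equiv_trans : transitive equiv.
Proof.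
move=> y x z /equivP[u uS e] /equivP[v vS f]; apply/equivP.
exists (u * v * den y); first by rewrite !mult_setM ?denP.
transitivity (v * den z * (u * (num x * den y - num y * den x))
            + u * den x * (v * (num y * den z - num z * den y))); first by ring.
by rewrite e f; ring.
Qed.

Canonical equiv_equiv := EquivRel equiv equiv_refl equiv_sym equiv_trans.

Definition type := {eq_quot equiv}.
HB.instance Definition _ := EqQuotient.on type.
HB.instance Definition _ := Choice.on type.

Lemma piP (x y : preloc) :
  \pi_type x = \pi_type y <->
  exists2 u, u \in S & u * (num x * den y - num y * den x) = 0.
Proof. by split => [/eqmodP/equivP|/equivP/eqmodP]. Qed.

Lemma reprP (x : preloc) : exists2 u, u \in S &
  u * (num (repr (\pi_type x)) * den x - num x * den (repr (\pi_type x))) = 0.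
Proof. by apply/piP; rewrite reprK. Qed.

Definition addf (x y : preloc) : preloc :=
  mk (num x * den y + num y * den x) (mult_setM (denP x) (denP y)).
Definition mulf (x y : preloc) : preloc :=
  mk (num x * num y) (mult_setM (denP x) (denP y)).
Definition oppf (x : preloc) : preloc := mk (- num x) (denP x).
Definition embf (a : A) : preloc := mk a (mult_set1 S).

Definition add (p q : type) : type := \pi_type (addf (repr p) (repr q)).
Definition mul (p q : type) : type := \pi_type (mulf (repr p) (repr q)).
Definition opp (p : type) : type := \pi_type (oppf (repr p)).
Definition emb (a : A) : type := \pi_type (embf a).

Lemma addE x y : add (\pi_type x) (\pi_type y) = \pi_type (addf x y).
Proof.
apply/piP; have [u uS] := reprP x; have [v vS] := reprP y.
rewrite /addf /mk /num /den /=.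
move: (val (repr (\pi_type x))) (val (repr (\pi_type y))) (val x) (val y).
move=> [a s] [b t] [a' s'] [b' t'] /= f e; exists (u * v).
  by rewrite mult_setM.
transitivity (v * t * t' * (u * (a * s' - a' * s))
            + u * s * s' * (v * (b * t' - b' * t))); first by ring.
by rewrite e f; ring.
Qed.

Lemma mulE x y : mul (\pi_type x) (\pi_type y) = \pi_type (mulf x y).
Proof.
apply/piP; have [u uS] := reprP x; have [v vS] := reprP y.
rewrite /mulf /mk /num /den /=.
move: (val (repr (\pi_type x))) (val (repr (\pi_type y))) (val x) (val y).
move=> [a s] [b t] [a' s'] [b' t'] /= f e; exists (u * v).
  by rewrite mult_setM.
transitivity (v * b * t' * (u * (a * s' - a' * s))
            + u * a' * s * (v * (b * t' - b' * t))); first by ring.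
by rewrite e f; ring.
Qed.

Lemma oppE x : opp (\pi_type x) = \pi_type (oppf x).
Proof.
apply/piP; have [u uS e] := reprP x; exists u => //.
move: e; rewrite /oppf /mk /num /den /=.
by move=> e; rewrite -[RHS]oppr0 -[in RHS]e; ring.
Qed.

Lemma pi_eq (x y : preloc) :
  num x * den y - num y * den x = 0 -> \pi_type x = \pi_type y.
Proof.
by move=> e; apply/piP; exists 1; [exact: mult_set1|rewrite e mulr0].
Qed.

Lemma piW (K : type -> Prop) : (forall x, K (\pi_type x)) -> forall p, K p.
Proof. by move=> h p; rewrite -[p]reprK. Qed.

Ltac solve_pi := rewrite ?(addE, mulE, oppE) ?(addE, mulE, oppE); apply: pi_eq;
  rewrite /addf /mulf /oppf /embf /mk /num /den /=; ring.

Lemma addA : associative add.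
Proof. by elim/piW=> x; elim/piW=> y; elim/piW=> z; solve_pi. Qed.
Lemma addC : commutative add.
Proof. by elim/piW=> x; elim/piW=> y; solve_pi. Qed.
Lemma add0 : left_id (emb 0) add.
Proof. by elim/piW=> x; rewrite /emb; solve_pi. Qed.
Lemma addN : left_inverse (emb 0) opp add.
Proof. by elim/piW=> x; rewrite /emb; solve_pi. Qed.

HB.instance Definition _ := GRing.isZmodule.Build type addA addC add0 addN.

Lemma mulA : associative mul.
Proof. by elim/piW=> x; elim/piW=> y; elim/piW=> z; solve_pi. Qed.
Lemma mulC : commutative mul.
Proof. by elim/piW=> x; elim/piW=> y; solve_pi. Qed.
Lemma mul1 : left_id (emb 1) mul.
Proof. by elim/piW=> x; rewrite /emb; solve_pi. Qed.
Lemma mulD : left_distributive mul add.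
Proof. by elim/piW=> x; elim/piW=> y; elim/piW=> z; solve_pi. Qed.
Lemma one_neq0 : emb 1 != emb 0.
Proof.
apply/eqP => /piP[u uS]; rewrite /embf /num /den /= => e.
have u0 : u = 0 by rewrite -[RHS]e; ring.
by have := mult_set0 S; rewrite -u0 uS.
Qed.

HB.instance Definition _ :=
  GRing.Zmodule_isComNzRing.Build type mulA mulC mul1 mulD one_neq0.

End Localization.
End Localization.
HB.export Localization.

Notation localization := Localization.type.

Definition to_localization (A : comNzRingType) (S : mult_set A) :
  A -> localization S := @Localization.emb A S.

Section ToLocalization.
Variables (A : comNzRingType) (S : mult_set A).
Local Notation iota := (@to_localization A S).
Import Localization.

Lemma to_localization_zmod_morphism : zmod_morphism iota.
Proof.
move=> a b; transitivity (add (iota a) (opp (iota b))); last by [].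
rewrite /to_localization /emb oppE addE; apply: pi_eq.
by rewrite /embf /addf /oppf /mk /num /den /=; ring.
Qed.

Lemma to_localization_monoid_morphism : monoid_morphism iota.
Proof.
split=> // a b; transitivity (mul (iota a) (iota b)); last by [].
rewrite /to_localization /emb mulE; apply: pi_eq.
by rewrite /embf /mulf /mk /num /den /=; ring.
Qed.

HB.instance Definition _ := GRing.isZmodMorphism.Build A (localization S)
  iota to_localization_zmod_morphism.
HB.instance Definition _ := GRing.isMonoidMorphism.Build A (localization S)
  iota to_localization_monoid_morphism.

End ToLocalization.

Section LocalRings.
Variable A : comNzRingType.

Lemma prime_compl1 (P : prime_idealr A) : 1 \in [predC P].
Proof. by rewrite inE idealr1. Qed.
Lemma prime_complM (P : prime_idealr A) :
  {in [predC P] &, forall x y, x * y \in [predC P]}.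
Proof. by move=> x y; rewrite !inE prime_idealrM negb_or => -> ->. Qed.
Lemma prime_compl0 (P : prime_idealr A) : 0 \notin [predC P].
Proof. by rewrite inE negbK idealr0. Qed.

Definition prime_compl (P : prime_idealr A) : mult_set A :=
  MultSet (prime_compl1 P) (@prime_complM P) (prime_compl0 P).

Definition local_ring (P : prime_idealr A) : comNzRingType :=
  localization (prime_compl P).

Definition regular : {pred A} := fun x => `[< GRing.lreg x >].

Lemma regular1 : 1 \in regular. Proof. exact/asboolP/lreg1. Qed.
Lemma regularM : {in regular &, forall x y, x * y \in regular}.
Proof. by move=> x y /asboolP xr /asboolP yr; apply/asboolP/lregM. Qed.
Lemma regular0 : 0 \notin regular.
Proof. by apply/negP => /asboolP/lreg_neq0; rewrite eqxx. Qed.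

Definition regular_set : mult_set A := MultSet regular1 regularM regular0.

(* The total ring of fractions; it is the field of fractions when [A] is an
   integral domain. *)
Definition total_fractions : comNzRingType := localization regular_set.

End LocalRings.

Section RingProperties.
Variable A : comNzRingType.

Definition ring_unit (x : A) : Prop := exists y, x * y = 1.

Definition irreducible_elt (x : A) : Prop :=
  [/\ x <> 0, ~ ring_unit x &
      forall a b, x = a * b -> ring_unit a \/ ring_unit b].

Definition associates (x y : A) : Prop := exists2 e, ring_unit e & y = e * x.

Definition ufd : Prop :=
  [/\ GRing.integral_domain_axiom A,
      forall x : A, x <> 0 -> ~ ring_unit x ->
        exists s : seq A, (forall y, y \in s -> irreducible_elt y) /\
                          x = \prod_(y <- s) y
    & forall s t : seq A,
        (forall y, y \in s -> irreducible_elt y) ->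
        (forall y, y \in t -> irreducible_elt y) ->
        \prod_(y <- s) y = \prod_(y <- t) y ->
        size s = size t /\
        exists f : {perm 'I_(size s)},
          forall i : 'I_(size s), associates s`_i t`_(f i)].

Definition normal_domain : Prop :=
  GRing.integral_domain_axiom A /\
  forall x : total_fractions A,
    integralOver (@to_localization A (regular_set A)) x ->
    exists a, x = to_localization (regular_set A) a.

(* The unit ideal, which is not an [idealr], is generated by [1]. *)
Definition noetherian : Prop :=
  forall J : idealr A, exists s : seq A, J =i ideal_span s.

Definition maximal_ideal (P : idealr A) : Prop :=
  forall Q : idealr A, {subset P <= Q} -> {subset Q <= P}.

End RingProperties.

Section SpecProperties.
Variable A : comNzRingType.

(* The points of [Spec A] are the prime ideals of [A]; its closed subsets are
   the zero loci of subsets [E] of [A]. *)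
Definition zero_locus (E : set A) (P : prime_idealr A) : Prop :=
  forall a, E a -> a \in P.

Definition spec_irreducible : Prop :=
  (exists P : prime_idealr A, True) /\
  forall E F : set A, (forall P, zero_locus E P \/ zero_locus F P) ->
    (forall P, zero_locus E P) \/ (forall P, zero_locus F P).

Definition spec_reduced : Prop :=
  forall (P : prime_idealr A) (x : local_ring P) (n : nat),
    x ^+ n = 0 -> x = 0.

Definition spec_normal : Prop :=
  forall P : prime_idealr A, normal_domain (local_ring P).

End SpecProperties.

Section Codimension.
Variable A : comNzRingType.

Definition prime_chain (n : nat) (P : prime_idealr A) : Prop :=
  exists C : nat -> prime_idealr A,
    (forall i, (i < n)%N ->
       {subset C i <= C i.+1} /\ ~ {subset C i.+1 <= C i}) /\
    C n =i P.

Definition height (P : prime_idealr A) (n : nat) : Prop :=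
  prime_chain n P /\ forall m, prime_chain m P -> (m <= n)%N.

Definition codimension (J : idealr A) (c : nat) : Prop :=
  (exists P : prime_idealr A, {subset J <= P} /\ height P c) /\
  forall P : prime_idealr A, {subset J <= P} ->
    forall n, height P n -> (c <= n)%N.

End Codimension.

Section Gorenstein.

Definition injective_module (A : comNzRingType) (E : lmodType A) : Prop :=
  forall (M N : lmodType A) (f : {linear M -> N}) (g : {linear M -> E}),
    injective f -> exists h : {linear N -> E}, forall x, h (f x) = g x.

Definition finite_injective_dimension (A : comNzRingType) (M : lmodType A) :
    Prop :=
  exists (n : nat) (E : nat -> lmodType A) (e : {linear M -> E 0})
         (d : forall i, {linear E i -> E i.+1}),
    [/\ forall i, injective_module (E i),
        injective e,
        forall y, d 0 y = 0 <-> exists x, y = e x,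
        forall i y, d i.+1 y = 0 <-> exists x, y = d i x
      & forall i, (n < i)%N -> forall x : E i, x = 0].

Definition gorenstein_local_ring (A : comNzRingType) : Prop :=
  noetherian A /\ finite_injective_dimension (A^o : lmodType A).

Definition gorenstein_ring (A : comNzRingType) : Prop :=
  noetherian A /\
  forall P : prime_idealr A,
    maximal_ideal P -> gorenstein_local_ring (local_ring P).

Definition gorenstein_ideal (A : comNzRingType) (J : idealr A) (c : nat) :
    Prop :=
  codimension J c /\ gorenstein_ring {ideal_quot J}.

End Gorenstein.

Section Sigma.
Variable R : realType.

Definition S_Sigma : comNzRingType := {mpoly R[i][18]}.

(* The variables are numbered in the order
   p1 p2 p3 p4 q1 q2 q3 r u s11 s12 s13 s22 s23 s33 t1 t2 t3. *)
Definition var (k : nat) : S_Sigma := 'X_(inord k : 'I_18).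

Definition p_ : 'cV[S_Sigma]_3 := \col_i var i.
Definition p4 : S_Sigma := var 3.
Definition q_ : 'cV[S_Sigma]_3 := \col_i var (4 + i).
Definition r_ : S_Sigma := var 7.
Definition u_ : S_Sigma := var 8.
Definition S_ : 'M[S_Sigma]_3 := \matrix_(i, j)
  var (nth 0%N (nth [::] [:: [::  9; 10; 11];
                             [:: 10; 12; 13];
                             [:: 11; 13; 14]]%N i) j).
Definition t_ : 'cV[S_Sigma]_3 := \col_i var (15 + i).

Definition A_ : 'M[S_Sigma]_3 := \matrix_(i, j)
  let q1 := var 4 in let q2 := var 5 in let q3 := var 6 in
  nth 0 (nth [::] [:: [::    0; - q3;   q2];
                      [::   q3;    0; - q1];
                      [:: - q2;   q1;    0]] i) j.

Definition eq1 : 'M[S_Sigma]_1 := p_^T *m q_.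
Definition eq2 : 'cV[S_Sigma]_3 :=
  (r_%:M + A_ *m S_) *m p_ - (- p4 *: (A_ *m t_)).
Definition eq3 : 'M[S_Sigma]_1 := p_^T *m S_ *m p_ + p4 *: (p_^T *m t_).
Definition eq4 : 'cV[S_Sigma]_3 :=
  u_ *: p_ - (r_%:M - A_ *m S_) *m (A_ *m t_).
Definition eq5 : S_Sigma :=
  u_ * p4 - (- (r_ ^+ 2 + (q_^T *m \adj S_ *m q_) 0 0)).

Definition Sigma_eqs : seq S_Sigma :=
  eq1 0 0 :: [seq eq2 i 0 | i : 'I_3] ++ eq3 0 0 ::
  [seq eq4 i 0 | i : 'I_3] ++ [:: eq5].

Definition I_Sigma : {pred S_Sigma} := ideal_span Sigma_eqs.

(* The ideal of the scheme-theoretic intersection with [p1 = 0]. *)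
Definition I_Sigma_p1 : {pred S_Sigma} := ideal_span (var 0 :: Sigma_eqs).

Let ev : {rmorphism S_Sigma -> R[i]} := @meval 18 R[i] (fun=> 0).

Let ev_var k : ev (var k) = 0. Proof. by rewrite /ev /= mevalXU. Qed.

Let ev_mulmx m n l (M : 'M[S_Sigma]_(m, n)) (N : 'M_(n, l)) i j :
  (forall k, ev (N k j) = 0) -> ev ((M *m N) i j) = 0.
Proof.
by move=> h; rewrite mxE rmorph_sum /= big1// => k _; rewrite rmorphM h mulr0.
Qed.

Let ev_Sigma x : x \in var 0 :: Sigma_eqs -> ev x = 0.
Proof.
have evp k : ev (p_ k 0) = 0 by rewrite mxE.
have evq k : ev (q_ k 0) = 0 by rewrite mxE.
have evt k : ev (t_ k 0) = 0 by rewrite mxE.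
have evAt k : ev ((A_ *m t_) k 0) = 0 by exact: ev_mulmx.
rewrite !(inE, mem_cat) => /or4P[/eqP->|/eqP->||].
- exact: ev_var.
- exact: ev_mulmx.
- case/mapP => i _ ->; rewrite mxE rmorphD (ev_mulmx _ _ evp) add0r.
  by rewrite mxE rmorphN mxE rmorphM evAt mulr0 oppr0.
- case/or3P => [/eqP->||].
  + rewrite mxE rmorphD (ev_mulmx _ _ evp) add0r.
    by rewrite mxE rmorphM (ev_mulmx _ _ evt) mulr0.
  + case/mapP => i _ ->; rewrite mxE rmorphD mxE rmorphM evp mulr0 add0r.
    by rewrite mxE rmorphN ev_mulmx ?oppr0.
  + move=> /eqP->; rewrite /eq5 opprK rmorphD rmorphM ev_var mul0r add0r.
    by rewrite rmorphD rmorphXn ev_var expr0n add0r ev_mulmx.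
Qed.

Lemma I_Sigma_closed : idealr_closed I_Sigma.
Proof.
apply: (@ideal_span_closed _ _ _ ev) => x xs.
by apply: ev_Sigma; rewrite inE xs orbT.
Qed.

Lemma I_Sigma_p1_closed : idealr_closed I_Sigma_p1.
Proof. exact: ideal_span_closed ev_Sigma. Qed.

HB.instance Definition _ := isIdealr.Build S_Sigma I_Sigma I_Sigma_closed.
HB.instance Definition _ :=
  isIdealr.Build S_Sigma I_Sigma_p1 I_Sigma_p1_closed.

Definition R_Sigma : comNzRingType := {ideal_quot I_Sigma}.

Definition R_Sigma_p1 : comNzRingType := {ideal_quot I_Sigma_p1}.

End Sigma.

Arguments I_Sigma : clear implicits.
Arguments I_Sigma_p1 : clear implicits.

(* Main.v *)
(* Write m = q x t, v = S p + p4 t, F = r p + q x v, a = (r I - A S) A t = r m - q x S m and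
   rQ = r^2 + q^t adj(S) q.  The ideal I_Sigma is obtained from the complete intersection (p.q, p.v) by two
   Kustin-Miller unprojections: adding F = (F1, F2, F3) (link with (p1, p2, p3)), and then adding u p - a and
   u p4 + rQ (link with (p1, p2, p3, p4)).  An unprojection turns a Gorenstein ideal of grade g into one of
   grade g + 1; here "Gorenstein of grade g" is read off the complex Hom(S/I, E), for a finite injective
   resolution E of S, by asking that its cohomology be S/I in degree g.  The unit needed in each unprojection
   comes from a divisibility argument in S, and finite injective dimension passes to R_Sigma and to its
   localizations by comparing E with free resolutions.

   Grade bounds for ideals J come from explicit regular sequences, after splitting along products f s in J
   (grade J is at least the minimum of grade (J + f) and grade (J + s)).  They show that u is regular modulo
   I_Sigma, and that p1, p2, u T is a regular sequence, where T is the coefficient of t1 in a_1.  Inverting u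
   makes R_Sigma a localized polynomial ring, so I_Sigma is prime; likewise for p1, and for p2 or u T on the
   section p1 = 0.  Hence p1 is prime and Nagata's criterion gives a UFD, while the section p1 = 0 is
   integrally closed because p2, u T is a regular sequence there.  The height is 4 because 14 variables stay
   algebraically independent modulo I_Sigma, and each strict inclusion of primes adds one independent
   element. *)
Require Import Defs.
From HB Require Import structures.
From mathcomp Require Import all_boot all_order all_algebra.
From mathcomp Require Import perm generic_quotient ring_quotient fraction ring.
From mathcomp Require Import boolp classical_sets reals.
From mathcomp Require Import complex mpoly.

Set Implicit Arguments.
Unset Strict Implicit.
Unset Printing Implicit Defensive.

Import GRing.Theory.
Local Open Scope ring_scope.
Local Open Scope quotient_scope.

(** * Ideals and Noetherian rings *)

(** The Gorenstein property is defined through injective resolutions, and every homological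
    statement is proved with elements. Hom(S/I, E) is the set of elements of E killed by I, Ext
    groups are never formed, and finite injective dimension is reduced to one condition: for each
    ideal J some free resolution of A/J has a dual that is exact at one fixed index k. By Baer's
    criterion and dimension shifting the k-th cosyzygy is then injective. Since the condition speaks
    of finite matrices only, it passes to localizations. Injective modules come from Hom_K(A, M),
    which is injective because K is a field.

    Unprojection makes it possible to treat the ideal of grade four without writing down a free
    resolution of it. The Gorenstein property in turn supplies regularity: f is regular modulo I as
    soon as I + (f) has larger grade than I ([gor_reg_mod]), so explicit regular sequences are
    needed only inside larger ideals, where the equations simplify. The polynomial identities behind
    them are checked by computing normal forms with integer coefficients. *)

Section Submodules.
Variables (A : comNzRingType) (M : lmodType A).
Implicit Types (D : M -> Prop) (s : seq M).

Definition submod D : Prop :=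
  [/\ D 0, forall x y, D x -> D y -> D (x + y) & forall a x, D x -> D (a *: x)].

(** The recursion makes [Span (a :: s)] by computation the sum of a principal submodule and
    [Span s]: membership in an explicit list is proved one generator at a time, and adding one
    element to an ideal needs no conversion. *)
Fixpoint Span s (x : M) : Prop :=
  if s is a :: s' then exists c, Span s' (x - c *: a) else x = 0.

Lemma submodN D x : submod D -> D x -> D (- x).
Proof. by move=> [_ _ DZ] Dx; rewrite -scaleN1r; exact: DZ. Qed.

Lemma submodB D x y : submod D -> D x -> D y -> D (x - y).
Proof. by move=> sD Dx Dy; case: (sD) => _ + _; apply=> //; exact: submodN. Qed.

Lemma submod_sum D (I : Type) (r : seq I) (P : pred I) (F : I -> M) :
  submod D -> (forall i, P i -> D (F i)) -> D (\sum_(i <- r | P i) F i).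
Proof. by move=> [D0 DD _] DF; elim/big_ind: _. Qed.

Lemma Span_submod s : submod (Span s).
Proof.
elim: s => [|a s [S0 SD SZ]] /=; first by split=> [|x y -> ->|c x ->]; rewrite ?addr0 ?scaler0.
split=> [|x y [c Sx] [d Sy]|c x [d Sx]].
- by exists 0; rewrite scale0r subr0.
- by exists (c + d); rewrite scalerDl opprD addrACA; exact: SD.
- by exists (c * d); rewrite -scalerA -scalerBr; exact: SZ.
Qed.

Lemma Span_cons a s x : Span s x -> Span (a :: s) x.
Proof. by move=> Sx; exists 0; rewrite scale0r subr0. Qed.

Lemma mem_Span a s : a \in s -> Span s a.
Proof.
elim: s => // b s IHs; rewrite inE => /predU1P[->|/IHs/Span_cons//].
by exists 1; rewrite scale1r subrr; case: (Span_submod s).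
Qed.

Lemma Span_min D s : submod D -> (forall a, a \in s -> D a) -> forall x, Span s x -> D x.
Proof.
move=> sD; elim: s => [_ x ->|a s IHs Ds x [c Sx]]; first by case: sD.
rewrite -[x](subrK (c *: a)); case: (sD) => _ DD DZ; apply: DD.
  by apply: IHs => // b bs; apply: Ds; rewrite inE bs orbT.
by apply: DZ; apply: Ds; rewrite inE eqxx.
Qed.

Lemma Span_sub s t x : (forall a, a \in s -> Span t a) -> Span s x -> Span t x.
Proof. by move=> st; apply: Span_min => //; exact: Span_submod. Qed.

Lemma Span_subset s t x : {subset s <= t} -> Span s x -> Span t x.
Proof. by move=> st; apply: Span_sub => a /st; exact: mem_Span. Qed.

Lemma Span_cat s t x : Span (s ++ t) x <-> exists2 y, Span s y & Span t (x - y).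
Proof.
split=> [|[y Sy Sxy]].
  elim: s x => [|a s IHs] /= x; first by move=> Sx; exists 0; rewrite ?subr0.
  move=> [c /IHs[y Sy Sxy]]; exists (y + c *: a); first by exists c; rewrite addrK.
  by rewrite opprD addrA addrAC.
case: (Span_submod (s ++ t)) => _ SD _; rewrite -[x](subrKC y); apply: SD.
  by apply: Span_subset Sy => a; rewrite mem_cat => ->.
by apply: Span_subset Sxy => a; rewrite mem_cat orbC => ->.
Qed.

Lemma Span_sum s x : Span s x <-> exists c : 'I_(size s) -> A, x = \sum_i c i *: s`_i.
Proof.
split=> [|[c ->]]; last first.
  apply: submod_sum => [|i _]; first exact: Span_submod.
  by case: (Span_submod s) => _ _; apply; apply: mem_Span; rewrite mem_nth.
elim: s x => [|a s IHs] /= x; first by move=> ->; exists (fun=> 0); rewrite big_ord0.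
move=> [c /IHs[d xE]]; exists (fun i => oapp d c (unlift ord0 i)).
rewrite big_ord_recl unlift_none /= -[x](subrKC (c *: a)) xE; congr (_ + _).
by apply: eq_bigr => i _; rewrite liftK.
Qed.

Definition finitely_generated D := exists s, forall x, D x <-> Span s x.

End Submodules.

Definition ideal (A : comNzRingType) (J : A -> Prop) := @submod A A^o J.
Notation ISpan s := (@Span _ (_^o) s).

Section Ideals.
Variable A : comNzRingType.
Implicit Types (J : A -> Prop).

Lemma ideal0 J : ideal J -> J 0. Proof. by case. Qed.
Lemma idealD J x y : ideal J -> J x -> J y -> J (x + y).
Proof. by case=> _ + _; apply. Qed.
Lemma idealMl J a x : ideal J -> J x -> J (a * x).
Proof. by case=> _ _; apply. Qed.
Lemma idealMr J a x : ideal J -> J x -> J (x * a).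
Proof. by rewrite mulrC; exact: idealMl. Qed.
Lemma idealN J x : ideal J -> J x -> J (- x).
Proof. exact: (@submodN A A^o). Qed.
Lemma idealB J x y : ideal J -> J x -> J y -> J (x - y).
Proof. exact: (@submodB A A^o). Qed.
Lemma ideal_sum J (I : Type) (r : seq I) (P : pred I) (F : I -> A) :
  ideal J -> (forall i, P i -> J (F i)) -> J (\sum_(i <- r | P i) F i).
Proof. exact: (@submod_sum A A^o). Qed.

Definition Noeth := forall J, ideal J -> @finitely_generated A A^o J.

End Ideals.

Lemma Noeth_surj (A B : comNzRingType) (f : {rmorphism A -> B}) :
  (forall b, exists a, f a = b) -> Noeth A -> Noeth B.
Proof.
move=> fs NA J iJ; have iJ' : ideal (fun a => J (f a)).
  split=> [|x y Jx Jy|a x Jx]; first by rewrite rmorph0; exact: ideal0.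
    by rewrite rmorphD; exact: idealD.
  by rewrite /GRing.scale /= rmorphM; exact: idealMl.
have [s Js] := NA _ iJ'; exists (map f s : seq B^o) => b; split=> [Jb|].
  have [a fab] := fs b; rewrite -fab in Jb *.
  move/Js: Jb => {b fab Js}; elim: s a => [|c s IHs] a /=; first by move=> ->; exact: rmorph0.
  by move=> [d /IHs h]; exists (f d); move: h; rewrite rmorphB rmorphM.
apply: Span_min => // _ /mapP[a as_ ->]; apply/Js; exact: mem_Span.
Qed.

(* An ideal that is not finitely generated would give an infinite sequence of elements of minimal
   size outside the span of the previous ones; the lead coefficients contradict Noetherianity. *)
Lemma Noeth_poly (A : comNzRingType) : Noeth A -> Noeth {poly A}.
Proof.
move=> NA J iJ; apply: contrapT => nfg.
have step (s : seq {poly A}) : exists f, (forall a, a \in s -> J a) ->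
    [/\ J f, ~ ISpan s f & forall g, J g -> ~ ISpan s g -> (size f <= size g)%N].
  have [Js|nJs] := pselect (forall a, a \in s -> J a); last by exists 0.
  have ex : exists n, `[< exists f, [/\ J f, ~ ISpan s f & size f = n] >].
    apply: contrapT => h; apply: nfg; exists (s : seq {poly A}^o) => x; split.
      by move=> Jx; apply: contrapT => nSx; apply: h; exists (size x); apply/asboolP; exists x.
    exact: (@Span_min _ {poly A}^o).
  have [m /asboolP[f [Jf nSf sf]] mf] := ex_minnP ex; exists f => _; split=> // g Jg nSg; rewrite sf; apply: mf; apply/asboolP.
  by exists g.
have {}/choice[F FP] := step.
pose S := fix S n := if n is n'.+1 then F (S n') :: S n' else [::].
have SJ n a : a \in S n -> J a.
  by elim: n a => // n IHn a /=; rewrite inE => /predU1P[->|/IHn//]; case: (FP (S n) IHn).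
have SF n := FP (S n) (SJ n).
have Smono m n : (m <= n)%N -> {subset S m <= S n}.
  elim: n => [|n IHn]; first by rewrite leqn0 => /eqP->.
  by rewrite leq_eqVlt ltnS => /predU1P[->//|/IHn h x /h xS]; rewrite inE xS orbT.
have Fsize m n : (m <= n)%N -> (size (F (S m)) <= size (F (S n)))%N.
  move=> mn; have [Jn nn _] := SF n; have [_ _ mm] := SF m; apply: mm => // h.
  by apply: nn; apply: Span_subset h; exact: Smono.
have Ssize n a : a \in S n -> (size a <= size (F (S n)))%N.
  elim: n a => // n IHn a /=; rewrite inE => /predU1P[->|/IHn h]; first exact: (@Fsize n n.+1).
  by apply: leq_trans h _; exact: (@Fsize n n.+1).
pose L c := exists n, ISpan (map lead_coef (S n)) c.
have Lmono m n c : (m <= n)%N -> ISpan (map lead_coef (S m)) c -> ISpan (map lead_coef (S n)) c.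
  move=> mn; apply: Span_subset => x /mapP[y ym ->]; apply: map_f; exact: Smono ym.
have iL : ideal L.
  split=> [|x y [m Lx] [n Ly]|a x [n Lx]].
  - by exists 0%N.
  - exists (maxn m n); case: (Span_submod (map lead_coef (S (maxn m n)) : seq A^o)) => _ SD _.
    by apply: SD; [apply: Lmono Lx; exact: leq_maxl|apply: Lmono Ly; exact: leq_maxr].
  - by exists n; case: (Span_submod (map lead_coef (S n) : seq A^o)) => _ _; exact.
have [t Lt] := NA L iL.
have [n Ln] : exists n, forall c, c \in t -> ISpan (map lead_coef (S n)) c.
  have : forall c, c \in t -> L c by move=> c ct; apply/Lt; exact: mem_Span.
  move: {Lt}t; elim=> [|c t IHt] tL; first by exists 0%N.
  have [|n nt] := IHt; first by move=> d dt; apply: tL; rewrite inE dt orbT.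
  have [m mc] := tL c (mem_head _ _); exists (maxn m n) => d; rewrite inE => /predU1P[->|/nt].
    by apply: Lmono mc; exact: leq_maxl.
  by apply: Lmono; exact: leq_maxr.
have [Jf nSf fmin] := SF n; set f := F (S n) in Jf nSf fmin.
have f0 : f != 0.
  by apply: contra_notN nSf => /eqP->; case: (Span_submod (S n : seq {poly A}^o)).
have lead : ISpan (map lead_coef (S n)) (lead_coef f).
  have : L (lead_coef f) by exists n.+1; apply: mem_Span; rewrite /= inE eqxx.
  by move/Lt; apply: Span_sub.
have [h [Sh sh hf]] : exists h : {poly A},
    [/\ ISpan (S n) h, (size h <= size f)%N & h`_(size f).-1 = lead_coef f].
  move: (lead_coef f) lead (Ssize n); rewrite -/f.
  elim: (S n) => [|a s IHs] c /=; first by move=> -> _; exists 0; rewrite size_poly0 coef0.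
  move=> [d /IHs h] sz; have [|h' [Sh' sh' hc]] := h.
    by move=> b bs; apply: sz; rewrite inE bs orbT.
  have sa : (size a <= size f)%N by apply: sz; rewrite inE eqxx.
  have [a0|a0] := eqVneq a 0.
    exists h'; split=> //; first exact: (@Span_cons _ {poly A}^o).
    by rewrite hc a0 lead_coef0 scaler0 subr0.
  exists (h' + d%:P * 'X^(size f - size a) * a); split.
  - by exists (d%:P * 'X^(size f - size a)); rewrite /GRing.scale /= addrK.
  - rewrite (leq_trans (size_polyD _ _))// geq_max sh' /= -mulrA mul_polyC.
    rewrite (leq_trans (size_scale_leq _ _))// mulrC size_mulXn//.
    by rewrite subnK.
  - rewrite coefD hc -mulrA coefCM coefXnM.
    move: sa f0 a0; rewrite -!size_poly_gt0 => sa f0 a0.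
    have -> : ((size f).-1 < size f - size a)%N = false.
      by apply/negbTE; rewrite -leqNgt leq_subLR -{1}(prednK f0) -(prednK a0) addSn ltnS leq_addl.
    have -> : ((size f).-1 - (size f - size a) = (size a).-1)%N.
      by rewrite -subn1 -subnDA addnC subnDA subKn// subn1.
    by rewrite -lead_coefE subrK.
apply: nSf; rewrite -[f](subrK h).
case: (Span_submod (S n : seq {poly A}^o)) => _ SD _; apply: SD => //.
apply: contrapT => /fmin H.
have Jfh : J (f - h).
  by apply: idealB => //; apply: (@Span_min _ {poly A}^o) Sh => // a /SJ.
have := H Jfh; rewrite leqNgt => /negP; apply.
have s0 : (0 < size f)%N by rewrite size_poly_gt0.
rewrite -(prednK s0) ltnS; apply/leq_sizeP => j; rewrite leq_eqVlt => /predU1P[<-|lt].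
  by rewrite coefB hf lead_coefE subrr.
rewrite (prednK s0) in lt.
by rewrite coefB !nth_default ?subr0// (leq_trans _ lt).
Qed.

(** * Polynomial rings in several variables *)

Lemma mpoly_rmorph_ext (K : comNzRingType) n (B : nzRingType) (f g : {rmorphism {mpoly K[n]} -> B}) :
  (forall c, f c%:MP = g c%:MP) -> (forall i, f 'X_i = g 'X_i) -> f =1 g.
Proof.
move=> fgC fgX p; rewrite [p]mpolyE !rmorph_sum; apply: eq_bigr => m _.
rewrite -mul_mpolyC !rmorphM fgC mpolyXE_id !rmorph_prod; congr (_ * _).
by apply: eq_bigr => i _; rewrite !rmorphXn fgX.
Qed.

Section PolyMpoly.
Variables (K : comNzRingType) (n : nat).
Local Notation widen := (widen_ord (leqnSn n)).

Definition mpoly_of_poly (p : {poly {mpoly K[n]}}) : {mpoly K[n.+1]} :=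
  (map_poly (@mwiden n K) p).['X_ord_max].

Lemma mpoly_of_poly_zmod : zmod_morphism mpoly_of_poly.
Proof. by move=> p q; rewrite /mpoly_of_poly rmorphB hornerD hornerN. Qed.
Lemma mpoly_of_poly_monoid : monoid_morphism mpoly_of_poly.
Proof.
by split=> [|p q]; rewrite /mpoly_of_poly ?rmorph1 ?hornerC// rmorphM hornerM.
Qed.
HB.instance Definition _ := GRing.isZmodMorphism.Build _ _ mpoly_of_poly mpoly_of_poly_zmod.
HB.instance Definition _ := GRing.isMonoidMorphism.Build _ _ mpoly_of_poly mpoly_of_poly_monoid.

Lemma muni_widen (i : 'I_n) : muni ('X_(widen i) : {mpoly K[n.+1]}) = ('X_i)%:P.
Proof.
rewrite /muni mmapX mmap1U; case: splitP => /= [j e|j]; last first.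
  by rewrite ord1 /= addn0 => e; have := ltn_ord i; rewrite e ltnn.
by congr ('X__)%:P; apply/val_inj; rewrite /= -e.
Qed.
Lemma muni_max : muni ('X_ord_max : {mpoly K[n.+1]}) = 'X.
Proof.
rewrite /muni mmapX mmap1U; case: splitP => //= j e.
by have := ltn_ord j; rewrite -e ltnn.
Qed.

Lemma muniK : cancel (@muni n K) mpoly_of_poly.
Proof.
move=> p; have := @mpoly_rmorph_ext K n.+1 _ (mpoly_of_poly \o (@muni n K)) idfun; apply.
  by move=> c; rewrite /= muniC /mpoly_of_poly map_polyC hornerC /= mwidenC.
move=> i /=; have [->|ni] := eqVneq i ord_max.
  by rewrite muni_max /mpoly_of_poly map_polyX hornerX.
have lt : (i < n)%N by rewrite ltn_neqAle -ltnS ltn_ord andbT.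
have -> : i = widen (Ordinal lt) by exact/val_inj.
by rewrite muni_widen /mpoly_of_poly map_polyC hornerC /= mwidenX mnmwiden1.
Qed.

Lemma mpoly_of_polyK : cancel mpoly_of_poly (@muni n K).
Proof.
have E c : muni (mwiden c : {mpoly K[n.+1]}) = c%:P.
  have := @mpoly_rmorph_ext K n _ ((@muni n K) \o (@mwiden n K)) polyC; apply.
    by move=> d /=; rewrite mwidenC muniC.
  by move=> i /=; rewrite mwidenX mnmwiden1 muni_widen.
elim/poly_ind => [|p c IHp]; first by rewrite !rmorph0.
rewrite !rmorphD !rmorphM /= IHp /mpoly_of_poly map_polyX hornerX muni_max.
by rewrite map_polyC hornerC /= E.
Qed.

End PolyMpoly.

Lemma Noeth_field (K : fieldType) : Noeth K.
Proof.
move=> J iJ; have [[x [Jx x0]]|nJ] := pselect (exists x, J x /\ x != 0).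
  exists [:: 1 : K^o] => y; split=> [_|_]; first by exists y; rewrite /GRing.scale /= mulr1 subrr.
  by rewrite -[y](mulfVK x0); exact: idealMl.
exists [::] => y; split=> [Jy|->]; last exact: ideal0.
by apply/eqP; apply: contra_notT nJ => y0; exists y.
Qed.

Lemma Noeth_mpoly (K : fieldType) n : Noeth {mpoly K[n]}.
Proof.
elim: n => [|n IHn].
  apply: (@Noeth_surj K _ (@mpolyC 0 K)); last exact: Noeth_field.
  move=> p; exists p@_0; apply/mpolyP => m; rewrite mcoeffC.
  have -> : m = 0%MM by apply/mnmP => -[].
  by rewrite eqxx mulr1.
apply: (@Noeth_surj _ _ (@mpoly_of_poly K n)); last exact: Noeth_poly.
by move=> p; exists (muni p); exact: muniK.
Qed.

(** * Submodules of free modules *)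

Section Matrices.
Variable A : comNzRingType.

(** Induction on the first coordinate: the first entries of the rows in [D] form an ideal [J], and
    the rows starting with 0 a submodule of smaller rank. Lifts [G] of generators of [J] are stacked
    over generators of the latter. *)
Lemma Noeth_rows n (D : 'rV[A]_n -> Prop) : Noeth A -> submod D ->
  exists (m : nat) (M : 'M[A]_(m, n)), forall x, D x <-> exists y, x = y *m M.
Proof.
move=> NA; elim: n D => [|n IHn] D sD.
  exists 0%N, 0 => x; split=> [_|_]; first by exists 0; rewrite [x]thinmx0 [RHS]thinmx0.
  by rewrite [x]thinmx0; case: sD.
have [D0 DD DZ] := sD.
pose J a := exists x : 'rV_n, D (row_mx (a%:M : 'M_1) x : 'rV_(1 + n)).
have iJ : ideal J.
  split=> [|a b [x Dx] [y Dy]|c a [x Dx]].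
  - by exists 0; rewrite raddf0 row_mx0.
  - by exists (x + y); rewrite raddfD -add_row_mx; exact: DD.
  - by exists (c *: x); rewrite /GRing.scale /= -scale_scalar_mx -scale_row_mx; exact: DZ.
have [s Js] := NA J iJ.
have [|m' [M' DM']] := IHn (fun x => D (row_mx (0 : 'M_1) x : 'rV_(1 + n))).
  split=> [|x y Dx Dy|c x Dx]; first by rewrite row_mx0.
    by rewrite -[0 in X in D X](addr0 (0 : 'M_1)) -add_row_mx; exact: DD.
  by rewrite -[0 in X in D X](scaler0 _ c) -scale_row_mx; exact: DZ.
have {}/choice[g gP] : forall i : 'I_(size s), exists x : 'rV_n,
    D (row_mx ((s`_i)%:M : 'M_1) x : 'rV_(1 + n)).
  by move=> i; apply/Js; apply: mem_Span; rewrite mem_nth.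
pose G : 'M[A]_(size s, 1 + n) := row_mx (\col_i s`_i) (\matrix_i g i).
have rowG i : row i G = row_mx ((s`_i)%:M : 'M_1) (g i).
  rewrite row_row_mx rowK; congr row_mx; apply/matrixP => a b.
  by rewrite !ord1 !mxE eqxx mulr1n.
exists (size s + m')%N, (col_mx G (row_mx (0 : 'M_(m', 1)) M')) => x; split=> [Dx|[y ->]].
  rewrite -[x](@hsubmxK _ 1 1 n) [lsubmx _]mx11_scalar in Dx *; set a := _ 0 0 in Dx *.
  have /Js/Span_sum[c cE] : J a by exists (@rsubmx _ 1 1 n x).
  pose y := \row_i c i.
  have yG : y *m G = row_mx (a%:M : 'M_1) (y *m \matrix_i g i).
    rewrite /G mul_mx_row; congr row_mx; apply/matrixP => i j.
    rewrite !ord1 !mxE eqxx mulr1n cE; apply: eq_bigr => k _; by rewrite !mxE.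
  have DyG : D (y *m G).
    rewrite mulmx_sum_row; apply: submod_sum => // i _; apply: DZ.
    by rewrite rowG; exact: gP.
  have /DM'[z zE] : D (row_mx (0 : 'M_1) (@rsubmx _ 1 1 n x - y *m \matrix_i g i) : 'rV_(1 + n)).
    rewrite -(subrr (a%:M : 'M_1)) -[X in D X]/(row_mx (_ + _) (_ + _)) -add_row_mx -opp_row_mx -yG.
    exact: submodB.
  exists (row_mx y z); rewrite mul_row_col yG.
  have -> : z *m row_mx (0 : 'M_(m', 1)) M' = row_mx (0 : 'M_1) (z *m M').
    by rewrite mul_mx_row mulmx0.
  rewrite -zE; set b := y *m _; set b' := _ - b.
  have E := add_row_mx (a%:M : 'M_1) b 0 b'.
  by rewrite [RHS]E addr0 subrKC.
rewrite -[y]hsubmxK mul_row_col; apply: DD.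
  by rewrite mulmx_sum_row; apply: submod_sum => // i _; apply: DZ; rewrite rowG; exact: gP.
have E := mul_mx_row (rsubmx y) (0 : 'M_(m', 1)) M'.
by rewrite E mulmx0; apply/DM'; exists (rsubmx y).
Qed.

End Matrices.

(** * Injective modules *)

Section Baer.
Variable A : comNzRingType.

Definition linear_on (N M : lmodType A) (D : N -> Prop) (phi : N -> M) : Prop :=
  (forall x y, D x -> D y -> phi (x + y) = phi x + phi y) /\
  (forall a x, D x -> phi (a *: x) = a *: phi x).

(** The submodule is a predicate and the partial map a total function that is linear on [D] only, so
    that no type of submodules has to be built. *)
Definition inj_ext (M : lmodType A) : Prop :=
  forall (N : lmodType A) (D : N -> Prop) (phi : N -> M), submod D -> linear_on D phi ->
    exists h : {linear N -> M}, forall x, D x -> h x = phi x.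

Lemma inj_ext_injective (M : lmodType A) : inj_ext M -> injective_module M.
Proof.
move=> iM P N f g finj.
have /choice[phi phiP] : forall y, exists m, forall x, f x = y -> m = g x.
  move=> y; have [[x fx]|nx] := pselect (exists x, f x = y).
    by exists (g x) => x'; rewrite -fx => /finj->.
  by exists 0 => x fx; case: nx; exists x.
have phiE x : phi (f x) = g x by exact: phiP.
have [||h hP] := iM N (fun y => exists x, f x = y) phi.
- split=> [|_ _ [x <-] [y <-]|a _ [x <-]]; first by exists 0; rewrite linear0.
    by exists (x + y); rewrite linearD.
  by exists (a *: x); rewrite linearZ.
- split=> [_ _ [x <-] [y <-]|a _ [x <-]]; first by rewrite -linearD !phiE linearD.
  by rewrite -linearZ !phiE linearZ.
by exists h => x; rewrite hP ?phiE//; exists x.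
Qed.

Section Criterion.
Variable M : lmodType A.
Hypothesis ideal_ext : forall (J : A -> Prop) (phi : A -> M), ideal J ->
  @linear_on A^o M J phi -> exists m, forall x, J x -> phi x = x *: m.
Variables (N : lmodType A) (D : N -> Prop) (phi : N -> M).
Hypotheses (sD : submod D) (lphi : linear_on D phi).

(** Partial extensions of [phi] are represented by their graphs, so that an upper bound of a chain
    is a union of sets; the second clause makes the relation single-valued. *)
Let graph (G : set (N * M)) : Prop :=
  [/\ submod G, forall m, G (0, m) -> m = 0 & forall x, D x -> G (x, phi x)].

(** The multipliers that send [x] into the domain of [G] form an ideal [J]; the hypothesis on ideals
    yields a value [m] for [x] that is compatible with [G] on the multiples of [x] by [J]. *)
Let graph_ext G x : graph G -> exists2 G', graph G' & (G `<=` G')%classic /\ exists m, G' (x, m).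
Proof.
move=> [sG G0 GD]; have [G00 GA GZ] := sG.
pose J a := exists m, G (a *: x, m).
have /choice[f fP] : forall a, exists m, J a -> G (a *: x, m).
  by move=> a; have [[m Gm]|nJ] := pselect (J a); [exists m|exists 0].
have funct y m m' : G (y, m) -> G (y, m') -> m = m'.
  move=> h h'; apply/eqP; rewrite -subr_eq0; apply/eqP; apply: G0.
  by rewrite -[0](subrr y); exact: (submodB sG h h').
have [||m mP] := @ideal_ext J f.
- split=> [|a b [m Gm] [m' Gm']|a b [m Gm]].
  + by exists 0; rewrite scale0r.
  + by exists (m + m'); rewrite scalerDl; exact: (GA _ _ Gm Gm').
  + by exists (a *: m); rewrite -scalerA; exact: (GZ a _ Gm).
- split=> [a b Ja Jb|a b Jb].
  + apply: (funct ((a + b) *: x)); last first.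
      by rewrite scalerDl; exact: (GA _ _ (fP _ Ja) (fP _ Jb)).
    by apply: (fP); exists (f a + f b); rewrite scalerDl; exact: (GA _ _ (fP _ Ja) (fP _ Jb)).
  + have H : G ((a * b) *: x, a *: f b) by rewrite -scalerA; exact: (GZ a _ (fP _ Jb)).
    by apply: (funct ((a * b) *: x)) => //; apply: (fP); exists (a *: f b).
pose G' (z : N * M) := exists a, G (z - (a *: x, a *: m)).
exists G'; last split.
- split; first split.
  + by exists 0; rewrite !scale0r subr0.
  + move=> y z [a Ga] [b Gb]; exists (a + b); rewrite !scalerDl.
    by have := GA _ _ Ga Gb; rewrite addrACA -opprD.
  + move=> a y [b Gb]; exists (a * b); rewrite -!scalerA.
    by have := GZ a _ Gb; rewrite scalerBr.
  + move=> m' [a H]; have {}H : G (a *: x, a *: m - m').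
      have -> : (a *: x, a *: m - m') = - ((0, m') - (a *: x, a *: m)).
        by rewrite opprB; congr pair; rewrite /= subr0.
      exact: submodN.
    have Ja : J a by exists (a *: m - m').
    have := funct _ _ _ H (fP _ Ja); rewrite mP// => /eqP.
    by rewrite subr_eq addrC -subr_eq subrr eq_sym => /eqP.
  + by move=> y Dy; exists 0; rewrite !scale0r subr0; exact: GD.
- by move=> z Gz; exists 0; rewrite !scale0r subr0.
- by exists m, 1; rewrite !scale1r subrr.
Qed.

Lemma baer_criterion : exists h : {linear N -> M}, forall x, D x -> h x = phi x.
Proof.
pose G0 : set (N * M) := fun z => D z.1 /\ z.2 = phi z.1.
have [lA lZ] := lphi; have [D0 DA DZ] := sD.
have phi0 : phi 0 = 0 by rewrite -(scale0r 0) lZ// scale0r.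
have gG0 : graph G0.
  split=> [|m [/= _ ->]|x Dx]; [|exact: phi0|by split].
  split; first by split; rewrite //= phi0.
    by move=> [x m] [y m'] [/= Dx ->] [/= Dy ->]; split=> /=; [exact: DA|rewrite lA].
  by move=> a [x m] [/= Dx ->]; split=> /=; [exact: DZ|rewrite lZ].
have [] := @Zorn_bigcup _ (fun X => X = set0 \/ graph X).
  move=> F FP tot; have [[X FX gX]|nX] := pselect (exists2 X, F X & graph X); last first.
    left; apply/seteqP; split=> // z [X FX Xz]; case: (FP X FX) => [X0|gX].
      by move: Xz; rewrite X0.
    by case: nX; exists X.
  right; split.
  - split; first by exists X => //; case: gX => -[].
      move=> y z [Y FY Yy] [Z FZ Zz].
      have sub W w : F W -> W w -> submod W.
        by move=> /FP[->|[]].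
      case: (tot Y Z FY FZ) => h.
        by exists Z => //; case: (sub _ _ FZ Zz) => _ + _; apply=> //; exact: h.
      by exists Y => //; case: (sub _ _ FY Yy) => _ + _; apply=> //; exact: h.
    move=> a y [Y FY Yy]; exists Y => //; case: (FP Y FY) => [Y0|[[_ _ YZ] _ _]].
      by move: Yy; rewrite Y0.
    exact: YZ.
  - move=> m [Y FY Ym]; case: (FP Y FY) => [Y0|[_ YZ _]]; last exact: YZ.
    by move: Ym; rewrite Y0.
  - by move=> x Dx; exists X => //; case: gX => _ _; exact.
move=> G [[->|gG] Gmax].
  exfalso; apply: (Gmax G0); last by right.
  by split=> // /(_ (0, 0)); apply; split; rewrite //= phi0.
have tot x : exists m, G (x, m).
  have [G' gG' [GG' G'x]] := graph_ext x gG; apply: contrapT => nx.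
  apply: (Gmax G'); last by right.
  by split=> // h; apply: nx; have [m /h] := G'x; exists m.
have [h hP] := choice tot; have [sG Gz GD] := gG.
have funct y m m' : G (y, m) -> G (y, m') -> m = m'.
  move=> g g'; apply/eqP; rewrite -subr_eq0; apply/eqP; apply: Gz.
  by rewrite -[0](subrr y); exact: (submodB sG g g').
have hlin : linear h.
  move=> a x y; apply: funct (hP _) _; case: sG => _ GA GZ.
  exact: (GA _ _ (GZ a _ (hP x)) (hP y)).
pose hL := GRing.isLinear.Build A N M *:%R h hlin.
pose hh : {linear N -> M} := HB.pack h hL.
by exists hh => x Dx; exact: (funct x (h x) (phi x) (hP x) (GD x Dx)).
Qed.

End Criterion.

Lemma baer (M : lmodType A) :
  (forall (J : A -> Prop) (phi : A -> M), ideal J -> @linear_on A^o M J phi ->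
     exists m, forall x, J x -> phi x = x *: m) -> inj_ext M.
Proof. by move=> H N D phi sD lphi; exact: baer_criterion. Qed.

End Baer.

Lemma vector_space_inj_ext (K : fieldType) (V : lmodType K) : inj_ext V.
Proof.
apply: baer => J phi iJ [_ lZ].
have [[x [Jx x0]]|nJ] := pselect (exists x, J x /\ x != 0).
  exists (x^-1 *: phi x) => y Jy; rewrite scalerA -lZ//; congr phi.
  by rewrite /GRing.scale /= mulfVK.
exists 0 => x Jx; have -> : x = 0 by apply/eqP; apply: contra_notT nJ => x0; exists x.
by rewrite scaler0; have := lZ 0 0 (ideal0 iJ); rewrite scaler0 scale0r.
Qed.

(** * Restriction of scalars and coinduced modules *)

Section Restriction.
Variables (K A : comNzRingType) (kap : {rmorphism K -> A}) (M : lmodType A).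

(** The [let] makes the type depend on [kap], so that the action of [K] through [kap] can be
    attached to it as a canonical structure. *)
Definition restr : Type := let _ := kap in M.
HB.instance Definition _ := GRing.Zmodule.on restr.
Definition restr_scale (c : K) (x : restr) : restr := kap c *: (x : M).
Lemma restr_scaleA a b v : restr_scale a (restr_scale b v) = restr_scale (a * b) v.
Proof. by rewrite /restr_scale scalerA rmorphM. Qed.
Lemma restr_scale1 : left_id 1 restr_scale.
Proof. by move=> v; rewrite /restr_scale rmorph1 scale1r. Qed.
Lemma restr_scaleDr : right_distributive restr_scale +%R.
Proof. by move=> a x y; exact: scalerDr. Qed.
Lemma restr_scaleDl v : {morph restr_scale^~ v : a b / a + b}.
Proof. by move=> a b; rewrite /restr_scale rmorphD; exact: scalerDl. Qed.
HB.instance Definition _ := GRing.Zmodule_isLmodule.Build K restr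
  restr_scaleA restr_scale1 restr_scaleDr restr_scaleDl.
End Restriction.

Section Coinduced.
Variables (K : fieldType) (A : comNzRingType) (kap : {rmorphism K -> A}) (M : lmodType A).

Definition klin (f : A -> M) : Prop :=
  (forall x y, f (x + y) = f x + f y) /\ (forall c x, f (kap c * x) = kap c *: f x).

Record coind := Coind { cfun :> A -> M; cfunP : klin cfun }.

Lemma coind_eq (f g : coind) : cfun f =1 cfun g -> f = g.
Proof.
case: f g => [f fP] [g gP] /= /funext fg; move: fP gP; rewrite fg => fP gP.
by rewrite (Prop_irrelevance fP gP).
Qed.
HB.instance Definition _ := gen_eqMixin coind.
HB.instance Definition _ := gen_choiceMixin coind.

Lemma klin0 : klin (fun=> 0).
Proof. by split=> [x y|c x]; rewrite ?addr0 ?scaler0. Qed.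
Lemma klinD f g : klin f -> klin g -> klin (fun x => f x + g x).
Proof.
move=> [fD fZ] [gD gZ]; split=> [x y|c x]; first by rewrite fD gD addrACA.
by rewrite fZ gZ scalerDr.
Qed.
Lemma klinN f : klin f -> klin (fun x => - f x).
Proof. by move=> [fD fZ]; split=> [x y|c x]; rewrite ?fD ?fZ ?opprD ?scalerN. Qed.
Lemma klinM a f : klin f -> klin (fun x => f (x * a)).
Proof. by move=> [fD fZ]; split=> [x y|c x]; rewrite ?mulrDl -?mulrA ?fD ?fZ. Qed.
Lemma klin_scale m : klin (fun x => x *: m).
Proof. by split=> [x y|c x]; rewrite ?scalerDl ?scalerA. Qed.

Definition coind0 := Coind klin0.
Definition coindD (f g : coind) := Coind (klinD (cfunP f) (cfunP g)).
Definition coindN (f : coind) := Coind (klinN (cfunP f)).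
Lemma coindDA : associative coindD. Proof. by move=> f g h; apply: coind_eq => x /=; rewrite addrA. Qed.
Lemma coindDC : commutative coindD. Proof. by move=> f g; apply: coind_eq => x /=; rewrite addrC. Qed.
Lemma coind0D : left_id coind0 coindD. Proof. by move=> f; apply: coind_eq => x /=; rewrite add0r. Qed.
Lemma coindND : left_inverse coind0 coindN coindD.
Proof. by move=> f; apply: coind_eq => x /=; rewrite addNr. Qed.
HB.instance Definition _ := GRing.isZmodule.Build coind coindDA coindDC coind0D coindND.

Definition coindZ a (f : coind) := Coind (klinM a (cfunP f)).
Lemma coindZA a b f : coindZ a (coindZ b f) = coindZ (a * b) f.
Proof. by apply: coind_eq => x /=; rewrite mulrA. Qed.
Lemma coindZ1 : left_id 1 coindZ. Proof. by move=> f; apply: coind_eq => x /=; rewrite mulr1. Qed.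
Lemma coindZDr : right_distributive coindZ +%R. Proof. by move=> a f g; exact: coind_eq. Qed.
Lemma coindZDl f : {morph coindZ^~ f : a b / a + b}.
Proof. by move=> a b; apply: coind_eq => x /=; rewrite mulrDr (cfunP f).1. Qed.
HB.instance Definition _ := GRing.Zmodule_isLmodule.Build A coind coindZA coindZ1 coindZDr coindZDl.

(** [coind] is Hom_K(A, M), and evaluation at 1 identifies A-linear maps into it with K-linear maps
    into [M]; the extension problem becomes one for vector spaces. *)
Lemma coind_inj_ext : inj_ext coind.
Proof.
move=> N D phi sD [lD lZ].
have sD' : @submod K (restr kap N) D by case: sD => D0 DA DZ; split=> // c x; exact: DZ.
have [|h hP] := @vector_space_inj_ext K (restr kap M) (restr kap N) D (fun n => phi n 1) sD'.
  split=> [x y Dx Dy|c x Dx]; first by rewrite lD.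
  by have := congr1 (fun f : coind => f 1) (lZ (kap c) x Dx) => /= ->; rewrite mul1r -(mulr1 (kap c)) (cfunP (phi x)).2.
pose h' (x : N) : M := h x.
have h'D x y : h' (x + y) = h' x + h' y := raddfD h x y.
have h'Z c x : h' (kap c *: x) = kap c *: h' x := linearZ_LR h c x.
have kl x : klin (fun a => h' (a *: x)).
  by split=> [a b|c a]; rewrite ?scalerDl ?h'D// -scalerA h'Z.
pose H x := Coind (kl x).
have Hlin : linear H.
  move=> a x y; apply: coind_eq => b /=.
  by rewrite scalerDr h'D !scalerA.
pose HL := GRing.isLinear.Build A N coind *:%R H Hlin.
exists (HB.pack H HL : {linear N -> coind}) => x Dx; apply: coind_eq => a /=.
have Dax : D (a *: x) by case: sD => _ _; exact.
have -> : h' (a *: x) = phi (a *: x) 1 := hP _ Dax.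
by rewrite lZ//= mul1r.
Qed.

Record cokc := Cokc { kfun :> A -> M; kfunP : klin kfun; kfun1 : kfun 1 = 0 }.

Lemma cokc_eq (f g : cokc) : kfun f =1 kfun g -> f = g.
Proof.
case: f g => [f fP f1] [g gP g1] /= /funext fg; move: fP f1 gP g1; rewrite fg => fP f1 gP g1.
by rewrite (Prop_irrelevance fP gP) (Prop_irrelevance f1 g1).
Qed.
HB.instance Definition _ := gen_eqMixin cokc.
HB.instance Definition _ := gen_choiceMixin cokc.

Definition cokc0 := Cokc klin0 erefl.
Lemma cokcD1 (f g : cokc) : f 1 + g 1 = 0. Proof. by rewrite !kfun1 addr0. Qed.
Lemma cokcN1 (f : cokc) : - f 1 = 0. Proof. by rewrite kfun1 oppr0. Qed.
Definition cokcD (f g : cokc) := Cokc (klinD (kfunP f) (kfunP g)) (cokcD1 f g).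
Definition cokcN (f : cokc) := Cokc (klinN (kfunP f)) (cokcN1 f).
Lemma cokcDA : associative cokcD. Proof. by move=> f g h; apply: cokc_eq => x /=; rewrite addrA. Qed.
Lemma cokcDC : commutative cokcD. Proof. by move=> f g; apply: cokc_eq => x /=; rewrite addrC. Qed.
Lemma cokc0D : left_id cokc0 cokcD. Proof. by move=> f; apply: cokc_eq => x /=; rewrite add0r. Qed.
Lemma cokcND : left_inverse cokc0 cokcN cokcD.
Proof. by move=> f; apply: cokc_eq => x /=; rewrite addNr. Qed.
HB.instance Definition _ := GRing.isZmodule.Build cokc cokcDA cokcDC cokc0D cokcND.

(* The cokernel of [M -> coind] is identified with [{f | f 1 = 0}] through [f |-> f - f 1]; the
   module structure is transported along this identification. *)
Lemma cokcZ1_ a (f : A -> M) : f (1 * a) - 1 *: f a = 0.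
Proof. by rewrite mul1r scale1r subrr. Qed.
Definition cokcZ a (f : cokc) : cokc :=
  Cokc (klinD (klinM a (kfunP f)) (klinN (klin_scale (f a)))) (cokcZ1_ a f).
Lemma cokcZA a b f : cokcZ a (cokcZ b f) = cokcZ (a * b) f.
Proof.
apply: cokc_eq => x /=; rewrite scalerBr scalerA opprB addrCA addrC mulrA.
by rewrite [_ - _ + _]addrAC subrK.
Qed.
Lemma cokcZ1 : left_id 1 cokcZ.
Proof. by move=> f; apply: cokc_eq => x /=; rewrite mulr1 kfun1 scaler0 subr0. Qed.
Lemma cokcZDr : right_distributive cokcZ +%R.
Proof. by move=> a f g; apply: cokc_eq => x /=; rewrite scalerDr opprD addrACA. Qed.
Lemma cokcZDl f : {morph cokcZ^~ f : a b / a + b}.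
Proof.
move=> a b; apply: cokc_eq => x /=.
by rewrite mulrDr !(kfunP f).1 scalerDr opprD addrACA.
Qed.
HB.instance Definition _ := GRing.Zmodule_isLmodule.Build A cokc cokcZA cokcZ1 cokcZDr cokcZDl.

Definition coind_in (m : M) : coind := Coind (klin_scale m).
Lemma coind_in_linear : linear coind_in.
Proof. by move=> a m m'; apply: coind_eq => x /=; rewrite scalerDr scalerA. Qed.
HB.instance Definition _ := GRing.isLinear.Build A M coind *:%R coind_in coind_in_linear.

Lemma coind_out1 (f : A -> M) : f 1 - 1 *: f 1 = 0. Proof. by rewrite scale1r subrr. Qed.
Definition coind_out (f : coind) : cokc :=
  Cokc (klinD (cfunP f) (klinN (klin_scale (f 1)))) (coind_out1 f).
Lemma coind_out_linear : linear coind_out.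
Proof.
move=> a f g; apply: cokc_eq => x /=; rewrite !mul1r scalerDr opprD addrACA; congr (_ + _).
by rewrite scalerBr scalerA opprB addrA subrK.
Qed.
HB.instance Definition _ := GRing.isLinear.Build A coind cokc *:%R coind_out coind_out_linear.

Lemma coind_in_inj : injective coind_in.
Proof. by move=> m m' /(congr1 (fun f : coind => f 1)) /=; rewrite !scale1r. Qed.
Lemma coind_out_surj g : exists f, g = coind_out f.
Proof.
by exists (Coind (kfunP g)); apply: cokc_eq => x /=; rewrite kfun1 scaler0 subr0.
Qed.
Lemma coind_exact f : coind_out f = 0 <-> exists m, f = coind_in m.
Proof.
split=> [/(congr1 kfun) f0|[m ->]].
  exists (f 1); apply: coind_eq => x /=.
  by apply/eqP; rewrite -subr_eq0; apply/eqP; exact: (congr1 (@^~ x) f0).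
by apply: cokc_eq => x /=; rewrite scale1r subrr.
Qed.

End Coinduced.

(** * Finite injective resolutions *)

Section Tuples.
Variables (A : comNzRingType) (M : lmodType A).

(** A tuple [f] is a linear map from the rows of length [q] to [M], given on the standard basis;
    [mxact D f] is its composite with x |-> x *m D. *)
Definition mxact p q (D : 'M[A]_(p, q)) (f : 'I_q -> M) (j : 'I_p) : M := \sum_k D j k *: f k.

Lemma mxactB p q (D : 'M[A]_(p, q)) f g j :
  mxact D (fun i => f i - g i) j = mxact D f j - mxact D g j.
Proof. by rewrite -sumrB; apply: eq_bigr => k _; rewrite scalerBr. Qed.

Lemma mxact_mul p q r (D : 'M[A]_(p, q)) (D' : 'M[A]_(q, r)) f j :
  mxact (D *m D') f j = mxact D (mxact D' f) j.
Proof.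
rewrite /mxact; under [RHS]eq_bigr do rewrite scaler_sumr.
rewrite exchange_big; apply: eq_bigr => k _; rewrite mxE scaler_suml.
by apply: eq_bigr => i _; rewrite scalerA.
Qed.

Lemma mxact0 p q f j : mxact (0 : 'M_(p, q)) f j = 0.
Proof. by rewrite /mxact big1// => k _; rewrite mxE scale0r. Qed.

Lemma mxact_ext p q (D : 'M[A]_(p, q)) f g j : f =1 g -> mxact D f j = mxact D g j.
Proof. by move=> fg; apply: eq_bigr => k _; rewrite fg. Qed.

(** By the hypothesis [f] induces a well-defined map on the row space of [D]; the values on the
    basis of an extension to all rows solve the system. *)
Lemma inj_ext_solve p q (D : 'M[A]_(p, q)) (f : 'I_p -> M) : inj_ext M ->
  (forall x : 'rV_p, x *m D = 0 -> \sum_j x 0 j *: f j = 0) ->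
  exists g, forall j, f j = mxact D g j.
Proof.
move=> iM H.
have funct (x y : 'rV_p) : x *m D = y *m D -> \sum_j x 0 j *: f j = \sum_j y 0 j *: f j.
  move=> e; apply/eqP; rewrite -subr_eq0 -sumrB; apply/eqP; rewrite -[RHS](H (x - y)).
    by apply: eq_bigr => j _; rewrite !mxE scalerBl.
  by rewrite mulmxBl e subrr.
have /choice[phi phiP] : forall y : 'rV_q, exists m, forall x, y = x *m D -> m = \sum_j x 0 j *: f j.
  move=> y; have [[x yE]|ny] := pselect (exists x, y = x *m D).
    by exists (\sum_j x 0 j *: f j) => x' yE'; apply: funct; rewrite -yE.
  by exists 0 => x yE; case: ny; exists x.
have [||h hP] := iM _ (fun y => exists x, y = x *m D) phi.
- split=> [|_ _ [x ->] [y ->]|a _ [x ->]]; first by exists 0; rewrite mul0mx.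
    by exists (x + y); rewrite mulmxDl.
  by exists (a *: x); rewrite scalemxAl.
- split=> [_ _ [x ->] [y ->]|a _ [x ->]].
    rewrite (phiP _ (x + y)) ?mulmxDl// (phiP _ x)// (phiP _ y)// -big_split.
    by apply: eq_bigr => j _; rewrite mxE scalerDl.
  rewrite (phiP _ (a *: x)) -?scalemxAl// (phiP _ x)// scaler_sumr.
  by apply: eq_bigr => j _; rewrite mxE scalerA.
exists (fun i => h (delta_mx 0 i)) => j.
have := hP _ (ex_intro _ (delta_mx 0 j) erefl); rewrite (phiP _ (delta_mx 0 j))//.
rewrite (bigD1 j)//= mxE !eqxx scale1r big1 ?addr0 => [<-|i ij]; last first.
  by rewrite mxE eqxx (negbTE ij) scale0r.
rewrite -rowE [row j D]row_sum_delta linear_sum; apply: eq_bigr => k _.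
by rewrite linearZ mxE.
Qed.

End Tuples.

(* [ev_exact M D k] says that [Hom(D, M)] is exact at the free module of index [k + 1]. *)
Section DualExactness.
Variables (A : comNzRingType) (n : nat -> nat) (D : forall i, 'M[A]_(n i.+1, n i)).

Definition mx_exact : Prop :=
  (forall i, D i.+1 *m D i = 0) /\
  (forall i (x : 'rV_(n i.+1)), x *m D i = 0 -> exists y, x = y *m D i.+1).

Definition ev_exact (M : lmodType A) (k : nat) : Prop :=
  forall f : 'I_(n k.+1) -> M, (forall j, mxact (D k.+1) f j = 0) ->
    exists g, forall j, f j = mxact (D k) g j.

Hypothesis Dex : mx_exact.

Lemma inj_ext_ev_exact (M : lmodType A) k : inj_ext M -> ev_exact M k.
Proof.
move=> iM f f0; apply: inj_ext_solve => // x /Dex.2[y ->].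
transitivity (mxact y (mxact (D k.+1) f) 0); first by rewrite -mxact_mul.
by rewrite /mxact big1// => j _; have := f0 j; rewrite /mxact => ->; rewrite scaler0.
Qed.

(** Dimension shifting. The obstruction to lifting a cocycle from [C] to [E] is a cocycle one degree
    higher with values in [M]; it bounds, which allows the lift to be corrected, and cocycles with
    values in [E] bound. *)
Lemma ev_exact_shift (M E C : lmodType A) (e : {linear M -> E}) (p : {linear E -> C}) k :
  inj_ext E -> injective e -> (forall c, exists x, c = p x) ->
  (forall x, p x = 0 <-> exists m, x = e m) -> ev_exact M k.+1 -> ev_exact C k.
Proof.
move=> iE einj psurj ex evM f f0.
have /choice[f' f'P] : forall j, exists x, f j = p x by move=> j; exact: psurj.
have lin_act (V W : lmodType A) (h : {linear V -> W}) a b (Dm : 'M[A]_(a, b)) v j :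
    h (mxact Dm v j) = mxact Dm (fun i => h (v i)) j.
  by rewrite linear_sum; apply: eq_bigr => i _; rewrite linearZ.
have /choice[f0' f0'P] : forall j, exists m, mxact (D k.+1) f' j = e m.
  move=> j; apply/ex; rewrite lin_act -[RHS](f0 j); apply: mxact_ext => i; by rewrite f'P.
have [|f1 f1P] := evM f0'.
  move=> j; apply: einj; rewrite lin_act linear0.
  rewrite -(mxact_ext _ _ f0'P) -mxact_mul Dex.1; exact: mxact0.
have [|g gP] := @inj_ext_ev_exact E k iE (fun i => f' i - e (f1 i)).
  move=> j; rewrite mxactB f0'P f1P lin_act; exact: subrr.
exists (fun i => p (g i)) => j; rewrite -lin_act -gP linearB -f'P.
have -> : p (e (f1 j)) = 0 by apply/ex; exists (f1 j).
by rewrite subr0.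
Qed.

End DualExactness.

(* The two alternatives of the last field make an iteration of such steps stop as soon as an
   injective module is reached. *)
Record coresol (A : comNzRingType) (M : lmodType A) := Coresol {
  cE : lmodType A; cC : lmodType A; ce : {linear M -> cE}; cp : {linear cE -> cC};
  ce_inj : injective ce;
  cp_surj : forall c, exists x, c = cp x;
  c_exact : forall x, cp x = 0 <-> exists m, x = ce m;
  cE_inj : inj_ext cE;
  c_stop : inj_ext M -> forall x : cC, x = 0;
  c_triv : (forall x : M, x = 0) -> forall x : cE, x = 0 }.

Lemma triv_inj_ext (A : comNzRingType) (M : lmodType A) : (forall x : M, x = 0) -> inj_ext M.
Proof.
move=> M0 N D phi _ _; exists \0%R => x _; by rewrite [RHS]M0.
Qed.

Section FiniteResolution.
Variables (K : fieldType) (A : comNzRingType) (kap : {rmorphism K -> A}).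

Definition coresol_step (M : lmodType A) : coresol M.
Proof.
have [iM|nM] := pselect (inj_ext M).
  apply: (@Coresol A M M 'rV[A]_0 idfun \0%R) => //.
  - by move=> c; exists 0; rewrite thinmx0 /=; apply/esym; exact: thinmx0.
  - by move=> x; split=> [_|_]; [exists x|exact: thinmx0].
  - by move=> _ x; exact: thinmx0.
apply: (@Coresol A M (coind kap M) (cokc kap M) (@coind_in _ _ kap M) (@coind_out _ _ kap M)).
- exact: coind_in_inj.
- exact: coind_out_surj.
- exact: coind_exact.
- exact: coind_inj_ext.
- by move=> /nM.
- by move=> M0 x; apply: coind_eq => a; rewrite [LHS]M0.
Qed.

(** A free resolution of A/J. Rank one in degree 0 is expressed by a unique index [i0], so that no
    cast along [n 0 = 1] is needed. *)
Definition resolves (J : A -> Prop) (n : nat -> nat) (D : forall i, 'M[A]_(n i.+1, n i)) : Prop :=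
  mx_exact D /\ exists i0 : 'I_(n 0), (forall j, j = i0) /\
    forall a, J a <-> exists y : 'rV_(n 1), (y *m D 0) 0 i0 = a.
Arguments resolves J n D : clear implicits.

(** Exactness at this place is Ext^1(A/J, M) = 0: a map from [J] to [M], read on the generators in
    [D 0], kills the syzygies and is therefore given by one element of [M], which is Baer's
    condition. *)
Lemma ev_exact_baer (M : lmodType A) :
  (forall J, ideal J -> exists n D, resolves J n D /\ ev_exact D M 0) -> inj_ext M.
Proof.
move=> H; apply: baer => J phi iJ [pD pZ].
have [n [D [[[Dc Dex] [i0 [i0u JE]]] ev]]] := H J iJ.
have JD j : J (D 0 j i0).
  by apply/JE; exists (delta_mx 0 j); rewrite -rowE mxE.
have phisum (I : finType) (c : I -> A) (x : I -> A) : (forall i, J (x i)) ->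
    phi (\sum_i c i * x i) = \sum_i c i *: phi (x i).
  move=> Jx; elim: index_enum => [|i s IHs].
    by rewrite !big_nil; have := pZ 0 0 (ideal0 iJ); rewrite !scale0r.
  rewrite !big_cons pD ?IHs.
  - by congr (_ + _); exact: pZ.
  - exact: idealMl.
  - by apply: ideal_sum => // k _; exact: idealMl.
have [|g gP] := ev (fun j => phi (D 0 j i0)).
  move=> j; rewrite /mxact -phisum//.
  have := congr1 (fun X : 'M_(_, _) => X j i0) (Dc 0); rewrite !mxE => ->.
  by have := pZ 0 0 (ideal0 iJ); rewrite !scale0r.
exists (g i0) => a /JE[y <-]; rewrite mxE phisum// scaler_suml; apply: eq_bigr => j _.
rewrite gP /mxact (bigD1 i0)//= big1 ?addr0 ?scalerA// => k.
by rewrite (i0u k) eqxx.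
Qed.

Fixpoint cosyz (M : lmodType A) (i : nat) : lmodType A :=
  if i is i'.+1 then cC (coresol_step (cosyz M i')) else M.

(** Shifting [k] times turns the hypothesis into Baer's condition for the [k]-th cosyzygy. Being
    injective, this module ends the resolution by the stopping clause of [coresol]. *)
Theorem finite_resolution (M : lmodType A) (k : nat) :
  (forall J, ideal J -> exists n D, resolves J n D /\ ev_exact D M k) ->
  exists (E : nat -> lmodType A) (e : {linear M -> E 0}) (d : forall i, {linear E i -> E i.+1}),
   [/\ [/\ forall i, inj_ext (E i), injective e & forall y, d 0 y = 0 <-> exists x, y = e x],
       forall i y, d i.+1 y = 0 <-> exists x, y = d i x
     & forall i, (k < i)%N -> forall x : E i, x = 0].
Proof.
move=> H; pose N i := coresol_step (cosyz M i).
pose d i : {linear cE (N i) -> cE (N i.+1)} := ce (N i.+1) \o cp (N i).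
have d0 i y : d i y = 0 <-> exists x, y = ce (N i) x.
  rewrite -c_exact /d /=; split=> [h|->]; last exact: linear0.
  by apply: (@ce_inj _ _ (N i.+1)); rewrite h linear0.
exists (fun i => cE (N i)), (ce (N 0%N)), d; split; first split.
- by move=> i; exact: cE_inj.
- exact: ce_inj.
- exact: d0.
- move=> i y; rewrite d0; split=> [[x ->]|[x ->]]; last by exists (cp (N i) x).
  by have [z ->] := cp_surj x; exists z.
have injk : inj_ext (cosyz M k).
  apply: ev_exact_baer => J iJ; have [n [D [DJ ev]]] := H J iJ; exists n, D; split=> //.
  have : forall i, (i <= k)%N -> ev_exact D (cosyz M i) (k - i).
    elim=> [|i IHi] ik; first by rewrite subn0.
    apply: (@ev_exact_shift _ _ _ DJ.1 _ _ _ (ce (N i)) (cp (N i))).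
    - exact: cE_inj.
    - exact: ce_inj.
    - exact: cp_surj.
    - exact: c_exact.
    - by rewrite subnSK//; apply: IHi; exact: ltnW.
  by move/(_ k (leqnn k)); rewrite subnn.
have triv j : forall x : cosyz M (k.+1 + j), x = 0.
  elim: j => [|j IHj]; first by rewrite addn0 => x; exact: (c_stop injk).
  by rewrite addnS => x; apply: (c_stop (triv_inj_ext IHj)).
by move=> i ki; rewrite -(subnKC ki); apply: c_triv; exact: triv.
Qed.

Corollary finite_injective_dimension_ev (k : nat) :
  (forall J, ideal J -> exists n D, resolves J n D /\ ev_exact D (A^o : lmodType A) k) ->
  finite_injective_dimension (A^o : lmodType A).
Proof.
move=> /finite_resolution[E [e [d [[iE einj e0] dd dtriv]]]].
exists k, E, e, d; split=> // i; exact: inj_ext_injective.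
Qed.

Lemma Noeth_resolution J : Noeth A -> ideal J -> exists n D, resolves J n D.
Proof.
move=> NA iJ.
pose St := {q : nat & {p : nat & 'M[A]_(p, q)}}.
have kerP (st : St) : exists M : {p' : nat & 'M[A]_(p', projT1 (projT2 st))},
    forall x : 'rV_(projT1 (projT2 st)), x *m projT2 (projT2 st) = 0 <-> exists y, x = y *m projT2 M.
  have [|m [M MP]] := @Noeth_rows A _ (fun x => x *m projT2 (projT2 st) = 0) NA.
    by split=> [|x y xD yD|a x xD]; rewrite ?mul0mx ?mulmxDl ?xD ?yD ?addr0// -scalemxAl xD scaler0.
  by exists (existT _ m M).
pose ker st := sval (cid (kerP st)).
have kerE st : forall x : 'rV_(projT1 (projT2 st)), x *m projT2 (projT2 st) = 0 <->
    exists y, x = y *m projT2 (ker st) := svalP (cid (kerP st)).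
have [s Js] := NA J iJ.
pose st0 : St := existT _ 1%N (existT _ (size s) (\col_i s`_i)).
(* The column number of the next matrix is by computation the row number of the present one, so the
   matrices fit together without casts. *)
pose next (st : St) : St := existT _ (projT1 (projT2 st)) (ker st).
pose st := fix st i := if i is i'.+1 then next (st i') else st0.
exists (fun i => projT1 (st i)), (fun i => projT2 (projT2 (st i))); split; first split.
- move=> i; apply/row_matrixP => j; rewrite row0 rowE mulmxA.
  by apply/(kerE (st i)); exists (delta_mx 0 j).
- by move=> i x /(kerE (st i)).
exists (ord0 : 'I_1); split=> [j|a]; first exact: ord1.
split=> [/Js/Span_sum[c ->]|[y <-]].
  by exists (\row_i c i); rewrite mxE; apply: eq_bigr => i _; rewrite !mxE.
rewrite mxE; apply: ideal_sum => // i _; apply: idealMl => //=.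
by rewrite mxE; apply/Js; apply: mem_Span; rewrite mem_nth.
Qed.

End FiniteResolution.

(** * Ext over a polynomial ring *)

(* Ext vanishes over a polynomial ring above the number of variables. Starting from a linear splitting over
   the field, the splitting is made to commute with one variable at a time: if [g] splits a cocycle,
   then [X g - g X] is a cocycle one degree lower, hence [h d], and [X k - k X = h] is solvable on
   a free module. *)
Section Syzygy.
Variables (K : fieldType) (v : nat).
Local Notation S := {mpoly K[v]}.

Definition klinear (V : lmodType S) (f : V -> S) : Prop :=
  (forall x y, f (x + y) = f x + f y) /\ (forall c x, f (c%:MP *: x) = c%:MP * f x).

Definition partial_lin (j : nat) (V : lmodType S) (f : V -> S) : Prop :=
  klinear f /\ forall i : 'I_v, (i < j)%N -> forall x, f ('X_i *: x) = 'X_i * f x.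

Lemma klinear0 (V : lmodType S) (f : V -> S) : klinear f -> f 0 = 0.
Proof. by move=> [_ fZ]; have := fZ 0 0; rewrite scaler0 rmorph0 mul0r. Qed.

Lemma klinear_sum (V : lmodType S) (f : V -> S) I (r : seq I) P (F : I -> V) : klinear f ->
  f (\sum_(i <- r | P i) F i) = \sum_(i <- r | P i) f (F i).
Proof.
move=> kf; apply: (big_morph f); first exact: kf.1.
exact: klinear0.
Qed.

Lemma klinear_ext (f g : S^o -> S) : klinear f -> klinear g ->
  (forall m, f 'X_[m] = g 'X_[m]) -> f =1 g.
Proof.
move=> kf kg fg s; rewrite [s]mpolyE !klinear_sum//; apply: eq_bigr => m _.
rewrite -mul_mpolyC; have := kf.2 s@_m 'X_[m]; rewrite /GRing.scale /= => ->.
by have := kg.2 s@_m 'X_[m]; rewrite /GRing.scale /= => ->; rewrite fg.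
Qed.

Section LinearExtension.
Variable k0 : 'X_{1..v} -> S.
Definition lext (s : S) : S := \sum_(m <- msupp s) s@_m *: k0 m.

Lemma lext_big s r : uniq r -> {subset msupp s <= r} -> lext s = \sum_(m <- r) s@_m *: k0 m.
Proof.
move=> ur sr; rewrite [RHS](bigID (mem (msupp s))) /= [X in _ + X]big1 ?addr0; last first.
  by move=> m /memN_msupp_eq0->; rewrite scale0r.
rewrite -big_filter /lext; apply: perm_big; apply: uniq_perm.
- exact: msupp_uniq.
- exact: filter_uniq.
- by move=> m; rewrite mem_filter; case: (boolP (m \in msupp s)) => // /sr->.
Qed.

Lemma lext_klinear : @klinear S^o lext.
Proof.
split=> [s t|c s].
  pose r := undup (msupp s ++ msupp t ++ msupp (s + t)).
  have ur : uniq r by exact: undup_uniq.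
  rewrite !(@lext_big _ r)//; try by move=> m h; rewrite mem_undup !mem_cat h ?orbT.
  by rewrite -big_split; apply: eq_bigr => m _; rewrite mcoeffD scalerDl.
pose r := undup (msupp s ++ msupp (c%:MP * s)).
have ur : uniq r by exact: undup_uniq.
rewrite /GRing.scale /= !(@lext_big _ r)//; try by move=> m h; rewrite mem_undup !mem_cat h ?orbT.
rewrite mulr_sumr; apply: eq_bigr => m _.
by rewrite [c%:MP * s]mul_mpolyC mcoeffZ -scalerA mul_mpolyC.
Qed.

Lemma lextX m : lext 'X_[m] = k0 m.
Proof. by rewrite /lext msuppX big_seq1 mcoeffX eqxx scale1r. Qed.
End LinearExtension.

(** Start with k = 0 on the monomials free of X_j. The equation then forces k(X_j s) = X_j k(s) -
    h(s), and [k0] is the closed form of this recursion, [w m] being [m] without its X_j-part.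
    Commutation with the earlier variables is inherited from [h]. *)
Lemma commutator_solve1 (j : 'I_v) (h : S^o -> S) : partial_lin j h ->
  exists2 k : S^o -> S, partial_lin j k & forall s, 'X_j * k s - k ('X_j * s) = h s.
Proof.
move=> [kh ch].
pose w (m : 'X_{1..v}) := [multinom (if i == j then 0%N else m i) | i < v].
pose k0 (m : 'X_{1..v}) : S := - \sum_(b < m j) 'X_j ^+ ((m j).-1 - b) * h ('X_j ^+ b * 'X_[w m]).
have klk : @klinear S^o (lext k0) by exact: lext_klinear.
have klM (f : S^o -> S) y : klinear f -> @klinear S^o (fun x => f (y * x)).
  move=> [fD fZ]; split=> [a b|c a]; first by rewrite mulrDr fD.
  by rewrite /GRing.scale /= mulrCA; exact: fZ.
have klMl (f : S^o -> S) y : klinear f -> @klinear S^o (fun x => y * f x).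
  by move=> [fD fZ]; split=> [a b|c a]; rewrite ?fD ?fZ ?mulrDr// mulrCA.
exists (lext k0).
  split=> // i ij s; rewrite /GRing.scale /=.
  apply: (@klinear_ext (fun s => lext k0 ('X_i * s)) (fun s => 'X_i * lext k0 s)).
  - exact: klM.
  - exact: klMl.
  move=> m; rewrite -mpolyXD !lextX /k0 mulrN mulr_sumr.
  have ne : (j == i) = false by apply/negbTE; apply: contraTneq ij => ->; rewrite ltnn.
  have -> : (U_(i) + m)%MM j = m j by rewrite mnmDE mnm1E eq_sym ne.
  have -> : w (U_(i) + m)%MM = (U_(i) + w m)%MM.
    apply/mnmP => l; rewrite !(mnmE, mnmDE); case: eqP => [->|//].
    by rewrite eq_sym ne.
  congr (- _); apply: eq_bigr => b _; rewrite mpolyXD.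
  rewrite [_ ^+ b * ('X_i * _)]mulrCA [RHS]mulrCA; congr (_ * _).
  exact: (ch i ij ('X_j ^+ b * 'X_[w m])).
move=> s; apply: (@klinear_ext (fun s => 'X_j * lext k0 s - lext k0 ('X_j * s)) h) => //.
  have [a1 a2] := klMl _ 'X_j klk; have [b1 b2] := klM _ 'X_j klk.
  by split=> [x y|c x]; rewrite ?a1 ?b1 ?a2 ?b2 ?opprD ?mulrBr// addrACA.
move=> m; rewrite -mpolyXD !lextX /k0.
have -> : (U_(j) + m)%MM j = (m j).+1 by rewrite mnmDE mnm1E eqxx.
have -> : w (U_(j) + m)%MM = w m.
  by apply/mnmP => l; rewrite !(mnmE, mnmDE); case: eqP => // /eqP; rewrite eq_sym => /negbTE->.
rewrite big_ord_recr /= subnn expr0 mul1r opprK mulrN mulr_sumr addrA.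
have -> : 'X_j ^+ m j * 'X_[w m] = 'X_[m] :> S.
  rewrite mpolyXn -mpolyXD; congr 'X_[_]; apply/mnmP => l.
  rewrite mnmDE mulmnE mnm1E mnmE eq_sym; case: eqP => [->|_]; first by rewrite mul1n addn0.
  by rewrite mul0n.
rewrite [X in _ + X + _](_ : _ = \sum_(i < m j) 'X_j * ('X_j ^+ ((m j).-1 - i) * h ('X_j ^+ i * 'X_[w m]))).
  by rewrite addNr add0r.
apply: eq_bigr => b _; rewrite mulrA -exprS; congr ('X_j ^+ _ * _).
have m0 : (0 < m j)%N by exact: leq_ltn_trans (ltn_ord b).
by rewrite -subSn ?prednK// -ltnS prednK.
Qed.

Lemma commutator_solve (j : 'I_v) m (h : 'rV[S]_m -> S) : partial_lin j h ->
  exists2 k : 'rV[S]_m -> S, partial_lin j k & forall x, 'X_j * k x - k ('X_j *: x) = h x.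
Proof.
move=> [kh ch]; pose hi (i : 'I_m) (s : S^o) : S := h ((s : S) *: delta_mx 0 i).
have hiP i : partial_lin j (hi i).
  split; first split.
  - by move=> s t; rewrite /hi scalerDl kh.1.
  - by move=> c s; rewrite /hi -scalerA kh.2.
  - by move=> l lj s; rewrite /hi -scalerA ch.
have /choice[k kP] : forall i, exists k : S^o -> S,
    partial_lin j k /\ forall s, 'X_j * k s - k ('X_j * s) = hi i s.
  by move=> i; have [k pk kk] := commutator_solve1 (hiP i); exists k.
exists (fun x => \sum_i k i (x 0 i)).
  split; first split.
  - by move=> x y; rewrite -big_split; apply: eq_bigr => i _; rewrite mxE (kP i).1.1.1.
  - by move=> c x; rewrite mulr_sumr; apply: eq_bigr => i _; rewrite mxE; apply: (kP i).1.1.2.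
  - by move=> l lj x; rewrite mulr_sumr; apply: eq_bigr => i _; rewrite mxE; apply: (kP i).1.2.
move=> x; rewrite [in RHS](row_sum_delta x) klinear_sum// mulr_sumr -sumrB; apply: eq_bigr => i _.
by rewrite mxE (kP i).2.
Qed.

Section Exact.
Variables (n : nat -> nat) (D : forall i, 'M[S]_(n i.+1, n i)).
Hypothesis Dex : mx_exact D.

(** Making the splitting commute with one more variable uses the statement one degree lower, whence
    the bound j <= k. *)
Lemma partial_ev_exact j k : (j <= v)%N -> (j <= k)%N ->
  forall f : 'rV[S]_(n k.+1) -> S, partial_lin j f -> (forall y, f (y *m D k.+1) = 0) ->
  exists2 g : 'rV[S]_(n k) -> S, partial_lin j g & forall x, f x = g (x *m D k).
Proof.
elim: j k => [|j IHj] k jv jk f pf f0.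
  have [[fD fZ] _] := pf.
  have funct x y : x *m D k = y *m D k -> f x = f y.
    move=> e; rewrite -[x](subrK y) fD.
    have [|z ->] := Dex.2 k (x - y); first by rewrite mulmxBl e subrr.
    by rewrite f0 add0r.
  have /choice[phi phiP] : forall y : 'rV_(n k), exists m, forall x, y = x *m D k -> m = f x.
    move=> y; have [[x yE]|ny] := pselect (exists x, y = x *m D k).
      by exists (f x) => x' yE'; apply: funct; rewrite -yE.
    by exists 0 => x yE; case: ny; exists x.
  have [||h hP] := @vector_space_inj_ext K (restr (@mpolyC v K) S^o) (restr (@mpolyC v K) 'rV[S]_(n k))
      (fun y => exists x, y = x *m D k) phi.
  - split=> [|_ _ [x ->] [y ->]|a _ [x ->]]; first by exists 0; rewrite mul0mx.
      by exists (x + y); rewrite mulmxDl.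
    by exists (a%:MP *: x); rewrite -scalemxAl.
  - split=> [_ _ [x ->] [y ->]|a _ [x ->]].
      by rewrite (phiP _ (x + y)) ?mulmxDl// (phiP _ x)// (phiP _ y).
    rewrite (phiP _ (a%:MP *: x)); last by rewrite -scalemxAl.
    by rewrite (phiP _ x)// fZ.
  exists h; last by move=> x; rewrite hP ?(phiP _ x)//; exists x.
  split=> //; split=> [x y|c x]; first exact: (raddfD h).
  exact: (linearZ_LR h).
case: k jk f pf f0 => // k jk f [kf cf] f0.
pose o := Ordinal jv.
have [||||g [kg cg] fg] := IHj k.+1 _ _ f.
- exact: ltnW.
- exact: leqW.
- by split=> // i ij; apply: cf; rewrite ltnS ltnW.
- exact: f0.
have [||||h ph gh] := IHj k _ _ (fun x => 'X_o * g x - g ('X_o *: x)).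
- exact: ltnW.
- exact: jk.
- split; first split.
  + by move=> x y; rewrite scalerDr !kg.1 mulrDr opprD addrACA.
  + move=> c x; rewrite scalerA [_ * c%:MP]mulrC -scalerA !kg.2.
    by rewrite [RHS]mulrBr; congr (_ - _); exact: mulrCA.
  + move=> i ij x; rewrite scalerA [_ * 'X_i]mulrC -scalerA !(cg i ij).
    by rewrite [RHS]mulrBr; congr (_ - _); exact: mulrCA.
- by move=> y; rewrite -fg scalemxAl -fg (cf o (ltnSn j)) subrr.
have [kk [klk ck] kkP] := @commutator_solve o _ h ph.
exists (fun x => g x - kk (x *m D k)).
  split; first split.
  - by move=> x y; rewrite mulmxDl kg.1 klk.1 opprD addrACA.
  - by move=> c x; rewrite -scalemxAl kg.2 klk.2 mulrBr.
  - move=> i; rewrite ltnS leq_eqVlt => /predU1P[ij|ij] x; last first.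
      by rewrite -scalemxAl cg// ck// mulrBr.
    have -> : i = o by exact/val_inj.
    have := gh x; rewrite -kkP => /eqP; rewrite subr_eq => /eqP e.
    rewrite -scalemxAl mulrBr e; ring.
by move=> x; rewrite -fg -mulmxA Dex.1 mulmx0 (klinear0 klk) subr0.
Qed.

Lemma mpoly_ev_exact k : (v <= k)%N -> ev_exact D (S^o : lmodType S) k.
Proof.
move=> vk f f0.
pose F (x : 'rV[S]_(n k.+1)) : S := \sum_j x 0 j * f j.
have [||g [[gD gC] gX] Fg] := @partial_ev_exact v k (leqnn v) vk F.
- split; first split.
  + by move=> x y; rewrite -big_split; apply: eq_bigr => j _; rewrite mxE mulrDl.
  + by move=> c x; rewrite mulr_sumr; apply: eq_bigr => j _; rewrite mxE mulrA.
  + by move=> i _ x; rewrite mulr_sumr; apply: eq_bigr => j _; rewrite mxE mulrA.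
- move=> y; transitivity (mxact y (mxact (D k.+1) f) 0); first by rewrite -mxact_mul.
  by rewrite /mxact big1// => j _; have := f0 j; rewrite /mxact => ->; rewrite scaler0.
have kg : klinear g by [].
have gM s x : g (s *: x) = s * g x.
  have gXm m y : g ('X_[m] *: y) = 'X_[m] * g y.
    rewrite mpolyXE_id.
    have: forall r, g ((\prod_(i <- r) 'X_i ^+ m i) *: y) = (\prod_(i <- r) 'X_i ^+ m i) * g y.
      elim=> [|i r IHr]; first by rewrite !big_nil scale1r mul1r.
      rewrite !big_cons -scalerA -mulrA -IHr.
      elim: (m i) => [|a IHa]; first by rewrite !expr0 scale1r mul1r.
      by rewrite !exprS -scalerA gX// IHa mulrA.
    by apply.
  rewrite [s]mpolyE scaler_suml klinear_sum// mulr_suml; apply: eq_bigr => m _.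
  by rewrite -mul_mpolyC -scalerA gC gXm mulrA.
exists (fun i => g (delta_mx 0 i)) => j.
have := Fg (delta_mx 0 j); rewrite /F (bigD1 j)//= mxE !eqxx mul1r big1 ?addr0; last first.
  by move=> i ij; rewrite mxE eqxx (negbTE ij) mul0r.
move=> ->; rewrite -rowE [row j _]row_sum_delta klinear_sum//; apply: eq_bigr => i _.
by rewrite gM mxE.
Qed.

End Exact.
End Syzygy.

(** * Gorenstein ideals and Kustin-Miller unprojections *)

Section Killed.
Variables (S : comNzRingType) (M : lmodType S).

(** Evaluation at 1 identifies Hom(S/I, M) with these elements. *)
Definition killed (I : S -> Prop) (e : M) : Prop := forall x, I x -> x *: e = 0.

Lemma killed0 I : killed I 0. Proof. by move=> x _; rewrite scaler0. Qed.
Lemma killedD I e f : killed I e -> killed I f -> killed I (e + f).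
Proof. by move=> ke kf x Ix; rewrite scalerDr ke// kf// addr0. Qed.
Lemma killedN I e : killed I e -> killed I (- e).
Proof. by move=> ke x Ix; rewrite scalerN ke// oppr0. Qed.
Lemma killedB I e f : killed I e -> killed I f -> killed I (e - f).
Proof. by move=> ke kf; apply: killedD => //; exact: killedN. Qed.
Lemma killedZ I c e : killed I e -> killed I (c *: e).
Proof. by move=> ke x Ix; rewrite scalerA mulrC -scalerA ke// scaler0. Qed.
Lemma killed_sub (I J : S -> Prop) e : (forall x, I x -> J x) -> killed J e -> killed I e.
Proof. by move=> IJ ke x /IJ; exact: ke. Qed.

End Killed.

Lemma killed_linear (S : comNzRingType) (M N : lmodType S) (h : {linear M -> N}) I e :
  killed I e -> killed I (h e).
Proof. by move=> ke x Ix; rewrite -linearZ ke// linear0. Qed.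

Section Adjoin.
Variables (S : comNzRingType) (I : S -> Prop) (k : nat) (p : 'I_k -> S).
Hypothesis iI : ideal I.

Definition adj (x : S) : Prop := exists c : 'I_k -> S, I (x - \sum_i c i * p i).

Lemma adj_ideal : ideal adj.
Proof.
split=> [|x y [c Ic] [c' Ic']|a x [c Ic]].
- exists (fun=> 0); rewrite big1 => [|i _]; rewrite ?mul0r// subr0; exact: ideal0.
- exists (fun i => c i + c' i).
  have -> : x + y - \sum_i (c i + c' i) * p i = (x - \sum_i c i * p i) + (y - \sum_i c' i * p i).
    rewrite addrACA -opprD -big_split; congr (_ - _); apply: eq_bigr => i _; exact: mulrDl.
  exact: idealD.
- exists (fun i => a * c i).
  have -> : a *: x - \sum_i (a * c i) * p i = a * (x - \sum_i c i * p i).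
    by rewrite mulrBr mulr_sumr; congr (_ - _); apply: eq_bigr => i _; rewrite mulrA.
  exact: idealMl.
Qed.

Lemma adj_sub x : I x -> adj x.
Proof. by move=> Ix; exists (fun=> 0); rewrite big1 ?subr0// => i _; rewrite mul0r. Qed.

Lemma adj_gen j : adj (p j).
Proof.
exists (fun i => (i == j)%:R); rewrite (bigD1 j)//= eqxx mul1r big1 => [|i /negbTE->].
  by rewrite addr0 subrr; exact: ideal0.
by rewrite mul0r.
Qed.

Lemma adj_min (J : S -> Prop) : ideal J -> (forall x, I x -> J x) -> (forall j, J (p j)) ->
  forall x, adj x -> J x.
Proof.
move=> iJ IJ Jp x [c /IJ Jx]; rewrite -[x](subrK (\sum_i c i * p i)); apply: idealD => //.
by apply: ideal_sum => // i _; exact: idealMl.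
Qed.

Lemma killed_adj (M : lmodType S) (e : M) : killed I e -> (forall j, p j *: e = 0) -> killed adj e.
Proof.
move=> ke pe x; apply: (@adj_min (fun x => x *: e = 0)) => // {x}.
split=> [|x y ex ey|a x ex]; first by rewrite scale0r.
  by rewrite scalerDl ex ey addr0.
by rewrite -scalerA ex scaler0.
Qed.

(** The elements [w] define a map from (I + (p))/I to [E]; [e] is the value at 1 of an extension to
    S. *)
Lemma ideal_solve (E : lmodType S) (w : 'I_k -> E) : inj_ext E ->
  (forall c : 'I_k -> S, I (\sum_i c i * p i) -> \sum_i c i *: w i = 0) ->
  exists2 e, killed I e & forall j, p j *: e = w j.
Proof.
move=> iE H.
have funct x (c c' : 'I_k -> S) : I (x - \sum_i c i * p i) -> I (x - \sum_i c' i * p i) ->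
    \sum_i c i *: w i = \sum_i c' i *: w i.
  move=> Ic Ic'; apply/eqP; rewrite -subr_eq0 -sumrB; apply/eqP.
  rewrite (eq_bigr (fun i => (c i - c' i) *: w i)); last by move=> i _; rewrite scalerBl.
  apply: H; have := idealB iI Ic' Ic; congr I; rewrite opprB [LHS]addrC addrA subrK -sumrB.
  by apply: eq_bigr => i _; rewrite mulrBl.
have /choice[phi phiP] : forall x : S^o, exists m, forall c : 'I_k -> S,
    I (x - \sum_i c i * p i) -> m = \sum_i c i *: w i.
  move=> x; have [[c Ic]|nx] := pselect (adj x); last by exists 0 => c Ic; case: nx; exists c.
  by exists (\sum_i c i *: w i) => c'; exact: funct.
have [||h hP] := iE S^o adj phi.
- exact: adj_ideal.
- split=> [x y [c Ic] [c' Ic']|a x [c Ic]].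
    rewrite (phiP _ _ Ic) (phiP _ _ Ic') (phiP _ (fun i => c i + c' i)) -?big_split.
      by apply: eq_bigr => i _; rewrite scalerDl.
    have := idealD iI Ic Ic'; congr I; rewrite addrACA -opprD -big_split; congr (_ - _).
    by apply: eq_bigr => i _; rewrite mulrDl.
  rewrite (phiP _ _ Ic) (phiP _ (fun i => a * c i)) ?scaler_sumr.
    by apply: eq_bigr => i _; rewrite scalerA.
  have := idealMl a iI Ic; congr I; rewrite mulrBr mulr_sumr; congr (_ - _).
  by apply: eq_bigr => i _; rewrite mulrA.
have hE x : h x = x *: h 1 by rewrite -linearZ /GRing.scale /= mulr1.
exists (h 1) => [x Ix|j].
  rewrite -hE hP; last exact: adj_sub.
  rewrite (phiP _ (fun=> 0)); first by rewrite big1// => i _; rewrite scale0r.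
  by rewrite big1 ?subr0// => i _; rewrite mul0r.
rewrite -hE hP; last exact: adj_gen.
have Ij : I (p j - \sum_i (i == j)%:R * p i).
  rewrite (bigD1 j)//= eqxx mul1r big1 => [|i /negbTE->]; last by rewrite mul0r.
  by rewrite addr0 subrr; exact: ideal0.
rewrite (phiP _ _ Ij) (bigD1 j)//= eqxx scale1r big1 ?addr0// => i /negbTE->.
by rewrite scale0r.
Qed.

End Adjoin.

Definition reg_mod (S : comNzRingType) (I : S -> Prop) (f : S) : Prop :=
  forall c, I (f * c) -> I c.

(* Ext groups of cyclic modules, computed by a complex [E] of injectives shifted by two degrees.
   [gor g I] says that H(Hom(S/I, E)) is concentrated in degree [g] and is there isomorphic to
   [S/I]; [grade k J] says that it vanishes in degrees below [k]. *)
Section Gorenstein.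
Variables (S : comNzRingType) (E : nat -> lmodType S) (d : forall i, {linear E i -> E i.+1}).
Hypotheses (iE : forall i, inj_ext (E i)) (dd : forall i x, d i.+1 (d i x) = 0).
Hypotheses (triv0 : forall x : E 0, x = 0) (triv1 : forall x : E 1, x = 0).

Let dZ i c (x : E i) : d i (c *: x) = c *: d i x. Proof. exact: linearZ_LR. Qed.

Let sCA i b c (x : E i) : b *: (c *: x) = c *: (b *: x). Proof. by rewrite !scalerA mulrC. Qed.

Definition acyc (I : S -> Prop) (i : nat) : Prop :=
  forall z : E i.+1, killed I z -> d i.+1 z = 0 -> exists2 y, killed I y & z = d i y.

Definition gor (g : nat) (I : S -> Prop) : Prop :=
  [/\ ideal I, forall i, i <> g.+1 -> acyc I i
    & exists xi : E g.+2, [/\ killed I xi, d g.+2 xi = 0,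
        forall z, killed I z -> d g.+2 z = 0 ->
          exists c y, killed I y /\ z = c *: xi + d g.+1 y
      & forall c, I c <-> exists2 y, killed I y & c *: xi = d g.+1 y]].

Definition grade (k : nat) (J : S -> Prop) : Prop := forall i, (i < k)%N -> acyc J i.+1.

Lemma gor_ideal g I : gor g I -> ideal I. Proof. by case. Qed.

Section KustinMiller.
Variables (g : nat) (I0 : S -> Prop) (k : nat) (p a : 'I_k -> S).
Hypotheses (g0 : gor g I0) (gD : gor g.+1 (adj I0 p)).
Hypothesis C1 : forall i j, I0 (p i * a j - p j * a i).
Variable j0 : 'I_k.
Hypotheses (C2 : reg_mod I0 (p j0)) (C2' : reg_mod I0 (a j0)).
Hypothesis C3 : forall m, (forall j, adj I0 p (m * a j)) -> adj I0 p m.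
Hypothesis C4 : forall c m (h : 'I_k -> S), (forall j, I0 (a j - c * h j - m * p j)) ->
  exists c', adj I0 p (c * c' - 1).

Let iI0 : ideal I0 := gor_ideal g0.

Let swap (c : 'I_k -> S) j : I0 (p j * (\sum_i c i * a i) - a j * (\sum_i c i * p i)).
Proof.
rewrite !mulr_sumr -sumrB; apply: ideal_sum => // i _.
have := idealMl (c i) iI0 (C1 j i); congr I0; rewrite mulrBr; congr (_ - _).
  exact: mulrCA.
by rewrite [p i * _]mulrC; exact: mulrCA.
Qed.

(** By [C1], and by cancelling p_{j0} or a_{j0}, the vectors p and a have the same relations modulo
    [I0]: the ideals they generate in S/I0 are isomorphic by p_i |-> a_i. *)
Let theta c : I0 (\sum_i c i * p i) -> I0 (\sum_i c i * a i).
Proof.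
move=> Ic; apply: C2; rewrite -[_ * _](subrK (a j0 * \sum_i c i * p i)).
by apply: idealD => //; exact: idealMl.
Qed.

Let theta' c : I0 (\sum_i c i * a i) -> I0 (\sum_i c i * p i).
Proof.
move=> Ic; apply: C2'; rewrite -[_ * _](subKr (p j0 * \sum_i c i * a i)).
by apply: idealB => //; exact: idealMl.
Qed.

(** Here e' plays the role of (a/p) e; it exists because [E i] is injective. It is determined only
    up to elements killed by [adj I0 p], which is the source of all corrections below. *)
Let up i (e : E i) : killed I0 e -> exists2 e', killed I0 e' & forall j, p j *: e' = a j *: e.
Proof.
move=> ke; apply: (@ideal_solve _ _ _ p iI0 (E i) (fun j => a j *: e) (@iE i)) => c /theta Ic.
rewrite -[RHS](ke _ Ic) scaler_suml; by apply: eq_bigr => l _; rewrite scalerA.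
Qed.

Let down i (e : E i) : killed I0 e -> exists2 e', killed I0 e' & forall j, a j *: e' = p j *: e.
Proof.
move=> ke; apply: (@ideal_solve _ _ _ a iI0 (E i) (fun j => p j *: e) (@iE i)) => c /theta' Ic.
rewrite -[RHS](ke _ Ic) scaler_suml; by apply: eq_bigr => l _; rewrite scalerA.
Qed.

Let K := adj I0 a.
Let ID := adj I0 p.
Let iK : ideal K := adj_ideal a iI0.
Let I0K x : I0 x -> K x := @adj_sub S I0 k a x.
Let I0D x : I0 x -> ID x := @adj_sub S I0 k p x.
Let Ka j : K (a j) := adj_gen a iI0 j.
Let Dp j : ID (p j) := adj_gen p iI0 j.

(** S/K and S/ID are the quotients of S/I0 by isomorphic ideals. A primitive y of z is moved by [up]
    to the side of [ID], corrected there by acyclicity of [ID] and [I0], and the correction is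
    brought back by [down]. *)
Lemma km_acyc i : i <> g.+2 -> acyc K i.
Proof.
case: i => [|i] ig z Kz dz; first by exists 0; [exact: killed0|rewrite linear0; exact: triv1].
have [_ ac [xi [kxi dxi xigen xiann]]] := g0; have [_ acD _] := gD.
have Iz : killed I0 z by exact: killed_sub Kz.
have [y ky zy] : exists2 y, killed I0 y & z = d i.+1 y.
  (* In the degree of [xi], where [I0] is not acyclic, the coefficient of [xi] in z lies in [I0],
     because a_{j0} kills z and is regular modulo [I0]. *)
  have [e|ne] := eqVneq i g; last by apply: ac => //; move/eqP: ne => ne [].
  move: e z Kz dz Iz ig => -> z Kz dz Iz _.
  have [c [y [ky zE]]] := xigen z Iz dz; exists y => //.
  suff /kxi c0 : I0 c by rewrite zE c0 add0r.
  apply: C2'; apply/xiann; exists (- (a j0 *: y)); first by apply: killedN; exact: killedZ.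
  have := Kz _ (Ka j0); rewrite zE scalerDr scalerA -dZ => /eqP.
  by rewrite addr_eq0 linearN => /eqP.
have [y' ky' py'] := up ky.
have [|||y'' ky'' dy''] := acD i.+1 _ (d _ y').
- by move=> [e]; apply: ig; rewrite e.
- apply: killed_adj => //; first exact: killed_linear.
  by move=> j; rewrite -dZ py' dZ -zy; exact: Kz.
- exact: dd.
have [|||x' kx' yx] := ac i _ (y' - y'').
- by move=> e; apply: ig; rewrite e.
- by apply: killedB => //; exact: killed_sub ky''.
- by rewrite linearB /= dy'' subrr.
have [x kx ax] := down kx'.
exists (y - d _ x); last by rewrite linearB /= dd subr0.
apply: killed_adj => //; first by apply: killedB => //; exact: killed_linear.
move=> j; rewrite scalerBr -dZ ax dZ -yx -py' scalerBr opprB addrCA subrr addr0.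
exact: (ky'' _ (Dp j)).
Qed.

(** With a eta = p xi, the generating class for [K] is d eta, the connecting image of [xi]. That it
    generates depends on the corresponding class d ep for [ID], where p ep = a xi: it must be a unit
    multiple of the given generator [zt], and this is what [C4] provides. *)
Lemma kustin_miller : gor g.+1 K.
Proof.
have [_ ac [xi [kxi dxi xigen xiann]]] := g0.
have [_ acD [zt [kzt dzt ztgen ztann]]] := gD.
have [ep kep pep] := up kxi.
have dep_killed : killed ID (d _ ep).
  apply: killed_adj => //; first exact: killed_linear.
  by move=> j; rewrite -dZ pep dZ dxi scaler0.
have [c [ep'' [kep'' depE]]] := ztgen _ dep_killed (dd _).
have acI0 : acyc I0 g.+2 by apply: ac; move=> /eqP; rewrite eqSS -[X in _ == X]addn0 -addn1 eqn_add2l.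
have [nu knu ztE] := acI0 zt (killed_sub I0D kzt) dzt.
(* The cocycles p_j nu and ep - c nu - ep'' equal h_j xi and m xi up to boundaries; multiplying the
   second by p_j gives a_j = c h_j + m p_j modulo [I0], the situation of [C4]. *)
have [c' cc'] : exists c', ID (c * c' - 1).
  have /choice[h hP] : forall j, exists h, exists2 x, killed I0 x & p j *: nu = h *: xi + d _ x.
    move=> j; have [||h [x [kx e]]] := xigen (p j *: nu).
    - exact: killedZ.
    - by rewrite dZ -ztE (kzt _ (Dp j)).
    by exists h, x.
  have [||m [x [kx e]]] := xigen (ep - c *: nu - ep'').
  - by apply: killedB; [apply: killedB => //; exact: killedZ|exact: killed_sub kep''].
  - by rewrite !linearB dZ depE -ztE [c *: zt + _]addrC addrK subrr.
  apply: (@C4 c m h) => j; apply/xiann.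
  have [xj kxj ej] := hP j; exists (c *: xj + p j *: x).
    by apply: killedD; exact: killedZ.
  have E1 : p j *: ep = p j *: (m *: xi + d _ x) + c *: (h j *: xi + d _ xj).
    by rewrite -e -ej !scalerBr (kep'' _ (Dp j)) subr0 !scalerA [c * _]mulrC subrK.
  rewrite linearD !dZ !scalerBl -scalerA -pep E1 !scalerDr !scalerA [p j * m]mulrC.
  rewrite -addrA -opprD [LHS]addrC addrACA [_ + (m * p j) *: xi]addrC.
  by rewrite addKr addrC.
have [eta keta aeta] := down kxi.
split; [exact: iK|exact: km_acyc|].
exists (d _ eta); split=> [|||c0].
- apply: killed_adj => //; first exact: killed_linear.
  by move=> j; rewrite -dZ aeta dZ dxi scaler0.
- exact: dd.
- move=> z Kz dz; have [y ky zE] := acI0 z (killed_sub I0K Kz) dz.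
  have [y' ky' py'] := up ky.
  have [||c0 [y0 [ky0 dy'E]]] := ztgen (d _ y').
  + apply: killed_adj => //; first exact: killed_linear.
    by move=> j; rewrite -dZ py' dZ -zE; exact: Kz.
  + exact: dd.
  pose c1 := c0 * c'; pose Y := y0 - c1 *: ep''.
  have kY : killed ID Y by apply: killedB => //; exact: killedZ.
  have dy'2 : d _ y' = c1 *: d _ ep + d _ Y.
    have ztE' : zt = c' *: (c *: zt).
      rewrite scalerA mulrC; apply/esym/eqP; rewrite -subr_eq0 -{2}[zt]scale1r -scalerBl.
      by rewrite (kzt _ cc').
    rewrite dy'E {1}ztE' -[c *: zt](addrK (d _ ep'')) -depE scalerA -/c1.
    have -> : d _ Y = d _ y0 - c1 *: d _ ep'' by rewrite linearB dZ.
    by rewrite scalerBr -addrA [_ + d _ y0]addrC.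
  clearbody Y.
  have [||c2 [x' [kx' y'E]]] := xigen (y' - c1 *: ep - Y).
  + by apply: killedB; [apply: killedB => //; exact: killedZ|exact: killed_sub kY].
  + by rewrite !linearB dZ dy'2 [_ + d _ Y]addrC addrK subrr.
  have [x kx ax] := down kx'.
  exists c2, (y - c1 *: xi - d _ x - c2 *: eta); split.
    apply: killed_adj => //.
      by do ![apply: killedB|apply: killedZ|apply: killed_linear].
    move=> j; rewrite !scalerBr -dZ ax dZ -py'.
    have -> : p j *: y' = c1 *: (a j *: xi) + c2 *: (p j *: xi) + p j *: d _ x'.
      rewrite -[y'](subrK (c1 *: ep)) -[y' - _](subrK Y) y'E !scalerDr (kY _ (Dp j)) addr0.
      rewrite [p j *: (c1 *: ep)]sCA pep [p j *: (c2 *: xi)]sCA.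
      by rewrite addrAC [c2 *: _ + _]addrC.
    rewrite [a j *: (c1 *: xi)]sCA [a j *: (c2 *: eta)]sCA aeta.
    move: (c1 *: _) (c2 *: _) (p j *: d _ _) => X1 X2 X3.
    by rewrite [X1 + X2]addrC -[X2 + X1 + X3]addrA -[_ - X1 - X3]addrA -opprD addrK subrr.
  by rewrite !linearB !dZ dxi scaler0 subr0 dd subr0 subrKC zE.
- split=> [Kc0|[w kw e]].
    exists 0; first exact: killed0.
    rewrite linear0; apply: (killed_adj _ _ Kc0); first exact: killed_linear.
    by move=> j; rewrite -dZ aeta dZ dxi scaler0.
  have [||m [x [kx xE]]] := xigen (c0 *: eta - w).
  + by apply: killedB; [exact: killedZ|exact: killed_sub kw].
  + by rewrite linearB dZ e subrr.
  have Im j : I0 (c0 * p j - m * a j).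
    apply/xiann; exists (a j *: x); first exact: killedZ.
    have := congr1 (fun v => a j *: v) xE; rewrite scalerBr (kw _ (Ka j)) subr0 scalerDr.
    rewrite sCA aeta !scalerA [a j * m]mulrC => E1.
    by rewrite scalerBl E1 [_ + a j *: _]addrC addrK dZ.
  (* Since c0 p_j = m a_j modulo [I0], every m a_j lies in [ID], and [C3] makes m a combination of
     the p_i. Exchanging p and a by [C1] and cancelling p_{j0} then puts c0 into [K]. *)
  have [q Iq] : ID m.
    apply: C3 => j; rewrite -[m * a j](subKr (c0 * p j)); apply: idealB; first exact: adj_ideal.
      by apply: idealMl; [exact: adj_ideal|exact: Dp].
    exact: I0D.
  exists q; apply: C2; rewrite mulrBr.
  have -> : p j0 * c0 - p j0 * \sum_i q i * a i =
     (c0 * p j0 - m * a j0) + (m - \sum_i q i * p i) * a j0 -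
     (p j0 * (\sum_i q i * a i) - a j0 * (\sum_i q i * p i)) by ring.
  apply: idealB => //; apply: idealD => //; exact: idealMr.
Qed.
End KustinMiller.

Definition add1 (I : S -> Prop) (f x : S) : Prop := exists c, I (x - c * f).

Lemma gor_equiv g I J : (forall x, I x <-> J x) -> gor g I -> gor g J.
Proof.
by move=> IJ; have -> : J = I by apply/funext => x; apply/propext; split=> /IJ.
Qed.

(** A hypersurface section is the degenerate unprojection with one generator, p = 1 and a = f: [ID]
    is then the unit ideal, whose complex is zero and which satisfies [gor] in every grade with [xi]
    = 0. *)
Lemma gor_reg g I f : gor g I -> reg_mod I f -> gor g.+1 (add1 I f).
Proof.
move=> gI rf; have iI := gor_ideal gI.
have adjP h x : adj I (fun _ : 'I_1 => h) x <-> add1 I h x.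
  split=> [[c]|[c Ic]]; first by rewrite big_ord1; exists (c ord0).
  by exists (fun=> c); rewrite big_ord1.
have full x : adj I (fun _ : 'I_1 => 1) x.
  by apply/adjP; exists x; rewrite mulr1 subrr; exact: ideal0.
apply: (gor_equiv (adjP f)).
apply: (@kustin_miller g I 1 (fun=> 1) (fun=> f) gI _ _ ord0) => //.
- split; first exact: adj_ideal.
  + move=> i _ z kz _; exists 0; first exact: killed0.
    by rewrite linear0 -[z]scale1r; exact: kz.
  + exists 0; split; [exact: killed0|exact: linear0| |].
      move=> z kz _; exists 0, 0; split; first exact: killed0.
      by rewrite scaler0 linear0 addr0 -[z]scale1r; exact: kz.
    by move=> c; split=> // _; exists 0; rewrite ?scaler0 ?linear0//; exact: killed0.
- by move=> i j; rewrite subrr; exact: ideal0.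
- by move=> c; rewrite mul1r.
- by move=> c m h _; exists 0.
Qed.

(* A complex of injectives that is exact in low degrees is split there; hence its subcomplexes
   killed by a larger ideal are exact as well. *)
Lemma grade_split k C : grade k C -> forall i, (i <= k)%N ->
  exists s : {linear E i.+1 -> E i}, forall z, killed C z -> d i.+1 z = 0 -> d i (s z) = z.
Proof.
move=> gC; elim=> [|i IHi] ik.
  by exists \0%R => z _ _; rewrite [LHS]triv1 [RHS]triv1.
have [s sP] := IHi (ltnW ik).
have pr y : killed C y -> d i.+1 y = 0 -> d i (s y) = y by exact: sP.
have funct y y' : killed C y -> killed C y' -> d i.+1 y = d i.+1 y' ->
    y - d i (s y) = y' - d i (s y').
  move=> ky ky' e; have := pr (y - y') (killedB ky ky').
  rewrite !linearB /= e subrr => /(_ erefl)/eqP; rewrite subr_eq => /eqP ->.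
  by rewrite opprD addrA subKr.
pose D (z : E i.+2) := exists2 y, killed C y & z = d i.+1 y.
have /choice[phi phiP] : forall z, exists m, forall y, killed C y -> z = d i.+1 y -> m = y - d i (s y).
  move=> z; have [[y ky zE]|nz] := pselect (D z).
    by exists (y - d i (s y)) => y' ky' zE'; apply: funct => //; rewrite -zE.
  by exists 0 => y ky zE; case: nz; exists y.
have phiE y : killed C y -> phi (d i.+1 y) = y - d i (s y) by move=> ky; exact: phiP.
have [||h hP] := @iE i.+1 (E i.+2) D phi.
- split=> [|_ _ [x kx ->] [y ky ->]|a _ [x kx ->]].
  + by exists 0; rewrite ?linear0//; exact: killed0.
  + by exists (x + y); rewrite ?linearD//; exact: killedD.
  + by exists (a *: x); rewrite ?dZ//; exact: killedZ.
- split=> [_ _ [x kx ->] [y ky ->]|a _ [x kx ->]].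
  + rewrite -linearD (phiE _ kx) (phiE _ ky) phiE; last exact: killedD.
    by rewrite [s (_ + _)]linearD [d i (_ + _)]linearD opprD addrACA.
  + rewrite -dZ (phiE _ kx) phiE; last exact: killedZ.
    by rewrite [s (_ *: _)]linearZ_LR [d i (_ *: _)]linearZ_LR scalerBr.
exists h => z kz dz; have [y ky zE] := gC i ik z kz dz.
by rewrite hP ?zE ?phiE//; [rewrite linearB /= dd subr0|exists y].
Qed.

Lemma grade_mono k C J : (forall x, C x -> J x) -> grade k C -> grade k J.
Proof.
move=> CJ gC i ik z kz dz; have [s sP] := grade_split gC ik.
by exists (s z); [exact: killed_linear|rewrite sP//; exact: killed_sub kz].
Qed.

Lemma grade_leq k l J : (k <= l)%N -> grade l J -> grade k J.
Proof. by move=> kl gJ i ik; apply: gJ; exact: leq_trans kl. Qed.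

Lemma gor_grade g C J : gor g C -> (forall x, C x -> J x) -> grade g J.
Proof.
move=> [_ ac _] CJ; apply: grade_mono CJ _ => i ig; apply: ac => -[e].
by rewrite e ltnn in ig.
Qed.

(** This is the exact sequence 0 -> S/(J : f) -> S/J -> S/(J + (f)) -> 0 in terms of elements: f z
    bounds an element killed by J : f, which has the form f y', and z - d y' is killed by J +
    (f). *)
Lemma grade_mul k J J' f : ideal J -> (forall x, J' x -> J (f * x)) ->
  grade k (add1 J f) -> grade k J' -> grade k J.
Proof.
move=> iJ fJ' g1 g2 i ik z kz dz.
pose JC x := J (f * x).
have g3 : grade k JC by exact: grade_mono fJ' g2.
have [||y ky yE] := g3 i ik (f *: z).
- by move=> x Jx; rewrite scalerA mulrC; exact: kz.
- by rewrite dZ dz scaler0.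
have [|y' ky' y'E] := @ideal_solve S J 1 (fun=> f) iJ _ (fun=> y) (@iE i.+1).
  by move=> c; rewrite !big_ord1 mulrC; exact: ky.
have {}y'E := y'E ord0.
have [||w kw wE] := g1 i ik (z - d _ y').
- move=> x [c Jx]; rewrite -[x](subrK (c * f)) scalerDl -scalerA.
  have -> : f *: (z - d _ y') = 0 by rewrite scalerBr -dZ y'E yE subrr.
  rewrite scaler0 addr0.
  by move: Jx; apply: killedB => //; exact: killed_linear.
- by rewrite linearB /= dz dd subrr.
exists (y' + w); last by rewrite linearD /= -wE subrKC.
by apply: killedD => //; apply: killed_sub kw => x Jx; exists 0; rewrite mul0r subr0.
Qed.

(** Unmixedness: c xi is a cocycle killed by [J], hence a boundary since [J] has no cohomology in
    degree [g], and boundaries among the multiples of [xi] come from [I]. *)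
Lemma gor_colon g I J c : gor g I -> grade g.+1 J -> (forall x, I x -> J x) ->
  (forall x, J x -> I (x * c)) -> I c.
Proof.
move=> [iI _ [xi [kxi dxi _ ann]]] gJ IJ Jc.
have [||y ky yE] := gJ g (ltnSn g) (c *: xi).
- by move=> x /Jc Ixc; rewrite scalerA; exact: kxi.
- by rewrite dZ dxi scaler0.
by apply/ann; exists y => //; exact: killed_sub ky.
Qed.

(** An element annihilated by f modulo [I] is annihilated by all of I + (f). This converts grade
    bounds into the regularity of p4, u, p2 and u T. *)
Lemma gor_reg_mod g I f : gor g I -> grade g.+1 (add1 I f) -> reg_mod I f.
Proof.
move=> gI gf c Ifc; have iI := gor_ideal gI.
apply: (gor_colon gI gf) => [x Ix|x [b Ix]]; first by exists 0; rewrite mul0r subr0.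
rewrite -[x](subrK (b * f)) mulrDl -mulrA; apply: idealD => //; first exact: idealMr.
exact: idealMl.
Qed.

Lemma gor0 (e : {linear S^o -> E 2}) : injective e ->
  (forall y, d 2 y = 0 <-> exists x, y = e x) ->
  (forall i y, d i.+3 y = 0 <-> exists x, y = d i.+2 x) -> gor 0 (fun x => x = 0).
Proof.
move=> einj e0 ex; have k0 (M : lmodType S) (z : M) : killed (fun x => x = 0) z.
  by move=> x ->; rewrite scale0r.
have eE c : e c = c *: e 1 by rewrite -linearZ_LR /GRing.scale /= mulr1.
split.
- by split=> [|x y -> ->|a x ->]; rewrite ?addr0 ?scaler0.
- move=> [|[|i]] i1 z _ dz //; first by exists 0 => //; rewrite [LHS]triv1 [RHS]triv1.
  by have [x ->] := (ex _ _).1 dz; exists x.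
- exists (e 1); split=> // [|z _ /e0[c ->]|c].
  + by apply/e0; exists 1.
  + by exists c, 0; split=> //; rewrite linear0 addr0 -eE.
  + split=> [->|[y _]]; first by exists 0 => //; rewrite scale0r linear0.
    by rewrite [y]triv1 linear0 -eE -(linear0 e) => /einj.
Qed.

End Gorenstein.

(** * Quotients and localizations *)

Section KilledModule.
Variables (S R : comNzRingType) (pr : {rmorphism S -> R}) (sec : R -> S).
Hypothesis secK : cancel sec pr.
Variable M : lmodType S.
Let I (x : S) := pr x = 0.

(** Hom_S(R, M) as a module over the quotient R, which acts through representatives chosen by [sec].
    The parameter ties the type to [sec], so that this action can be declared on it. *)
Record kmod (k : cancel sec pr) := KMod { kval : M; kvalP : killed I kval }.
Local Notation V := (kmod secK).

Lemma kmod_eq (e f : V) : kval e = kval f -> e = f.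
Proof. by case: e f => [e ke] [f kf] /= ef; move: ke kf; rewrite ef => ke kf; rewrite (Prop_irrelevance ke kf). Qed.
HB.instance Definition _ := gen_eqMixin V.
HB.instance Definition _ := gen_choiceMixin V.

Definition kmod0 : V := KMod secK (@killed0 S M I).
Definition kmodD (e f : V) : V := KMod secK (killedD (kvalP e) (kvalP f)).
Definition kmodN (e : V) : V := KMod secK (killedN (kvalP e)).
Lemma kmodDA : associative kmodD. Proof. by move=> e f g; apply: kmod_eq; rewrite /= addrA. Qed.
Lemma kmodDC : commutative kmodD. Proof. by move=> e f; apply: kmod_eq; rewrite /= addrC. Qed.
Lemma kmod0D : left_id kmod0 kmodD. Proof. by move=> e; apply: kmod_eq; rewrite /= add0r. Qed.
Lemma kmodND : left_inverse kmod0 kmodN kmodD. Proof. by move=> e; apply: kmod_eq; rewrite /= addNr. Qed.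
HB.instance Definition _ := GRing.isZmodule.Build V kmodDA kmodDC kmod0D kmodND.

Lemma killed_pr (e : M) a b : killed I e -> pr a = pr b -> a *: e = b *: e.
Proof.
move=> ke ab; apply/eqP; rewrite -subr_eq0 -scalerBl; apply/eqP; apply: ke.
by rewrite /I rmorphB ab subrr.
Qed.

Definition kmodZ (a : R) (e : V) : V := KMod secK (killedZ (sec a) (kvalP e)).
Lemma kmodZA a b e : kmodZ a (kmodZ b e) = kmodZ (a * b) e.
Proof.
apply: kmod_eq; rewrite /= scalerA; apply: killed_pr; first exact: kvalP.
by rewrite rmorphM !secK.
Qed.
Lemma kmodZ1 : left_id 1 kmodZ.
Proof.
move=> e; apply: kmod_eq; rewrite /= -[RHS]scale1r; apply: killed_pr; first exact: kvalP.
by rewrite secK rmorph1.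
Qed.
Lemma kmodZDr : right_distributive kmodZ +%R.
Proof. by move=> a e f; apply: kmod_eq; rewrite /= scalerDr. Qed.
Lemma kmodZDl e : {morph kmodZ^~ e : a b / a + b}.
Proof.
move=> a b; apply: kmod_eq; rewrite /= -scalerDl; apply: killed_pr; first exact: kvalP.
by rewrite rmorphD !secK.
Qed.
HB.instance Definition _ := GRing.Zmodule_isLmodule.Build R V kmodZA kmodZ1 kmodZDr kmodZDl.

Lemma kvalZ x (e : V) : kval (pr x *: e) = x *: kval e.
Proof. by apply: killed_pr; [exact: kvalP|rewrite secK]. Qed.

Lemma kval_sum (T : Type) (r : seq T) (F : T -> V) :
  kval (\sum_(i <- r) F i) = \sum_(i <- r) kval (F i).
Proof. by elim: r => [|i r IHr]; rewrite ?big_nil// !big_cons /= IHr. Qed.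

Lemma kmod_inj_ext : inj_ext M -> inj_ext V.
Proof.
move=> iM N D phi sD [pD pZ].
have sD' : @submod S (restr pr N) D by case: sD => D0 DA DZ; split=> // c x; exact: DZ.
have [|h hP] := iM (restr pr N) D (fun x => kval (phi x)) sD'.
  by split=> [x y Dx Dy|c x Dx]; rewrite ?pD// pZ// kvalZ.
pose h' (x : N) : M := h x.
have h'D x y : h' (x + y) = h' x + h' y := raddfD h x y.
have h'Z c x : h' (pr c *: x) = c *: h' x := linearZ_LR h c x.
have hk x : killed I (h' x).
  by move=> c Ic; rewrite -h'Z Ic scale0r; have := raddf0 h.
pose H x : V := KMod secK (hk x).
have Hlin : linear H.
  by move=> a x y; apply: kmod_eq; rewrite /= h'D -{1}[a]secK h'Z.
pose HL := GRing.isLinear.Build R N V *:%R H Hlin.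
by exists (HB.pack H HL : {linear N -> V}) => x Dx; apply: kmod_eq; exact: hP.
Qed.

End KilledModule.

(* The dual of a free resolution over [S/I] is compared with [E] through the double complex of maps from
   the resolution to the subcomplex of [E] killed by [I]. *)
Section QuotientExt.
Variables (S : comNzRingType) (E : nat -> lmodType S) (d : forall i, {linear E i -> E i.+1}).
Hypotheses (iE : forall i, inj_ext (E i)) (dd : forall i x, d i.+1 (d i x) = 0).
Variable top : nat.
Hypothesis Etop : forall i, (top < i)%N -> forall x : E i, x = 0.
Variables (g : nat) (R : comNzRingType) (pr : {rmorphism S -> R}) (sec : R -> S).
Hypothesis secK : cancel sec pr.
Let I (x : S) := pr x = 0.
Hypothesis gI : gor d g I.
Variables (n : nat -> nat) (D : forall i, 'M[R]_(n i.+1, n i)).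
Hypothesis Dex : mx_exact D.

Let V i : lmodType R := kmod (E i) secK.
Let dV i (e : V i) : V i.+1 := KMod secK (killed_linear (d i) (kvalP e)).

Let dV_mxact p q (M : 'M[R]_(p, q)) i (v : 'I_q -> V i) j :
  dV (mxact M v j) = mxact M (fun l => dV (v l)) j.
Proof.
apply: kmod_eq; rewrite /= !kval_sum linear_sum; apply: eq_bigr => l _.
exact: linearZ_LR.
Qed.

Let dV0 i (e : V i) : dV e = 0 -> d i (kval e) = 0.
Proof. by move/(congr1 (@kval _ _ _ _ _ _)). Qed.

(** A walk along a diagonal of the double complex: [t] counts the steps until the degree in [E]
    exceeds [top], where everything vanishes. The way back uses that elements killed by [I] have no
    cohomology beyond the class [xi]. *)
Let zigzag t j l (z : 'I_(n l.+1) -> V j) : (top < j + t)%N -> (g.+2 <= j)%N -> (t <= l)%N ->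
  (forall i, dV (z i) = 0) -> (forall i, mxact (D l.+1) z i = 0) ->
  exists2 w : 'I_(n l) -> V j, forall i, dV (w i) = 0 & forall i, z i = mxact (D l) w i.
Proof.
elim: t j l z => [|t IHt] j l z tj gj tl dz Dz.
  have triv (x : V j) : x = 0.
    by apply: kmod_eq; apply: Etop; rewrite addn0 in tj.
  exists (fun=> 0) => i; last by rewrite [LHS]triv [RHS]triv.
  by apply: kmod_eq; rewrite /= linear0.
have [|y yz] := @inj_ext_ev_exact R n D Dex (V j) l _ z Dz.
  by apply: kmod_inj_ext; exact: iE.
case: l z tl dz Dz y yz => // l z tl dz Dz y yz.
have [|||||w dw wE] := IHt j.+1 l (fun i => dV (y i)) => //.
- by rewrite addSnnS.
- exact: leqW.
- by move=> i; apply: kmod_eq; exact: dd.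
- by move=> i; rewrite -dV_mxact -yz.
have /choice[v vP] : forall i, exists v : V j, w i = dV v.
  move=> i; case: gI => _ ac _.
  have [|||y' ky' y'E] := ac j _ (kval (w i)).
  - by move=> e; rewrite e ltnn in gj.
  - exact: kvalP.
  - exact: dV0 (dw i).
  by exists (KMod secK ky'); apply: kmod_eq.
exists (fun i => y i - mxact (D l) v i) => i.
  have := wE i; rewrite (mxact_ext _ _ vP) -dV_mxact => e.
  apply: kmod_eq; rewrite /= linearB; have := congr1 (@kval _ _ _ _ _ _) e.
  by rewrite /= => ->; rewrite subrr.
rewrite mxactB -yz -mxact_mul Dex.1; by rewrite mxact0 subr0.
Qed.

(** A cocycle f with values in [R] becomes the cocycle f X with values in the killed part of [E].
    The zigzag writes it as an image of cocycles w, and the coefficients of w along [X] give the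
    required preimage of f. *)
Lemma gor_ev_exact k : (top <= k)%N -> ev_exact D (R^o : lmodType R) k.
Proof.
move=> tk f Df; have [_ _ [xi [kxi dxi xigen xiann]]] := gI.
pose X : V g.+2 := KMod secK kxi.
have [|||||w dw wE] := @zigzag top g.+2 k (fun i => f i *: X) => //.
- by rewrite addnC addnS ltnS leq_addr.
- by move=> i; apply: kmod_eq; rewrite /= linearZ_LR /= dxi scaler0.
- move=> i; have := congr1 (fun a => a *: X) (Df i); rewrite scale0r => <-.
  by rewrite /mxact scaler_suml; apply: eq_bigr => j _; rewrite scalerA.
have /choice[c cP] : forall i, exists c, exists y : V g.+1, w i = pr c *: X + dV y.
  move=> i; have [||c [y [ky wiE]]] := xigen (kval (w i)).
  - exact: kvalP.
  - exact: dV0 (dw i).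
  exists c, (KMod secK ky); apply: kmod_eq; rewrite wiE.
  exact: (congr1 (fun v => v + d _ y) (esym (kvalZ c X))).
have [y yP] := choice cP.
exists (fun i => pr (c i)) => j; apply/eqP; rewrite -subr_eq0 -[X in X == 0]secK; apply/eqP.
apply/xiann; exists (kval (mxact (D k) y j)); first exact: kvalP.
have := wE j; rewrite (mxact_ext _ _ yP) => e.
rewrite -[LHS](kvalZ _ X) secK scalerBl e.
have -> : mxact (D k) (fun i => pr (c i) *: X + dV (y i)) j =
   mxact (D k) (fun i => pr (c i) : R^o) j *: X + dV (mxact (D k) y j).
  rewrite dV_mxact /mxact scaler_suml -big_split; apply: eq_bigr => i _.
  by rewrite scalerDr scalerA.
by rewrite addrC addrA [- _ + _]addrC subrr add0r.
Qed.

End QuotientExt.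

(** * Localization *)

Section FractionRing.
Variables (A L : comNzRingType) (W : A -> Prop) (io : {rmorphism A -> L}).

Record is_localization : Prop := IsLocalization {
  loc1 : W 1;
  locM : forall a b, W a -> W b -> W (a * b);
  loc_inv : forall s, W s -> exists t, io s * t = 1;
  loc_frac : forall y, exists2 s, W s & exists a, io s * y = io a;
  loc_eq0 : forall a, io a = 0 <-> exists2 s, W s & s * a = 0 }.

Hypothesis locL : is_localization.

Lemma loc_cancel s x : W s -> io s * x = 0 -> x = 0.
Proof.
move=> /(loc_inv locL)[t st] e; rewrite -[x]mul1r -st [io s * t]mulrC -mulrA e mulr0//.
Qed.

Lemma loc_common n (f : 'I_n -> A -> Prop) : (forall i, exists2 s, W s & f i s) ->
  (forall i s t, f i s -> f i (t * s)) -> exists2 s, W s & forall i, f i s.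
Proof.
move=> ex fM; have : forall r : seq 'I_n, exists2 s, W s & forall i, i \in r -> f i s.
  elim=> [|i r [s Ws fs]]; first by exists 1 => //; exact: (loc1 locL).
  have [t Wt ft] := ex i; exists (s * t); first exact: (locM locL).
  move=> j; rewrite inE => /predU1P[->|/fs fj]; first exact: fM.
  by rewrite mulrC; exact: fM.
by move=> /(_ (enum 'I_n))[s Ws fs]; exists s => // i; apply: fs; rewrite mem_enum.
Qed.

Lemma loc_common_den n (f : 'I_n -> L) :
  exists2 s, W s & exists a : 'I_n -> A, forall i, io s * f i = io (a i).
Proof.
have [i||s Ws sf] := @loc_common n (fun i s => exists a, io s * f i = io a).
- exact: (loc_frac locL).
- by move=> i s t [a e]; exists (t * a); rewrite !rmorphM -mulrA e.
have /choice[a aP] : forall i, exists a, io s * f i = io a by [].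
by exists s => //; exists a.
Qed.

Lemma loc_common_ann n (a : 'I_n -> A) : (forall i, io (a i) = 0) ->
  exists2 s, W s & forall i, s * a i = 0.
Proof.
move=> a0; apply: loc_common => [i|i s t e]; first exact/(loc_eq0 locL).
by rewrite -mulrA e mulr0.
Qed.

Lemma loc_ideal (J : L -> Prop) : ideal J -> ideal (fun a => J (io a)).
Proof.
move=> iJ; split=> [|x y Jx Jy|a x Jx]; first by rewrite rmorph0; exact: ideal0.
  by rewrite rmorphD; exact: idealD.
by rewrite /GRing.scale /= rmorphM; exact: idealMl.
Qed.

Lemma Noeth_loc : Noeth A -> Noeth L.
Proof.
move=> NA J iJ; have [s Js] := NA _ (loc_ideal iJ).
exists (map io s : seq L^o) => y; split=> [Jy|]; last first.
  by apply: Span_min => // _ /mapP[a as_ ->]; apply/Js; exact: mem_Span.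
have [t Wt [a ta]] := loc_frac locL y.
have [t' tt'] := loc_inv locL Wt.
have -> : y = t' *: (io a : L^o) by rewrite /GRing.scale /= -ta mulrA [t' * _]mulrC tt' mul1r.
case: (Span_submod (map io s : seq L^o)) => _ _; apply.
have /Js : J (io a) by rewrite -ta; exact: idealMl.
elim: (s) a {ta} => [|b r IHr] a /=; first by move=> ->; exact: rmorph0.
by move=> [c /IHr h]; exists (io c); move: h; rewrite rmorphB rmorphM.
Qed.

(** An ideal of [L] is generated by its contraction, so a resolution of the contraction localizes to
    one of the ideal; cocycles have finitely many entries and hence a common denominator. *)
Lemma loc_ev_exact (k : nat) :
  (forall J, ideal J -> exists n (D : forall i, 'M[A]_(n i.+1, n i)),
     resolves J D /\ ev_exact D (A^o : lmodType A) k) ->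
  (forall J, ideal J -> exists n (D : forall i, 'M[L]_(n i.+1, n i)),
     resolves J D /\ ev_exact D (L^o : lmodType L) k).
Proof.
move=> H J iJ; have [n [D [[[Dc Dex] [i0 [i0u JE]]] ev]]] := H _ (loc_ideal iJ).
exists n, (fun i => map_mx io (D i)); split; first split; first split.
- by move=> i; rewrite -map_mxM Dc map_mx0.
- move=> i x xD; have [s Ws [a aE]] := loc_common_den (x 0).
  have xa : io s *: x = map_mx io (\row_j a j) by apply/rowP => j; rewrite !mxE aE.
  have [j|t Wt tE] := @loc_common_ann _ (fun j => ((\row_j a j) *m D i) 0 j).
    have : map_mx io ((\row_j a j) *m D i) 0 j = 0.
      by rewrite map_mxM -xa -scalemxAl xD scaler0 mxE.
    by rewrite mxE.
  have /Dex[y yE] : (t *: \row_j a j) *m D i = 0.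
    by rewrite -scalemxAl; apply/rowP => j; rewrite mxE tE mxE.
  have [w we] := loc_inv locL (locM locL Wt Ws).
  exists (w *: map_mx io y); rewrite -scalemxAl -map_mxM -yE map_mxZ -xa !scalerA.
  by rewrite -mulrA -rmorphM mulrC we scale1r.
- exists i0; split=> // a; split=> [Ja|[y <-]].
    have [s Ws [b ab]] := loc_frac locL a.
    have /JE[y yE] : J (io b) by rewrite -ab; exact: idealMl.
    have [w we] := loc_inv locL Ws; exists (w *: map_mx io y).
    rewrite -scalemxAl -map_mxM mxE [X in _ * X]mxE yE -ab mulrA [w * _]mulrC we.
    exact: mul1r.
  rewrite mxE; apply: ideal_sum => // j _; apply: idealMl => //=; rewrite mxE.
  by apply/JE; exists (delta_mx 0 j); rewrite -rowE mxE.
- move=> f Df; have [s Ws [a aE]] := loc_common_den f.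
  have actE p q (M : 'M[A]_(p, q)) (v : 'I_q -> A) j :
      io (mxact M (v : 'I_q -> A^o) j) = mxact (map_mx io M) ((fun l => io (v l)) : 'I_q -> L^o) j.
    rewrite /mxact rmorph_sum; apply: eq_bigr => l _.
    by rewrite /GRing.scale /= rmorphM mxE.
  have actZ p q (M : 'M[L]_(p, q)) c (v : 'I_q -> L) j :
      mxact M ((fun l => c * v l) : 'I_q -> L^o) j = c * mxact M (v : 'I_q -> L^o) j.
    rewrite /mxact mulr_sumr; apply: eq_bigr => l _.
    by rewrite /GRing.scale /= mulrCA.
  have [j|t Wt tE] := @loc_common_ann _ (mxact (D k.+1) (a : 'I_(n k.+1) -> A^o)).
    rewrite actE; transitivity (io s * mxact (map_mx io (D k.+1)) (f : 'I_(n k.+1) -> L^o) j).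
      by rewrite -actZ; apply: eq_bigr => l _; rewrite aE.
    by rewrite [mxact _ _ _]Df mulr0.
  have [|b bE] := ev (fun l => t * a l).
    move=> j; rewrite -[RHS](tE j) /mxact mulr_sumr; apply: eq_bigr => l _.
    by rewrite /GRing.scale /= mulrCA.
  have [w we] := loc_inv locL (locM locL Wt Ws).
  exists (fun l => w * io (b l)) => j.
  rewrite actZ -actE -bE rmorphM -aE !mulrA -[w * _ * _]mulrA -rmorphM [w * _]mulrC we.
  by rewrite mul1r.
Qed.

End FractionRing.

(** * Regular elements of polynomial rings *)

Section ShiftedResolution.
Variables (K : fieldType) (v : nat).
Local Notation S := {mpoly K[v]}.

Lemma mpoly_resolution : exists (E : nat -> lmodType S) (d : forall i, {linear E i -> E i.+1})
    (e : {linear S^o -> E 2}) (top : nat),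
  [/\ [/\ forall i, inj_ext (E i), forall i x, d i.+1 (d i x) = 0,
          forall x : E 0, x = 0, forall x : E 1, x = 0 & injective e],
      forall y, d 2 y = 0 <-> exists x, y = e x,
      forall i y, d i.+3 y = 0 <-> exists x, y = d i.+2 x
    & forall i, (top < i)%N -> forall x : E i, x = 0].
Proof.
have [|E [e [d [[iE einj e0] dd top]]]] := @finite_resolution K S (@mpolyC v K) (S^o : lmodType S) v.
  move=> J iJ; have [n [D DJ]] := Noeth_resolution (@Noeth_mpoly K v) iJ.
  exists n, D; split=> //; apply: mpoly_ev_exact => //; by case: DJ.
(* Two zero modules in front provide the incoming differentials in the lowest degrees, so that
   [acyc] and [gor] have no special case. *)
pose E' i : lmodType S := if i is i'.+2 then E i' else 'rV[S]_0.
pose d' i : {linear E' i -> E' i.+1} :=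
  match i return {linear E' i -> E' i.+1} with i'.+2 => d i' | 1 => \0%R | 0 => \0%R end.
have triv (x : 'rV[S]_0) : x = 0 by exact: thinmx0.
exists E', d', e, v.+2; split; first split=> //.
- by move=> [|[|i]]; [exact: triv_inj_ext|exact: triv_inj_ext|exact: iE].
- by case=> [|[|i]] x; [exact: erefl|exact: linear0|apply/dd; exists x].
- exact: e0.
- exact: dd.
- by case=> [|[|i]] lt; [| |exact: top]; rewrite ltnNge in lt.
Qed.

End ShiftedResolution.

Lemma gor_quotient_ev (K : fieldType) (v : nat) (R : comNzRingType) (pr : {rmorphism {mpoly K[v]} -> R})
    (E : nat -> lmodType {mpoly K[v]}) (d : forall i, {linear E i -> E i.+1}) (top g : nat) :
  (forall i, inj_ext (E i)) -> (forall i x, d i.+1 (d i x) = 0) ->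
  (forall i, (top < i)%N -> forall x : E i, x = 0) ->
  (forall y, exists x, pr x = y) -> gor d g (fun x => pr x = 0) ->
  forall J : R -> Prop, ideal J -> exists n (D : forall i, 'M[R]_(n i.+1, n i)),
     resolves J D /\ ev_exact D (R^o : lmodType R) top.
Proof.
move=> iE dd Etop prS gI J iJ.
have [n [D DJ]] := Noeth_resolution (Noeth_surj prS (@Noeth_mpoly K v)) iJ.
exists n, D; split=> //; have [sec secK] := choice prS.
by apply: (gor_ev_exact iE dd Etop secK gI) => //; case: DJ.
Qed.

Section RegularElements.
Variable S : comNzRingType.
Implicit Types (s : seq S) (f x y : S) (I : S -> Prop).

Lemma ISpan_ideal s : ideal (ISpan s).
Proof. exact: (@Span_submod S S^o). Qed.
Lemma ISpan_mem s f : f \in s -> ISpan s f.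
Proof. exact: (@mem_Span S S^o). Qed.
Lemma ISpan_sub s t x : (forall a, a \in s -> ISpan t a) -> ISpan s x -> ISpan t x.
Proof. exact: (@Span_sub S S^o). Qed.
Lemma ISpan_subset s t x : {subset s <= t} -> ISpan s x -> ISpan t x.
Proof. exact: (@Span_subset S S^o). Qed.

Definition ISpan_eq s t := (forall a, a \in s -> ISpan t a) /\ (forall a, a \in t -> ISpan s a).

Lemma reg_eq s t f : ISpan_eq s t -> reg_mod (ISpan s) f -> reg_mod (ISpan t) f.
Proof. by move=> [st ts] rf c Ic; apply: (ISpan_sub st); apply: rf; exact: (ISpan_sub ts). Qed.

Lemma reg_mul I f g : reg_mod I f -> reg_mod I g -> reg_mod I (f * g).
Proof. by move=> rf rg c; rewrite -mulrA => /rf/rg. Qed.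
Lemma reg_opp I f : ideal I -> reg_mod I f -> reg_mod I (- f).
Proof. by move=> iI rf c; rewrite mulNr => /(idealN iI); rewrite opprK; exact: rf. Qed.
Lemma reg1 I : reg_mod I 1.
Proof. by move=> c; rewrite mul1r. Qed.

Lemma reg_congr I f g : ideal I -> I (f - g) -> reg_mod I g -> reg_mod I f.
Proof.
move=> iI fg rg c Ifc; apply: rg; rewrite -[g * c](subKr (f * c)) -mulrBl.
by apply: idealB => //; exact: idealMr.
Qed.

Lemma reg_left I f g : reg_mod I (g * f) -> ideal I -> reg_mod I f.
Proof. by move=> rgf iI c Ifc; apply: rgf; rewrite -mulrA; exact: idealMl. Qed.

(** The half of the permutability of regular sequences that holds over any commutative ring. *)
Lemma reg_exchange s x y : reg_mod (ISpan s) x -> reg_mod (ISpan (x :: s)) y ->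
  reg_mod (ISpan (y :: s)) x.
Proof.
move=> rx ry c [b Ib]; have iD := ISpan_ideal s.
have [|b' Ib'] := ry b.
  exists c; have := idealN iD Ib; congr (ISpan s); rewrite /GRing.scale /=; ring.
exists b'; apply: rx; have := idealD iD Ib (idealMr y iD Ib'); congr (ISpan s).
by rewrite /GRing.scale /=; ring.
Qed.

(** Multiplication by a embeds S/(s, b) into S/(s, a b) with quotient S/(s, a), and [y] is regular
    on both ends. *)
Lemma reg_prod_gen s a b y : reg_mod (ISpan s) a -> reg_mod (ISpan (a :: s)) y ->
  reg_mod (ISpan (b :: s)) y -> reg_mod (ISpan (a * b :: s)) y.
Proof.
move=> ra rya ryb c [e Ie]; have iD := ISpan_ideal s.
have [|c' Ic'] := rya c.
  by exists (e * b); move: Ie; congr (ISpan s); rewrite /GRing.scale /=; ring.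
have [|c'' Ic''] := ryb c'.
  exists e; apply: ra; have := idealB iD Ie (idealMl y iD Ic'); congr (ISpan s).
  by rewrite /GRing.scale /=; ring.
exists c''; have := idealD iD Ic' (idealMr a iD Ic''); congr (ISpan s).
by rewrite /GRing.scale /=; ring.
Qed.

Lemma reg_poly (I : S -> Prop) (P : {poly S}) (Q : {poly S}) n :
  ideal I -> reg_mod I P`_n -> (size P <= n.+1)%N -> (forall i, I (P * Q)`_i) -> forall i, I Q`_i.
Proof.
move=> iI rP sP; have [m] := ubnP (size Q); elim: m Q => // m IHm Q; rewrite ltnS => sQ PQ.
have [->|Q0] := eqVneq Q 0; first by move=> i; rewrite coef0; exact: ideal0.
pose e := (size Q).-1; have sQe : size Q = e.+1 by rewrite prednK// size_poly_gt0.
have Ie : I Q`_e.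
  apply: rP; have := PQ (n + e)%N; congr I; rewrite coefM.
  rewrite (bigD1 (inord n : 'I_(n + e).+1))//= inordK ?ltnS ?leq_addr// addKn big1 ?addr0//.
  move=> i ine; have [ltin|ltni|e'] := ltngtP i n.
  - by rewrite [Q`__]nth_default ?mulr0// sQe ltn_subRL ltn_add2r.
  - by rewrite nth_default ?mul0r//; exact: leq_trans sP _.
  - by move: ine; rewrite -val_eqE /= inordK ?e' ?eqxx// ltnS leq_addr.
move=> i; rewrite -[Q](subrK (Q`_e *: 'X^e)) coefD coefZ; apply: idealD => //; last exact: idealMr.
apply: IHm => [|j].
  apply: leq_trans (_ : e < m)%N; last by rewrite -sQe.
  rewrite ltnS; apply/leq_sizeP => j; rewrite leq_eqVlt => /predU1P[<-|lt].
    by rewrite coefB coefZ coefXn eqxx mulr1 subrr.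
  rewrite coefB coefZ coefXn gtn_eqF// mulr0 subr0 nth_default// sQe//.
rewrite mulrBr coefB; apply: idealB => //.
rewrite -scalerAr coefZ; exact: idealMr.
Qed.

End RegularElements.

Section FreeVariable.
Variables (K : fieldType) (v : nat) (k : 'I_v).
Local Notation S := {mpoly K[v]}.

(** Expansion in powers of X_k. The coefficients stay in [S], so that they can be tested against
    ideals of [S], and evaluation at X_k recovers the polynomial. *)
Definition tau : S -> {poly S} :=
  mmap ((@polyC S) \o (@mpolyC v K)) (fun j => if j == k then 'X else ('X_j)%:P).
HB.instance Definition _ := GRing.RMorphism.on tau.

Lemma tauC c : tau c%:MP = (c%:MP)%:P. Proof. exact: mmapC. Qed.
Lemma tauX j : tau 'X_j = if j == k then 'X else ('X_j)%:P.
Proof. by rewrite /tau mmapX mmap1U. Qed.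

Lemma tauK f : (tau f).['X_k] = f.
Proof.
have := @mpoly_rmorph_ext K v S (horner_eval 'X_k \o tau) idfun; apply.
  by move=> c; rewrite /= tauC /horner_eval hornerC.
move=> i; rewrite /= tauX /horner_eval; case: eqP => [->|_]; first by rewrite hornerX.
by rewrite hornerC.
Qed.

Definition vfree f := tau f = f%:P.

Lemma vfreeD f g : vfree f -> vfree g -> vfree (f + g).
Proof. by move=> hf hg; rewrite /vfree rmorphD /= hf hg polyCD. Qed.
Lemma vfreeM f g : vfree f -> vfree g -> vfree (f * g).
Proof. by move=> hf hg; rewrite /vfree rmorphM /= hf hg polyCM. Qed.
Lemma vfreeN f : vfree f -> vfree (- f).
Proof. by move=> hf; rewrite /vfree rmorphN /= hf polyCN. Qed.
Lemma vfree1 : vfree 1. Proof. by rewrite /vfree rmorph1. Qed.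
Lemma vfree0 : vfree 0. Proof. by rewrite /vfree rmorph0. Qed.
Lemma vfreeXn f n : vfree f -> vfree (f ^+ n).
Proof. by move=> hf; rewrite /vfree rmorphXn /= hf polyC_exp. Qed.
Lemma vfreeX j : j != k -> vfree 'X_j.
Proof. by move=> /negbTE jk; rewrite /vfree tauX jk. Qed.

Lemma ISpan_tau (s : seq S) f : (forall a, a \in s -> vfree a) -> ISpan s f -> forall i, ISpan s (tau f)`_i.
Proof.
move=> vs Sf i; have [c ->] := (@Span_sum S S^o s f).1 Sf.
rewrite rmorph_sum coef_sum; apply: ideal_sum => [|j _]; first exact: ISpan_ideal.
rewrite /GRing.scale /= rmorphM /= [tau s`_j]vs ?mem_nth// coefMC.
by apply: idealMl; [exact: ISpan_ideal|apply: ISpan_mem; rewrite mem_nth].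
Qed.

(** Generators free of X_k make membership in the ideal a condition on each coefficient; then a
    leading coefficient that is regular suffices. The explicit regular sequences below rest on this
    test. *)
Lemma reg_top (s : seq S) f a (b : {poly S}) n : (forall a, a \in s -> vfree a) -> vfree a -> (size b <= n)%N ->
  tau f = a%:P * 'X^n + b -> reg_mod (ISpan s) a -> reg_mod (ISpan s) f.
Proof.
move=> vs va sb fE ra c Sfc; have iS := ISpan_ideal s.
have H : forall i, ISpan s (tau c)`_i.
  apply: (@reg_poly S (ISpan s) (tau f) (tau c) n) => //.
  - by rewrite fE coefD coefCM coefXn eqxx mulr1 [b`_n]nth_default// addr0.
  - rewrite fE; apply: leq_trans (size_polyD _ _) _; rewrite geq_max (leq_trans sb)// andbT.
    by rewrite mul_polyC (leq_trans (size_scale_leq _ _))// size_polyXn.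
  - by move=> i; rewrite -rmorphM; exact: ISpan_tau.
rewrite -[c]tauK horner_coef; apply: ideal_sum => // i _; exact: idealMr.
Qed.

Lemma reg_top1 (s : seq S) f a b : (forall a, a \in s -> vfree a) -> vfree a -> vfree b ->
  f = a * 'X_k + b -> reg_mod (ISpan s) a -> reg_mod (ISpan s) f.
Proof.
move=> vs va vb fE; apply: (@reg_top s f a b%:P 1) => //; first exact: size_polyC_leq1.
by rewrite fE rmorphD rmorphM /= [tau a]va [tau b]vb tauX eqxx expr1.
Qed.

Lemma reg_var (s : seq S) : (forall a, a \in s -> vfree a) -> reg_mod (ISpan s) 'X_k.
Proof.
move=> vs; apply: (@reg_top1 s _ 1 0) => //; [exact: vfree1|exact: vfree0| |exact: reg1].
by rewrite mul1r addr0.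
Qed.

End FreeVariable.

(** * Factorial rings *)

Section Factorial.
Variable R : comNzRingType.

Definition dvd (a b : R) : Prop := exists c, b = c * a.
(** Factorizations are taken into primes instead of irreducibles: their uniqueness is then
    automatic, and the number of factors, recorded in [facn], drives the inductions. *)
Definition prime_elt (p : R) : Prop :=
  [/\ p <> 0, ~ ring_unit p & forall a b, dvd p (a * b) -> dvd p a \/ dvd p b].
Definition facn (n : nat) (x : R) : Prop := exists e s, [/\ ring_unit e, forall y, y \in s -> prime_elt y,
  size s = n & x = e * \prod_(y <- s) y].
Definition fac (x : R) : Prop := exists n, facn n x.
Definition factorial : Prop := forall x, x <> 0 -> fac x.

Lemma dvd_mull a b c : dvd a b -> dvd a (c * b).
Proof. by move=> [d ->]; exists (c * d); rewrite mulrA. Qed.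
Lemma dvd_trans a b c : dvd a b -> dvd b c -> dvd a c.
Proof. by move=> ab [d ->]; exact: dvd_mull. Qed.
Lemma ring_unit1 : ring_unit (1 : R). Proof. by exists 1; rewrite mulr1. Qed.
Lemma ring_unitM (a b : R) : ring_unit a -> ring_unit b -> ring_unit (a * b).
Proof. by move=> [a' aa'] [b' bb']; exists (a' * b'); rewrite mulrACA aa' bb' mulr1. Qed.
Lemma ring_unit_dvd (a b : R) : dvd a b -> ring_unit b -> ring_unit a.
Proof. by move=> [c ->] [d cd]; exists (c * d); rewrite mulrA [a * c]mulrC. Qed.
Lemma ring_unit_divr (a b : R) : ring_unit (a * b) -> ring_unit b.
Proof. by apply: ring_unit_dvd; exists a. Qed.

Lemma facM x y : fac x -> fac y -> fac (x * y).
Proof.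
move=> [m [e [s [ue ps sm ->]]]] [n [f [t [uf pt tn ->]]]]; exists (m + n)%N, (e * f), (s ++ t).
split; [exact: ring_unitM| |by rewrite size_cat sm tn|by rewrite big_cat /= mulrACA].
by move=> z; rewrite mem_cat => /orP[/ps|/pt].
Qed.
Lemma fac_unit e : ring_unit e -> fac e.
Proof. by move=> ue; exists 0%N, e, [::]; split=> //; rewrite big_nil mulr1. Qed.
Lemma fac_prime p : prime_elt p -> fac p.
Proof.
move=> pp; exists 1%N, 1, [:: p]; split; [exact: ring_unit1| |by []|by rewrite big_seq1 mul1r].
by move=> y; rewrite inE => /eqP ->.
Qed.

Lemma prime_prod p (s : seq R) : prime_elt p -> dvd p (\prod_(y <- s) y) -> exists2 y, y \in s & dvd p y.
Proof.
move=> [_ np pp]; elim: s => [|y s IHs]; first by rewrite big_nil => /ring_unit_dvd/(_ ring_unit1).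
rewrite big_cons => /pp[py|/IHs[z zs pz]]; first by exists y; rewrite ?mem_head.
by exists z; rewrite // inE zs orbT.
Qed.

Hypothesis dom : GRing.integral_domain_axiom R.

Lemma dom_mulI (a x y : R) : a <> 0 -> a * x = a * y -> x = y.
Proof.
move=> a0 /eqP; rewrite -subr_eq0 -mulrBr => /eqP/dom/orP[/eqP//|].
by rewrite subr_eq0 => /eqP.
Qed.

Lemma dom_mul_neq0 (x y : R) : x <> 0 -> y <> 0 -> x * y <> 0.
Proof. by move=> x0 y0 /dom/orP[/eqP|/eqP]. Qed.

Lemma ring_unit_neq0 (x : R) : ring_unit x -> x <> 0.
Proof. by move=> [y xy] x0; move/eqP: xy; rewrite x0 mul0r eq_sym oner_eq0. Qed.

Lemma prime_dvd_prime p q : prime_elt p -> prime_elt q -> dvd p q -> exists2 e, ring_unit e & q = e * p.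
Proof.
move=> [p0 np _] [q0 nq pq] [c qE]; exists c => //.
have [[d cE]|[d pE]] := pq c p ltac:(by exists 1; rewrite mul1r).
  case: np; exists d; apply: (dom_mulI q0); rewrite mulr1 {2}qE cE; ring.
by exists d; apply: (dom_mulI p0); rewrite mulr1 {2}pE qE; ring.
Qed.

Lemma facn_div n p x : prime_elt p -> facn n (p * x) -> facn n.-1 x /\ (0 < n)%N.
Proof.
move=> pp [e [s [ue ps sn xE]]]; have [p0 np pdvd] := pp.
have : dvd p (e * \prod_(y <- s) y) by exists x; rewrite -xE mulrC.
case/pdvd => [/ring_unit_dvd/(_ ue)//|/(prime_prod pp)[y ys py]].
have [f uf yE] := prime_dvd_prime pp (ps _ ys) py.
split; last by rewrite -sn; case: (s) ys.
exists (e * f), (rem y s); split; [exact: ring_unitM| |by rewrite size_rem ?sn|].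
  by move=> z /mem_rem; exact: ps.
apply: (dom_mulI p0); rewrite xE (perm_big _ (perm_to_rem ys)) big_cons.
rewrite /=; set B := \prod_(j <- _) j; rewrite {1}yE; ring.
Qed.

Lemma fac_div p x : prime_elt p -> fac (p * x) -> fac x.
Proof. by move=> pp [n /(facn_div pp)[fx _]]; exists n.-1. Qed.

Lemma fac_divX p k x : prime_elt p -> fac (p ^+ k * x) -> fac x.
Proof.
move=> pp; elim: k => [|k IHk]; first by rewrite expr0 mul1r.
by rewrite exprS -mulrA => /(fac_div pp)/IHk.
Qed.

Lemma prime_expr_dvd p q k x : prime_elt p -> ~ dvd p q -> dvd q (p ^+ k * x) -> dvd q x.
Proof.
move=> [p0 _ pp] pq; elim: k x => [|k IHk] x; first by rewrite expr0 mul1r.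
rewrite exprS -mulrA => -[c e]; apply: IHk.
have [[d cE]|//] := pp c q ltac:(by exists (p ^+ k * x); rewrite -e mulrC).
by exists d; apply: (dom_mulI p0); rewrite e cE; ring.
Qed.

(** Suppose every power of p divides x. The union [J] of the ideals (x : p^k) is finitely generated,
    so one k serves for all of it; for x = p^(k+1) y the element y is in [J], so x divides p^k y and
    p is a unit. *)
Lemma prime_valuation p x : Noeth R -> prime_elt p -> x <> 0 -> exists k y, x = p ^+ k * y /\ ~ dvd p y.
Proof.
move=> nR pp x0; apply: contrapT => H; have [p0 np _] := pp.
have dv k : exists y, x = p ^+ k * y.
  elim: k => [|k [y yE]]; first by exists x; rewrite expr0 mul1r.
  have [[z zE]|py] := pselect (dvd p y); last by case: H; exists k, y.
  by exists z; rewrite yE zE exprS; ring.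
pose J y := exists k, dvd x (p ^+ k * y).
have iJ : ideal J.
  split=> [|y z [k [a ya]] [l [b zb]]|a y [k [b yb]]].
  - by exists 0%N, 0; rewrite mulr0 mul0r.
  - exists (k + l)%N, (a * p ^+ l + b * p ^+ k); rewrite exprD.
    by transitivity (p ^+ l * (p ^+ k * y) + p ^+ k * (p ^+ l * z)); [ring|rewrite ya zb; ring].
  - by exists k, (a * b); rewrite /GRing.scale /= -mulrA -yb; ring.
have [s sJ] := nR J iJ.
have [k kP] : exists k, forall y, y \in s -> dvd x (p ^+ k * y).
  have : forall y, y \in s -> J y by move=> y ys; apply/sJ; exact: mem_Span.
  elim: s {sJ} => [|y s IHs] h; first by exists 0%N.
  have [z zs|k kP] := IHs; first by apply: h; rewrite inE zs orbT.
  have [l [a la]] := h y (mem_head _ _); exists (k + l)%N => z; rewrite inE => /predU1P[->|/kP].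
    by exists (p ^+ k * a); rewrite exprD -[LHS]mulrA la mulrA.
  by move=> [b zb]; exists (p ^+ l * b); transitivity (p ^+ l * (p ^+ k * z)); [rewrite exprD; ring|rewrite zb; ring].
have [y yE] := dv k.+1.
have : J y by exists k.+1, 1; rewrite mul1r.
move=> /sJ /(@Span_sum R R^o)[c cE].
have [d dE] : dvd x (p ^+ k * y).
  rewrite cE mulr_sumr.
  have kd (i : 'I_(size s)) : exists d, p ^+ k * s`_i = d * x by exact: kP (mem_nth _ _).
  exists (\sum_i c i * sval (cid (kd i))); rewrite mulr_suml; apply: eq_bigr => i _.
  by case: (cid (kd i)) => d dE /=; rewrite /GRing.scale /= mulrCA dE mulrA.
case: np; exists d; apply: (dom_mulI x0); rewrite mulr1 {2}yE.
by rewrite exprS -mulrA dE; ring.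
Qed.

End Factorial.

(** * Nagata's criterion *)

Section Nagata.
Variables (P R : comNzRingType) (phi : {rmorphism P -> R}) (p : P).
Hypotheses (domR : GRing.integral_domain_axiom R) (nR : Noeth R) (phi_inj : injective phi)
  (fP : factorial P) (pp : prime_elt (phi p))
  (clear_p : forall x, exists k y, phi p ^+ k * x = phi y).

(** If q divides p, then phi q divides a prime. Otherwise remove from phi q the full power of the
    prime phi p: the rest y is a unit or prime, since a divisibility by y can be moved to [P] by
    multiplying with powers of p, which are then cancelled because p does not divide y in [R]. *)
Lemma fac_image_prime q : prime_elt q -> fac (phi q).
Proof.
move=> [q0 nq pq]; have [p0 np pdvd] := pp.
have [[c pE]|nqp] := pselect (dvd q p).
  have pqE : phi p = phi c * phi q by rewrite -rmorphM -pE.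
  have [[d dE]|[d dE]] := pdvd (phi c) (phi q) ltac:(by exists 1; rewrite -pqE mul1r).
    apply: fac_unit; exists d.
    by apply: (dom_mulI domR p0); rewrite mulr1 [in RHS]pqE dE; ring.
  rewrite dE; apply: facM; last exact: fac_prime.
  by apply: fac_unit; exists (phi c); apply: (dom_mulI domR p0); rewrite mulr1 [in RHS]pqE dE; ring.
have q0' : phi q <> 0 by rewrite -[0](rmorph0 phi) => /phi_inj.
have [e [y [yE npy]]] := prime_valuation domR nR pp q0'.
rewrite yE; apply: facM.
  by elim: e {yE} => [|e IHe]; [rewrite expr0; exact: fac_unit (ring_unit1 _)|
    rewrite exprS; apply: facM => //; exact: fac_prime].
have [uy|ny] := pselect (ring_unit y); first exact: fac_unit.
apply: fac_prime; split=> // [y0|a b [c abE]]; first by apply: q0'; rewrite yE y0 mulr0.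
have [k [a1 aE]] := clear_p a; have [l [b1 bE]] := clear_p b; have [m [c1 cE]] := clear_p c.
have ndvd x z n : phi p ^+ n * x = phi z -> dvd q z -> dvd y x.
  move=> xz [s zE]; apply: (prime_expr_dvd domR (k := n) pp npy).
  by exists (phi s * phi p ^+ e); rewrite xz zE rmorphM yE mulrA.
have qp n z : dvd q (p ^+ n * z) -> dvd q z.
  elim: n => [|n IHn]; first by rewrite expr0 mul1r.
  by rewrite exprS -mulrA => /pq[//|/IHn].
have : dvd q (a1 * b1).
  apply: (qp (e + m)%N); exists (p ^+ (k + l) * c1); apply: phi_inj.
  rewrite !rmorphM !rmorphXn /= -aE -bE -cE yE !exprD.
  transitivity (phi p ^+ e * phi p ^+ m * phi p ^+ k * phi p ^+ l * (a * b)); first by ring.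
  by rewrite abE; ring.
case/pq => [/(ndvd _ _ _ aE)|/(ndvd _ _ _ bE)]; [left|right] => //.
Qed.

Lemma factorial_nagata : factorial R.
Proof.
move=> x x0; have [k [y xE]] := clear_p x; have [p0 _ _] := pp.
apply: (fac_divX domR pp (k := k)); rewrite xE.
have y0 : y <> 0.
  move=> y0; move/eqP: xE; rewrite y0 rmorph0 => /eqP; apply: (dom_mul_neq0 domR) => //.
  elim: k => [|k IHk]; first by rewrite expr0; apply/eqP; rewrite oner_eq0.
  by rewrite exprS; exact: dom_mul_neq0.
have [_ [e [s [[e' ee'] ps _ ->]]]] := fP y0; rewrite rmorphM; apply: facM.
  by apply: fac_unit; exists (phi e'); rewrite -rmorphM ee' rmorph1.
rewrite rmorph_prod; elim: s ps => [|z s IHs] ps.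
  by rewrite big_nil; exact: fac_unit (ring_unit1 _).
rewrite big_cons; apply: facM; first by apply: fac_image_prime; apply: ps; rewrite mem_head.
by apply: IHs => w ws; apply: ps; rewrite inE ws orbT.
Qed.
End Nagata.

Section Unique.
Variable R : comNzRingType.
Hypotheses (dom : GRing.integral_domain_axiom R) (fR : factorial R).

Lemma irreducible_prime (x : R) : irreducible_elt x -> prime_elt x.
Proof.
move=> [x0 nx ix]; have [_ [e [[|p s] [ue ps _ xE]]]] := fR x0.
  by case: nx; rewrite xE big_nil mulr1.
have [p0 np pp] := ps p (mem_head _ _).
pose f := e * \prod_(y <- s) y; have {}xE : x = f * p by rewrite xE big_cons /f /=; ring.
clearbody f; clear ps.
have [[f' ff']|//] := ix _ _ xE.
split=> // a b [c abE].
have /pp[[d dE]|[d dE]] : dvd p (a * b) by exists (c * f); rewrite abE xE mulrA.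
  by left; exists (d * f'); rewrite dE; transitivity (d * p * (f * f')); [rewrite ff' mulr1|rewrite xE; ring].
by right; exists (d * f'); rewrite dE; transitivity (d * p * (f * f')); [rewrite ff' mulr1|rewrite xE; ring].
Qed.

Lemma unique_factorization (s t : seq R) e : ring_unit e ->
  (forall y, y \in s -> irreducible_elt y) -> (forall y, y \in t -> irreducible_elt y) ->
  \prod_(y <- s) y = e * \prod_(y <- t) y ->
  exists t', [/\ perm_eq t' t, size t' = size s & forall i, (i < size s)%N -> associates s`_i t'`_i].
Proof.
elim: s t e => [|a s IHs] t e ue is_ it.
  rewrite big_nil => e1; case: t it e1 => [|b t] it; first by exists [::].
  have [_ nb _] := it b (mem_head _ _); rewrite big_cons => e1; case: nb.
  by exists (e * \prod_(y <- t) y); rewrite [RHS]e1 /=; ring.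
rewrite big_cons => E; have ia := is_ a (mem_head _ _); have pa := irreducible_prime ia.
have [a0 na pdvd] := pa.
have [/ring_unit_dvd/(_ ue)//|/(prime_prod pa)[b bt [c bE]]] : dvd a e \/ dvd a (\prod_(y <- t) y).
  by apply: pdvd; rewrite -E; exists (\prod_(y <- s) y); rewrite mulrC.
have [_ _ ib] := it b bt; have [uc|//] := ib _ _ bE.
have [||||t' [pt' st' at']] := IHs (rem b t) (e * c).
- exact: ring_unitM.
- by move=> y ys; apply: is_; rewrite inE ys orbT.
- by move=> y /mem_rem; exact: it.
- apply: (dom_mulI dom a0); rewrite E (perm_big _ (perm_to_rem bt)) big_cons.
  by rewrite /=; set B := \prod_(j <- _) j; rewrite {1}bE; ring.
exists (b :: t'); split=> /=; first by rewrite perm_sym (permPl (perm_to_rem bt)) perm_cons perm_sym.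
  by rewrite st'.
by move=> [|i] //= i_s; [exists c|exact: at'].
Qed.

Lemma factorial_ufd : ufd R.
Proof.
split=> // [x x0 nx|s t is_ it E].
  have [_ [e [s [ue ps _ xE]]]] := fR x0.
  have pir (y : R) : prime_elt y -> irreducible_elt y.
    move=> [y0 ny py]; split=> // a b yE.
    have [[c aE]|[c bE]] := py a b ltac:(by exists 1; rewrite mul1r).
      right; exists c; apply: (dom_mulI dom y0); rewrite mulr1 [in RHS]yE aE; ring.
    left; exists c; apply: (dom_mulI dom y0); rewrite mulr1 [in RHS]yE bE; ring.
  case: s ps xE => [|p s] ps xE; first by case: nx; rewrite xE big_nil mulr1.
  exists (e * p :: s); split; last by rewrite xE !big_cons mulrA.
  move=> y; rewrite inE => /predU1P[->|ys]; last by apply: pir; apply: ps; rewrite inE ys orbT.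
  have [p0 np pp] := ps p (mem_head _ _); have [e' ee'] := ue.
  split.
  - by apply: (dom_mul_neq0 dom) => //; exact: ring_unit_neq0 ue.
  - by move/ring_unit_divr.
  move=> a b epE; have [_ _ ip] := pir _ (And3 p0 np pp).
  have [|[c cE]|ub] := ip (e' * a) b; [|left|by right].
    by rewrite -mulrA -epE mulrA [e' * e]mulrC ee' mul1r.
  by exists (c * e'); rewrite -cE; ring.
have [|t' [pt st at']] := unique_factorization (ring_unit1 R) is_ it; first by rewrite mul1r.
have sst : size s = size t by rewrite -st (perm_size pt).
split=> //; move: pt at' st; rewrite sst => pt at' st.
have tt : size t' = size t by rewrite (perm_size pt).
have /tuple_permP[f fE] : perm_eq t' (in_tuple t) by [].
exists f => i; have := at' i (ltn_ord i); congr (associates _ _).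
rewrite fE (nth_map i) ?size_enum_ord// -tnth_nth.
by rewrite tnth_ord_tuple (tnth_nth 0).
Qed.
End Unique.

(** * Gauss's lemma *)

Section Gauss.
Variable A : idomainType.
Local Notation P := {poly A}.
Hypothesis fA : factorial A.

Let domA : GRing.integral_domain_axiom A. Proof. by move=> x y /eqP; rewrite mulf_eq0. Qed.
Let domP : GRing.integral_domain_axiom P. Proof. by move=> x y /eqP; rewrite mulf_eq0. Qed.

Lemma dvd_polyC a (f : P) : dvd a%:P f <-> forall i, dvd a f`_i.
Proof.
split=> [[g ->] i|h]; first by exists g`_i; rewrite coefMC.
exists (\poly_(i < size f) sval (cid (h i))); apply/polyP => i; rewrite coefMC coef_poly.
by case: ltnP => i_s; [case: (cid (h i))|rewrite mul0r nth_default].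
Qed.

Lemma prime_polyC p : prime_elt p -> prime_elt (p%:P : P).
Proof.
move=> [p0 np pp]; split=> [/eqP|[y /(congr1 (fun f : P => f`_0))]|f g].
- by rewrite polyC_eq0 => /eqP.
- by rewrite coefCM coef1 => py; apply: np; exists y`_0.
rewrite !dvd_polyC => h; apply: contrapT => /not_orP[/existsNP hf /existsNP hg].
have /ex_minnP[i /asboolP fi imin] : exists i, `[< ~ dvd p f`_i >] by case: hf => i hi; exists i; apply/asboolP.
have /ex_minnP[j /asboolP gj jmin] : exists j, `[< ~ dvd p g`_j >] by case: hg => j hj; exists j; apply/asboolP.
have fl k : (k < i)%N -> dvd p f`_k.
  by move=> ki; apply: contrapT => /asboolP/imin; rewrite leqNgt ki.
have gl k : (k < j)%N -> dvd p g`_k.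
  by move=> kj; apply: contrapT => /asboolP/jmin; rewrite leqNgt kj.
have : dvd p (f`_i * g`_j).
  have dB a b : dvd p a -> dvd p b -> dvd p (a - b).
    by move=> [c ->] [d ->]; exists (c - d); rewrite mulrBl.
  have := h (i + j)%N; rewrite coefM (bigD1 (inord i)) //= inordK ?ltnS ?leq_addr// addKn => hd.
  rewrite -[f`_i * g`_j](addrK (\sum_(k < (i + j).+1 | k != inord i) f`_k * g`_(i + j - k))).
  apply: dB => //; apply: (big_ind (dvd p)) => [|a b [c ->] [d ->]|k ki].
  - by exists 0; rewrite mul0r.
  - by exists (c + d); rewrite mulrDl.
  - have [kli|ilk|e] := ltngtP k i.
    + by rewrite mulrC; apply: dvd_mull; exact: fl.
    + apply: dvd_mull; apply: gl; rewrite ltn_subLR ?ltn_add2r//.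
      by rewrite -ltnS.
    + by case/eqP: ki; apply: ord_inj; rewrite inordK ?ltnS ?leq_addr.
by case/pp.
Qed.

(** The prime factors of c stay prime in A[X], so each divides one of the two factors; they are
    removed one at a time. *)
Lemma polyC_strip c (b h k : P) : c <> 0 -> c%:P * b = h * k ->
  exists c1 c2 h' k', [/\ c = c1 * c2, h = c1%:P * h', k = c2%:P * k' & b = h' * k'].
Proof.
move=> /fA[_ [e [s [[e' ee'] ps _ ->]]]]; elim: s ps h k => [|p s IHs] ps h k.
  rewrite big_nil mulr1 => E; exists e, 1, (e'%:P * h), k; split.
  - by rewrite mulr1.
  - by rewrite mulrA -polyCM ee' mul1r.
  - by rewrite mul1r.
  - by rewrite -mulrA -E mulrA -polyCM [e' * e]mulrC ee' mul1r.
have pp := ps p (mem_head _ _); have [p0 _ pdvd] := prime_polyC pp.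
have {}IHs := IHs (fun y ys => ps y (mem_behead (s := p :: s) ys)).
rewrite big_cons; set t := \prod_(y <- s) y => E.
have : dvd p%:P (h * k) by exists ((e * t)%:P * b); rewrite -E /= !polyCM; ring.
case/pdvd => -[h1 hE].
- have [|c1 [c2 [h' [k' [cE h1E kE bE]]]]] := IHs h1 k.
    by apply: (dom_mulI domP p0); rewrite mulrA -polyCM [p * _]mulrCA E hE; ring.
  exists (c1 * p), c2, h', k'; split=> //; last by rewrite hE h1E polyCM; ring.
  by rewrite mulrCA cE; ring.
- have [|c1 [c2 [h' [k' [cE hE' k1E bE]]]]] := IHs h h1.
    by apply: (dom_mulI domP p0); rewrite mulrA -polyCM [p * _]mulrCA E hE; ring.
  exists c1, (c2 * p), h', k'; split=> //; last by rewrite hE k1E polyCM; ring.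
  by rewrite mulrCA cE; ring.
Qed.

Definition prim (g : P) : Prop := forall p, prime_elt p -> ~ dvd p%:P g.

Lemma prim_unit c (g h : P) : c <> 0 -> prim g -> g = c%:P * h -> ring_unit c.
Proof.
move=> /fA[_ [e [[|p s] [ue ps _ ->]]]] pg gE; first by rewrite big_nil mulr1.
case: (pg p (ps _ (mem_head _ _))); exists ((e * \prod_(y <- s) y)%:P * h).
by rewrite gE big_cons !polyCM; ring.
Qed.

(** Induction on the number of prime factors of the leading coefficient: each constant prime
    dividing f uses up one of them. *)
Lemma prim_part (f : P) : f <> 0 -> exists c g, [/\ c <> 0, f = c%:P * g & prim g].
Proof.
move=> f0; have l0 : lead_coef f <> 0 by apply/eqP; rewrite lead_coef_eq0; apply/eqP.
have [n] := fA l0; elim: n f {f0} l0 => [|n IHn] f l0 fn.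
  exists 1, f; split; [by apply/eqP; rewrite oner_eq0|by rewrite mul1r|].
  move=> p pp [g gE]; move: fn; rewrite gE lead_coefM lead_coefC mulrC.
  by move=> /(facn_div domA pp)[].
have [pf|npf] := pselect (prim f).
  by exists 1, f; split=> //; [apply/eqP; rewrite oner_eq0|rewrite mul1r].
have [p [pp [g gE]]] : exists p, prime_elt p /\ dvd p%:P f.
  by apply: contrapT => h; apply: npf => p pp pf; apply: h; exists p.
have lE : lead_coef f = p * lead_coef g by rewrite gE lead_coefM lead_coefC mulrC.
have [|fn' _] := facn_div domA pp (n := n.+1) (x := lead_coef g); first by rewrite -lE.
have [|//|c [g' [c0 g'E pg']]] := IHn g; first by move=> lg; apply: l0; rewrite lE lg mulr0.
have [p0 _ _] := pp.
exists (p * c), g'; split=> //; first exact: (dom_mul_neq0 domA).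
by rewrite gE g'E polyCM; ring.
Qed.

Lemma fac_polyC c : c <> 0 -> fac (c%:P : P).
Proof.
move=> /fA[_ [e [s [[e' ee'] ps _ ->]]]]; rewrite polyCM; apply: facM.
  by apply: fac_unit; exists e'%:P; rewrite -polyCM ee'.
elim: s ps => [|p s IHs] ps; first by rewrite big_nil; exact: fac_unit (ring_unit1 _).
rewrite big_cons polyCM; apply: facM; first by apply/fac_prime/prime_polyC/ps; rewrite mem_head.
by apply: IHs => y ys; apply: ps; rewrite inE ys orbT.
Qed.

Lemma prim_dvdp (g a : P) : prim g -> g %| a -> dvd g a.
Proof.
move=> pg /Pdiv.Idomain.dvdpP[[c q] /= c0]; rewrite -mul_polyC => /polyC_strip[|c1 [c2 [h [k [cE _ gE ->]]]]].
  exact/eqP.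
have c20 : c2 <> 0 by move=> c20; move/eqP: c0; apply; rewrite cE c20 mulr0.
have [c2' cc] := prim_unit c20 pg gE.
by exists (h * c2'%:P); rewrite gE mulrA -[h * _ * _]mulrA -polyCM [c2' * _]mulrC cc mulr1.
Qed.

(** If g does not divide a, their greatest common divisor up to constants is constant, because g has
    no proper factor of positive degree; coprimality then gives g | b up to a constant, and
    primitivity removes the constant. *)
Lemma prim_prime (g : P) : prim g -> (1 < size g)%N ->
  (forall h k, g = h * k -> (size h <= 1)%N \/ (size k <= 1)%N) -> prime_elt g.
Proof.
move=> pg sg irr; have g0 : g != 0 by rewrite -size_poly_gt0 (ltn_trans _ sg).
split=> [|[y /(congr1 (size \o val))/=]|a b [c cE]]; first exact/eqP.
  move=> gy; have y0 : y != 0.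
    by apply: contra_eq_neq gy => ->; rewrite mulr0 size_poly0 size_poly1.
  have sy : (0 < size y)%N by rewrite size_poly_gt0.
  move: gy; rewrite size_mul// size_poly1; move: sg sy.
  by case: (size g) (size y) => [|[|m]] [|n] //=; rewrite addnS.
have gab : g %| a * b by rewrite cE dvdp_mulIr.
have [ga|nga] := boolP (g %| a); first by left; exact: prim_dvdp.
right; apply: prim_dvdp => //; rewrite -(Gauss_dvdpr b (q := a)) //.
set d := gcdp g a; have d0 : d != 0 by rewrite gcdp_eq0 (negPf g0).
have /Pdiv.Idomain.dvdpP[[e q] /= e0] := dvdp_gcdl g a.
rewrite -/d -mul_polyC => /polyC_strip[|c1 [c2 [h [k [eE _ dE gE]]]]]; first exact/eqP.
have c20 : c2 != 0 by apply: contraNneq e0 => c20; rewrite eE c20 mulr0.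
have sdk : size d = size k by rewrite dE mul_polyC size_scale.
rewrite /coprimep -/d; case: (irr _ _ gE) => [sh|sk]; last first.
  by rewrite eqn_leq size_poly_gt0 d0 sdk sk.
case/negP: nga; apply: dvdp_trans (dvdp_gcdr g a).
have : d %= g.
  rewrite -dvdp_size_eqp ?dvdp_gcdl// sdk gE; apply/eqP.
  have h0 : h != 0 by apply: contraNneq g0 => h0; rewrite gE h0 mul0r.
  by rewrite (size1_polyC sh) mul_polyC size_scale//; move: h0; rewrite {1}(size1_polyC sh) polyC_eq0.
by case/andP.
Qed.

Lemma factorial_poly : factorial P.
Proof.
move=> f f0; have [c [g [c0 fE pg]]] := prim_part f0; rewrite fE; apply: facM; first exact: fac_polyC.
have g0 : g <> 0 by move=> g0; apply: f0; rewrite fE g0 mulr0.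
have [n] := ubnP (size g); elim: n g pg g0 {f f0 c c0 fE} => // n IHn g pg /eqP g0; rewrite ltnS => sg.
have [s1|s1] := leqP (size g) 1.
  by rewrite (size1_polyC s1); apply: fac_polyC => e; move: g0; rewrite (size1_polyC s1) e eqxx.
have [[h [k [gE sh sk]]]|irr] := pselect (exists h k, [/\ g = h * k, (1 < size h)%N & (1 < size k)%N]).
  have /andP[h0 k0] : (h != 0) && (k != 0) by rewrite -negb_or -mulf_eq0 -gE.
  have ss : size g = (size h + size k).-1 by rewrite gE size_mul.
  rewrite gE; apply: facM; apply: IHn.
  - by move=> p pp ph; apply: (pg p pp); rewrite gE mulrC; exact: dvd_mull.
  - exact/eqP.
  - by apply: leq_trans sg; rewrite ss; move: sk; case: (size k) => [|[|m]] // _; rewrite !addnS /= ltnS leq_addr.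
  - by move=> p pp ph; apply: (pg p pp); rewrite gE; exact: dvd_mull.
  - exact/eqP.
  - by apply: leq_trans sg; rewrite ss; move: sh; case: (size h) => [|[|m]] // _; rewrite !addSn /= ltnS leq_addl.
apply/fac_prime/prim_prime => // h k gE.
have [sh|sh] := leqP (size h) 1; first by left.
have [sk|sk] := leqP (size k) 1; first by right.
by case: irr; exists h, k.
Qed.
End Gauss.

Lemma factorial_iso (A B : comNzRingType) (f : {rmorphism A -> B}) (g : {rmorphism B -> A}) :
  cancel f g -> cancel g f -> factorial A -> factorial B.
Proof.
move=> fK gK fA x x0; have gx0 : g x <> 0 by move=> gx; apply: x0; rewrite -[x]gK gx rmorph0.
have [_ [e [s [[e' ee'] ps _ gE]]]] := fA _ gx0; rewrite -[x]gK gE rmorphM; apply: facM.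
  by apply: fac_unit; exists (f e'); rewrite -rmorphM ee' rmorph1.
rewrite rmorph_prod; elim: s ps {gE} => [|p s IHs] ps; first by rewrite big_nil; exact: fac_unit (ring_unit1 _).
rewrite big_cons; apply: facM; last by apply: IHs => y ys; apply: ps; rewrite inE ys orbT.
apply: fac_prime; have [p0 np pp] := ps p (mem_head _ _); split.
- by move=> fp; apply: p0; rewrite -[p]fK fp rmorph0.
- by move=> [y fy]; apply: np; exists (g y); rewrite -[p]fK -rmorphM fy rmorph1.
move=> a b [c abE]; have /pp : dvd p (g a * g b).
  by exists (g c); rewrite -rmorphM abE rmorphM /= fK.
by case=> -[d dE]; [left|right]; exists (f d); rewrite -rmorphM -dE gK.
Qed.

Lemma factorial_mpoly (K : fieldType) n : factorial {mpoly K[n]}.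
Proof.
elim: n => [|n IHn]; last first.
  exact: (@factorial_iso _ _ (@mpoly_of_poly K n) (@muni n K) (@mpoly_of_polyK K n) (@muniK K n)
    (factorial_poly IHn)).
move=> x x0; have [c cE] : exists c, x = c%:MP by exists (x@_0%MM); exact: nvar0_mpolyC.
apply: fac_unit; exists (c^-1)%:MP; rewrite cE -mpolyCM mulfV//.
by apply: contra_notN x0 => /eqP c0; rewrite cE c0 mpolyC0.
Qed.

(** * Integral closedness *)

Section IntegrallyClosed.

(* The monic equation of degree [n] for [a / b], with denominators cleared. *)
Definition hom_eq (A : comNzRingType) n (c : nat -> A) (a b : A) : A :=
  a ^+ n + \sum_(i < n) c i * a ^+ i * b ^+ (n - i).

Definition int_closed (A : comNzRingType) : Prop :=
  forall n (c : nat -> A) a b, b <> 0 -> hom_eq n c a b = 0 -> dvd b a.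

Lemma hom_eq_scale (A : comNzRingType) n (c : nat -> A) a b t :
  hom_eq n c (t * a) (t * b) = t ^+ n * hom_eq n c a b.
Proof.
rewrite /hom_eq mulrDr exprMn mulr_sumr; congr (_ + _); apply: eq_bigr => i _.
have -> : t ^+ n = t ^+ i * t ^+ (n - i) by rewrite -exprD subnKC // ltnW.
by rewrite !exprMn; ring.
Qed.

Lemma hom_eq_coef (A : comNzRingType) n (c d : nat -> A) a b g :
  (forall i, (i < n)%N -> d i = g ^+ (n - i) * c i) -> hom_eq n d (g * a) b = g ^+ n * hom_eq n c a b.
Proof.
move=> dE; rewrite /hom_eq mulrDr exprMn mulr_sumr; congr (_ + _); apply: eq_bigr => i _.
have -> : g ^+ n = g ^+ i * g ^+ (n - i) by rewrite -exprD subnKC // ltnW.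
by rewrite dE// !exprMn; ring.
Qed.

Lemma rmorph_hom_eq (A B : comNzRingType) (f : {rmorphism A -> B}) n (c : nat -> A) a b :
  f (hom_eq n c a b) = hom_eq n (f \o c) (f a) (f b).
Proof.
rewrite rmorphD rmorphXn rmorph_sum; congr (_ + _); apply: eq_bigr => i _.
by rewrite !rmorphM !rmorphXn.
Qed.

Lemma dom_expr_neq0 (A : comNzRingType) (x : A) k : GRing.integral_domain_axiom A -> x <> 0 -> x ^+ k <> 0.
Proof.
move=> dom x0; elim: k => [|k IHk]; first by rewrite expr0; apply/eqP; rewrite oner_eq0.
by rewrite exprS; exact: dom_mul_neq0.
Qed.

Lemma factorial_int_closed (A : comNzRingType) : GRing.integral_domain_axiom A -> factorial A -> int_closed A.
Proof.
move=> dom fA n c a b b0; have [m] := fA b b0.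
elim: m a b {b0} => [|m IHm] a b [e [s [ue ps sm bE]]] E.
  case: s sm ps bE => // _ _; rewrite big_nil mulr1 => bE; have [e' ee'] := ue.
  by exists (a * e'); rewrite bE -mulrA [e' * e]mulrC ee' mulr1.
case: s sm ps bE => // p s [sm] ps; rewrite big_cons => bE.
have pp := ps p (mem_head _ _); have [p0 np pdvd] := pp.
pose b' := e * \prod_(y <- s) y; have {}bE : b = p * b' by rewrite bE /b' /=; ring.
have pX k x : dvd p (x ^+ k) -> dvd p x.
  elim: k => [|k IHk]; first by rewrite expr0 => /ring_unit_dvd/(_ (ring_unit1 _)).
  by rewrite exprS => /pdvd[//|/IHk].
have [a' a'E] : dvd p a.
  apply: (pX n); exists (- \sum_(i < n) c i * a ^+ i * (b' * b ^+ (n - i).-1)).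
  move/eqP: E; rewrite /hom_eq addr_eq0 => /eqP ->; rewrite mulNr mulr_suml; congr (- _).
  apply: eq_bigr => i _; rewrite -[in LHS](prednK (n := n - i)) ?subn_gt0// exprS {1}bE; ring.
have fb' : facn m b' by exists e, s; split=> // y ys; apply: ps; rewrite inE ys orbT.
clearbody b'; have [|d dE] := IHm a' b' fb'.
  apply: (dom_mulI dom (@dom_expr_neq0 _ p n dom p0)); rewrite mulr0 -hom_eq_scale -bE.
  by rewrite [p * a']mulrC -a'E.
by exists d; rewrite a'E dE bE; ring.
Qed.

Lemma clear_coefs (A B : comNzRingType) (phi : {rmorphism B -> A}) (M : B -> Prop) n (c : nat -> A) :
  M 1 -> (forall s t, M s -> M t -> M (s * t)) -> (forall a, exists s y, M s /\ phi s * a = phi y) ->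
  exists g d, M g /\ forall i, (i < n)%N -> phi g * c i = phi (d i).
Proof.
move=> M1 MM cl; elim: n => [|n [g [d [Mg gd]]]]; first by exists 1, (fun=> 0).
have [s [y [Ms sy]]] := cl (c n); exists (s * g), (fun i => if i == n then g * y else s * d i).
split=> [|i]; first exact: MM.
rewrite ltnS leq_eqVlt; case: eqP => [-> _|_ /= i_n]; rewrite !rmorphM -?sy -?gd//; ring.
Qed.

(** [A] lies between [B] and the localization of [B] at [M]. Clearing denominators turns a/b into a
    fraction over [B]; its product with a common denominator g of the coefficients is integral over
    [B], with coefficients g^(n-i) c_i. *)
Lemma int_closed_clear (A B : comNzRingType) (phi : {rmorphism B -> A}) (M : B -> Prop) :
  GRing.integral_domain_axiom A -> injective phi -> int_closed B ->
  M 1 -> (forall s t, M s -> M t -> M (s * t)) -> ~ M 0 ->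
  (forall a, exists s y, M s /\ phi s * a = phi y) ->
  forall n c a b, b <> 0 -> hom_eq n c a b = 0 -> exists s, M s /\ dvd b (phi s * a).
Proof.
move=> dom inj icB M1 MM M0 cl n c a b b0 E.
have phi0 s : M s -> phi s <> 0.
  by move=> Ms; rewrite -[0](rmorph0 phi) => /inj s0; apply: M0; rewrite -s0.
have [s [y [Ms sy]]] := cl a; have [t [z [Mt tz]]] := cl b.
have [g [d [Mg gd]]] := clear_coefs n c M1 MM cl.
have [h hE] : dvd (s * z) (g * (t * y)).
  apply: (icB n (fun i => g ^+ (n - i).-1 * d i)).
    have : phi (s * z) <> 0.
      by rewrite rmorphM -tz; exact: (dom_mul_neq0 dom (phi0 _ Ms) (dom_mul_neq0 dom (phi0 _ Mt) b0)).
    by apply: contra_not => ->; rewrite rmorph0.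
  apply: inj; rewrite rmorph0 rmorph_hom_eq !rmorphM /= -sy -tz.
  rewrite (@hom_eq_coef _ _ c) => [|i i_n /=]; last first.
    by rewrite rmorphM rmorphXn /= -gd// mulrA -exprSr prednK ?subn_gt0.
  have -> : phi t * (phi s * a) = phi (s * t) * a by rewrite rmorphM; ring.
  have -> : phi s * (phi t * b) = phi (s * t) * b by rewrite rmorphM; ring.
  by rewrite hom_eq_scale E !mulr0.
exists g; split=> //; exists (phi h).
have st0 : phi (s * t) <> 0 by apply: phi0; exact: MM.
apply: (dom_mulI dom st0); move/(congr1 phi): hE; rewrite !rmorphM /= -sy -tz => hE.
by transitivity (phi g * (phi t * (phi s * a))); [ring|rewrite hE; ring].
Qed.

(** The last two hypotheses put an integral fraction into A[1/x] and into A[1/y], and these meet in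
    [A] because y is regular modulo x. *)
Lemma int_closed_pair (A : comNzRingType) (x y : A) : GRing.integral_domain_axiom A -> x <> 0 ->
  (forall c, dvd x (y * c) -> dvd x c) ->
  (forall n c a b, b <> 0 -> hom_eq n c a b = 0 -> exists N, dvd b (x ^+ N * a)) ->
  (forall n c a b, b <> 0 -> hom_eq n c a b = 0 -> exists N, dvd b (y ^+ N * a)) ->
  int_closed A.
Proof.
move=> dom x0 xy hx hy n c a b b0 E.
have [N [e xe]] := hx _ _ _ _ b0 E; have [M [d yd]] := hy _ _ _ _ b0 E.
have xyM k z : dvd x (y ^+ k * z) -> dvd x z.
  by elim: k => [|k IHk]; rewrite ?expr0 ?mul1r// exprS -mulrA => /xy/IHk.
have xyN k z : dvd (x ^+ k) (y ^+ M * z) -> dvd (x ^+ k) z.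
  elim: k z => [|k IHk] z; first by exists z; rewrite expr0 mulr1.
  move=> xz; have [z1 zE] : dvd x z.
    by apply: (xyM M); apply: dvd_trans xz; exists (x ^+ k); rewrite exprSr.
  have [w wE] := xz; have [|w' w'E] := IHk z1; last by exists w'; rewrite zE w'E exprSr mulrA.
  exists w; apply: (dom_mulI dom x0); transitivity (y ^+ M * z); first by rewrite zE; ring.
  by rewrite wE exprSr; ring.
have [|w wE] := xyN N e.
  exists d; apply: (dom_mulI dom b0).
  transitivity (y ^+ M * (x ^+ N * a)); first by rewrite xe; ring.
  by transitivity (x ^+ N * (y ^+ M * a)); [ring|rewrite yd; ring].
exists w; apply: (dom_mulI dom (@dom_expr_neq0 _ x N dom x0)); rewrite xe wE; ring.
Qed.
End IntegrallyClosed.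

(** * Localizations and normality *)

Lemma localizationP (A : comNzRingType) (W : mult_set A) :
  is_localization (fun a : A => a \in W) (@to_localization A W).
Proof.
split.
- exact: mult_set1.
- by move=> a b aW bW; exact: mult_setM.
- move=> s sW; exists (\pi_(localization W) (Localization.mk 1 sW)).
  rewrite -[_ * _]/(Localization.mul _ _) /to_localization /Localization.emb Localization.mulE.
  apply: Localization.pi_eq; rewrite /Localization.embf /Localization.mulf /Localization.mk /Localization.num /Localization.den /=; ring.
- elim/Localization.piW => x; exists (Localization.den x); first exact: Localization.denP.
  exists (Localization.num x).
  rewrite -[_ * _]/(Localization.mul _ _) /to_localization /Localization.emb Localization.mulE.
  apply: Localization.pi_eq; rewrite /Localization.embf /Localization.mulf /Localization.mk /Localization.num /Localization.den /=; ring.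
- move=> a; split=> [/Localization.piP[s sW]|[s sW sa]].
    rewrite /Localization.embf /Localization.mk /Localization.num /Localization.den /= !mulr1 subr0 => sa.
    by exists s.
  apply/Localization.piP; exists s => //.
  by rewrite /Localization.embf /Localization.mk /Localization.num /Localization.den /= !mulr1 subr0.
Qed.

Lemma localization_dom (A : comNzRingType) (W : mult_set A) :
  GRing.integral_domain_axiom A -> GRing.integral_domain_axiom (localization W).
Proof.
move=> dom x y xy; have lP := localizationP W.
have [s sW [a sx]] := loc_frac lP x; have [t tW [b ty]] := loc_frac lP y.
have /(loc_eq0 lP)[v vW] : to_localization W (a * b) = 0.
  by rewrite rmorphM /= -sx -ty mulrACA xy mulr0.
have nW z : z \in W -> z <> 0 by move=> zW z0; have := mult_set0 W; rewrite -z0 zW.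
move/dom => /orP[/eqP/(nW _ vW)//|/eqP/dom/orP[/eqP a0|/eqP b0]]; apply/orP; [left|right]; apply/eqP.
  by apply: (loc_cancel lP sW); rewrite sx a0 rmorph0.
by apply: (loc_cancel lP tW); rewrite ty b0 rmorph0.
Qed.

Lemma localization_inj (A : comNzRingType) (W : mult_set A) :
  GRing.integral_domain_axiom A -> injective (@to_localization A W).
Proof.
move=> dom a b /eqP; rewrite -subr_eq0 -rmorphB => /eqP/(loc_eq0 (localizationP W))[s sW].
move=> /dom/orP[/eqP s0|]; last by rewrite subr_eq0 => /eqP.
by have := mult_set0 W; rewrite -s0 sW.
Qed.

Lemma localization_int_closed (A : comNzRingType) (W : mult_set A) :
  GRing.integral_domain_axiom A -> int_closed A -> int_closed (localization W).
Proof.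
move=> dom ic n c a b b0 E; have lP := localizationP W.
have [||||s [sW [h hE]]] := @int_closed_clear _ _ (@to_localization A W) (fun a => a \in W)
  (localization_dom dom) (localization_inj dom) ic _ _ _ _ n c a b b0 E.
- exact: mult_set1.
- by move=> s t sW tW; exact: mult_setM.
- by apply/negP; exact: mult_set0.
- by move=> x; have [s sW [y e]] := loc_frac lP x; exists s, y.
have [t st] := loc_inv lP sW; exists (t * h).
by transitivity (t * (to_localization W s * a)); [rewrite mulrA [t * _]mulrC st mul1r|rewrite hE mulrA].
Qed.

Lemma int_closed_normal (B : comNzRingType) :
  GRing.integral_domain_axiom B -> int_closed B -> normal_domain B.
Proof.
move=> dom ic; split=> // x [p /monicP pm /rootP px].
have lP := localizationP (regular_set B); pose io : {rmorphism B -> localization (regular_set B)} := to_localization (regular_set B).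
rewrite -[to_localization _]/(io : B -> _) in lP px *.
have [b bW [a bx]] := loc_frac lP x.
have b0 : b <> 0 by move=> b0; have := @mult_set0 _ (regular_set B); rewrite -b0 bW.
pose n := (size p).-1.
have sp : size p = n.+1.
  by rewrite prednK// size_poly_gt0; apply: contra_eq_neq pm => ->; rewrite lead_coef0 eq_sym oner_eq0.
have [d dE] : dvd b a.
  apply: (ic n (fun i => p`_i)) => //; apply: (localization_inj (W := regular_set B) dom); rewrite rmorph0.
  transitivity (io b ^+ n * (map_poly io p).[x]); last by rewrite px mulr0.
  rewrite horner_coef (size_map_poly_id0 (f := io)); last first.
    by rewrite pm rmorph1 oner_neq0.
  rewrite sp big_ord_recr /= coef_map /= [p`_n](_ : _ = 1); last first.
    by rewrite -pm lead_coefE.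
  rewrite rmorph1 mul1r mulrDr mulr_sumr addrC rmorph_hom_eq /hom_eq -bx exprMn; congr (_ + _).
  apply: eq_bigr => i _; rewrite coef_map /= exprMn.
  have -> : io b ^+ n = io b ^+ i * io b ^+ (n - i) by rewrite -exprD subnKC // ltnW.
  by ring.
exists d; apply/eqP; rewrite -subr_eq0; apply/eqP; apply: (loc_cancel lP bW).
by rewrite mulrBr bx dE rmorphM; ring.
Qed.

(** * Heights of primes in polynomial rings *)

Section Counting.
Variables (K : fieldType) (m n : nat) (io : {rmorphism {mpoly K[m]} -> {mpoly K[n]}}).
Hypotheses (ioC : forall c, io c%:MP = c%:MP) (io_inj : injective io).

Lemma msizeM_leS (p q : {mpoly K[n]}) a b :
  (msize p <= a.+1)%N -> (msize q <= b.+1)%N -> (msize (p * q) <= (a + b).+1)%N.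
Proof.
move=> pa qb; have [->|p0] := eqVneq p 0; first by rewrite mul0r msize0.
have [->|q0] := eqVneq q 0; first by rewrite mulr0 msize0.
have := leq_add pa qb; rewrite msizeM// addSn addnS; case: (msize p + msize q)%N => [|k] //=.
Qed.

Lemma msize_monomial e (a : 'X_{1..m}) : (forall i, msize (io 'X_i) <= e.+1)%N ->
  (msize (io 'X_[a]) <= (e * mdeg a).+1)%N.
Proof.
move=> he; rewrite mpolyXE_id rmorph_prod mdegE.
elim/big_rec2: _ => [|i x y _ IH]; first by rewrite msize1 muln0.
rewrite mulnDr; apply: msizeM_leS => //.
elim: (a i) => [|k IHk]; first by rewrite expr0 rmorph1 msize1 muln0.
by rewrite exprS rmorphM mulnS; exact: msizeM_leS.
Qed.

(** The D^m monomials with exponents below D have images supported on the right-hand number of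
    monomials; with fewer of these, linear algebra would give a nonzero polynomial with image 0. *)
Lemma box_rank D e : (forall i, msize (io 'X_i) <= e.+1)%N -> (D ^ m <= (e * (m * D)).+1 ^ n)%N.
Proof.
move=> he; pose N := (e * (m * D)).+1.
pose al (x : {ffun 'I_m -> 'I_D}) : 'X_{1..m} := [multinom (x i : nat) | i < m].
pose be (y : {ffun 'I_n -> 'I_N}) : 'X_{1..n} := [multinom (y i : nat) | i < n].
pose rk := #|{ffun 'I_m -> 'I_D}|; pose ck := #|{ffun 'I_n -> 'I_N}|.
rewrite leqNgt; apply/negP => ltDN.
have rkE : rk = (D ^ m)%N by rewrite /rk card_ffun !card_ord.
have ckE : ck = (N ^ n)%N by rewrite /ck card_ffun !card_ord.
pose M : 'M[K]_(rk, ck) := \matrix_(i, j) (io 'X_[al (enum_val i)])@_(be (enum_val j)).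
have kM : kermx M != 0.
  rewrite -mxrank_eq0 mxrank_ker -lt0n subn_gt0.
  by apply: leq_ltn_trans (rank_leq_col M) _; rewrite rkE ckE.
have [i /eqP ui] : exists i, row i (kermx M) != 0.
  apply/existsP; rewrite -negb_forall; apply: contra kM => /forallP k0.
  by apply/eqP/row_matrixP => i; rewrite row0; exact/eqP.
pose w := row i (kermx M); have wM : w *m M = 0.
  by apply/sub_kermxP; exact: row_sub.
pose p : {mpoly K[m]} := \sum_i w 0 i *: 'X_[al (enum_val i)].
have ioZ c q : io (c *: q) = c *: io q by rewrite -!mul_mpolyC rmorphM ioC.
have al_deg x : (mdeg (al x) <= m * D)%N.
  rewrite mdegE -[m in (m * D)%N]card_ord -sum_nat_const; apply: leq_sum => j _.
  by rewrite mnmE ltnW.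
have p0 : p = 0.
  apply: io_inj; rewrite rmorph0; apply/mpolyP => b; rewrite mcoeff0.
  rewrite rmorph_sum raddf_sum /=.
  under eq_bigr => k _ do rewrite ioZ mcoeffZ.
  have [bN|bN] := boolP [forall j : 'I_n, (b j < N)%N].
    pose y : {ffun 'I_n -> 'I_N} := [ffun j => inord (b j)].
    have yb : be y = b.
      by apply/mnmP => j; rewrite mnmE ffunE inordK//; exact: (forallP bN j).
    transitivity ((w *m M) 0 (enum_rank y)); last by rewrite wM mxE.
    rewrite mxE; apply: eq_bigr => k _; rewrite [M _ _]mxE enum_rankK yb//.
  rewrite big1// => k _; rewrite memN_msupp_eq0 ?mulr0//; apply: msize_mdeg_ge.
  apply: leq_trans (msize_monomial _ he) _; move: bN; rewrite negb_forall => /existsP[j].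
  rewrite -leqNgt => Nb; rewrite (leq_trans _ (leq_trans Nb _))//.
    by rewrite ltnS leq_mul2l al_deg orbT.
  by rewrite mdegE (bigD1 j) //= leq_addr.
have al_inj : injective al.
  move=> x x' /mnmP xx; apply/ffunP => j; apply: val_inj.
  by have := xx j; rewrite !mnmE.
apply: ui; apply/rowP => k; rewrite [RHS]mxE.
have /mpolyP/(_ (al (enum_val k))) := p0; rewrite mcoeff0 raddf_sum (bigD1 k) //= mcoeffZ mcoeffX eqxx mulr1.
rewrite big1 ?addr0// => k' k'k; rewrite mcoeffZ mcoeffX (inj_eq al_inj) (inj_eq enum_val_inj).
by rewrite (negPf k'k) mulr0.
Qed.

(** For m > n the bound would give D^(n+1) <= c^n D^n, which fails for D > c^n. *)
Lemma mpoly_embedding_leq : (m <= n)%N.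
Proof.
rewrite leqNgt; apply/negP => nm.
pose e := \max_i msize (io 'X_i).
have he i : (msize (io 'X_i) <= e.+1)%N by apply: leqW; exact: leq_bigmax.
pose c := (e * m).+1; pose D := (c ^ n).+1.
have := box_rank D he; rewrite leqNgt => /negP; apply.
have h1 : ((e * (m * D)).+1 <= c * D)%N.
  by rewrite /c mulSn mulnA addnC -addn1 leq_add2l.
have h2 : ((e * (m * D)).+1 ^ n <= c ^ n * D ^ n)%N by rewrite -expnMn; case: (n) => // k; rewrite leq_exp2r.
apply: leq_ltn_trans h2 _.
apply: leq_trans (_ : D ^ n.+1 <= _)%N; last by rewrite leq_pexp2l.
by rewrite expnS ltn_pmul2r ?expn_gt0.
Qed.

End Counting.

Section Chains.
Variables (K : fieldType) (v : nat).
Local Notation S := {mpoly K[v]}.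

Definition indep n (io : {rmorphism {mpoly K[n]} -> S}) (P : {pred S}) : Prop :=
  (forall c, io c%:MP = c%:MP) /\ forall y, io y \in P -> y = 0.

(** An element f of Q outside P is transcendental modulo P over the given elements: the constant
    term of a relation lies in Q and so vanishes, and the factor f can be cancelled modulo the prime
    P. *)
Lemma indep_step n (io : {rmorphism {mpoly K[n]} -> S}) (P Q : prime_idealr S) :
  {subset P <= Q} -> ~ {subset Q <= P} -> indep io Q ->
  exists io' : {rmorphism {mpoly K[n.+1]} -> S}, indep io' P.
Proof.
move=> PQ QP [ioC ioQ].
have [f fQ fP] : exists2 f, f \in Q & f \notin P.
  by apply: contrapT => h; apply: QP => x xQ; apply: contrapT => /negP xP; apply: h; exists x.
exists (horner_eval f \o map_poly io \o @muni n K); split=> [c|g].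
  by rewrite /= muniC map_polyC /= ioC /horner_eval hornerC.
rewrite /= /horner_eval => h; rewrite -[g](@muniK K n).
suff -> : muni g = 0 by rewrite rmorph0.
elim/poly_ind: (muni g) h => // p c IHp.
rewrite rmorphD rmorphM /= map_polyX map_polyC /= hornerD hornerMX hornerC => h.
have c0 : c = 0.
  apply: ioQ; rewrite -[io c](addKr ((map_poly io p).[f] * f)) addrC.
  by apply: rpredB; [exact: PQ|exact: ring_quotient.idealMr].
move: h; rewrite c0 rmorph0 addr0 prime_idealrM (negPf fP) orbF => /IHp ->.
by rewrite mul0r addr0.
Qed.

Lemma prime_chain_indep m (C : nat -> prime_idealr S) n (io : {rmorphism {mpoly K[n]} -> S}) :
  (forall i, (i < m)%N -> {subset C i <= C i.+1} /\ ~ {subset C i.+1 <= C i}) ->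
  indep io (C m) -> (n + m <= v)%N.
Proof.
elim: m n io => [|m IHm] n io Cs ind.
  rewrite addn0; have [ioC ioP] := ind; apply: (mpoly_embedding_leq ioC) => x y /eqP.
  rewrite -subr_eq0 -rmorphB => /eqP xy; apply/eqP; rewrite -subr_eq0; apply/eqP/ioP.
  by rewrite xy rpred0.
have [s1 s2] := Cs m (ltnSn m); have [io' ind'] := indep_step s1 s2 ind.
rewrite addnS -addSn; apply: (IHm _ io') => // i im; apply: Cs; exact: ltnW.
Qed.
End Chains.

Lemma prime_idealr_of (A : comNzRingType) (T : A -> Prop) : ideal T -> ~ T 1 ->
  (forall x y, T (x * y) -> T x \/ T y) -> exists P : prime_idealr A, forall x, x \in P <-> T x.
Proof.
move=> iT T1 TM; pose p : {pred A} := fun x => `[< T x >].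
have pc : idealr_closed p.
  split; [by apply/asboolP; exact: ideal0|by apply/asboolP|move=> a u w /asboolP Tu /asboolP Tw].
  by apply/asboolP; apply: idealD => //; exact: idealMl.
have pp : prime_idealr_closed p.
  by move=> u w /asboolP/TM[] h; apply/orP; [left|right]; apply/asboolP.
pose iA := isIdealr.Build A p pc.
pose P : prime_idealr A := HB.pack p iA (isPrimeIdealrClosed.Build A p pp).
by exists P => x; split=> /asboolP.
Qed.

(** * Certified polynomial identities *)

Section Substitution.
Variables (K : fieldType) (v : nat).
Local Notation S := {mpoly K[v]}.

Lemma rmorph_congr (B : comNzRingType) (f g : {rmorphism S -> B}) (J : B -> Prop) : ideal J ->
  (forall c, f c%:MP = g c%:MP) -> (forall i, J (f 'X_i - g 'X_i)) -> forall x, J (f x - g x).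
Proof.
move=> iJ fgC fgX.
have fgM x y : J (f x - g x) -> J (f y - g y) -> J (f (x * y) - g (x * y)).
  move=> Jx Jy; rewrite !rmorphM.
  have -> : f x * f y - g x * g y = (f x - g x) * f y + g x * (f y - g y) by ring.
  by apply: idealD => //; [exact: idealMr|exact: idealMl].
move=> x; rewrite [x]mpolyE !rmorph_sum -sumrB; apply: ideal_sum => // m _.
rewrite -mul_mpolyC; apply: (fgM); first by rewrite fgC subrr; exact: ideal0.
rewrite mpolyXE_id; elim/big_ind: _ => [|y z|i _]; last elim: (m i) => [|k IHk].
- by rewrite !rmorph1 subrr; exact: ideal0.
- exact: fgM.
- by rewrite !expr0 !rmorph1 subrr; exact: ideal0.
- by rewrite exprS; exact: fgM.
Qed.

Variable V : pred 'I_v.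
Definition sub0 : S -> S := mmap (@mpolyC v K) (fun i => if V i then 0 else 'X_i).
HB.instance Definition _ := GRing.RMorphism.on sub0.

Lemma sub0C c : sub0 c%:MP = c%:MP. Proof. exact: mmapC. Qed.
Lemma sub0X i : sub0 'X_i = if V i then 0 else 'X_i.
Proof. by rewrite /sub0 mmapX mmap1U. Qed.

Lemma sub0_congr (s : seq S) f : (forall i, V i -> 'X_i \in s) -> ISpan s (f - sub0 f).
Proof.
move=> Vs; apply: (@rmorph_congr S idfun sub0 (ISpan s)); first exact: ISpan_ideal.
  by move=> c; exact: (esym (sub0C c)).
move=> i; rewrite [X in _ - X](sub0X i); case: (boolP (V i)) => [/Vs Xs|_] /=.
  by rewrite subr0; exact: ISpan_mem.
by rewrite subrr; exact: ideal0 (ISpan_ideal s).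
Qed.

Lemma sub0_span (s : seq S) f : (forall a, a \in s -> sub0 a = 0) -> ISpan s f -> sub0 f = 0.
Proof.
move=> s0 /(@Span_sum S S^o)[c ->]; rewrite rmorph_sum big1// => i _.
by rewrite /GRing.scale /= rmorphM /= [sub0 s`_i]s0 ?mulr0// mem_nth.
Qed.

End Substitution.

Section SpanTactics.
Variable S : comNzRingType.
Lemma span_use c a s (x : S) : ISpan s (x - c * a) -> ISpan (a :: s) x.
Proof. by exists c. Qed.
Lemma span_eq0 s (x : S) : x = 0 -> ISpan s x.
Proof. by move=> ->; exact: ideal0 (ISpan_ideal s). Qed.

Lemma adj_span s t (x : S) : adj (ISpan s) (fun i : 'I_(size t) => t`_i) x <-> ISpan (t ++ s) x.
Proof.
split=> [[c Sx]|/(@Span_cat S S^o)[y /(@Span_sum S S^o)[c ->] Sx]]; last by exists c.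
by apply/(@Span_cat S S^o); exists (\sum_i c i * t`_i) => //; apply/(@Span_sum S S^o); exists c.
Qed.

Lemma reg_subset s t (f : S) : {subset s <= t} -> {subset t <= s} ->
  reg_mod (ISpan s) f -> reg_mod (ISpan t) f.
Proof. by move=> st ts; apply: reg_eq; split=> a h; apply: ISpan_mem; [exact: st|exact: ts]. Qed.

Lemma reg_neq0 (f : S) : reg_mod (ISpan [::]) f -> f != 0.
Proof. by move=> rf; apply/eqP => f0; have /= := rf 1; rewrite f0 mul0r => /(_ erefl)/eqP; rewrite oner_eq0. Qed.
End SpanTactics.

(* Reflection of integer polynomial expressions; normal forms are sorted lists of monomials (exponent
   lists) with integer coefficients. *)
Inductive pex := PX of nat | PI of int | PA of pex & pex | PM of pex & pex | PO of pex | PE of pex & nat.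

Declare Scope pex_scope.
Delimit Scope pex_scope with pex.
Bind Scope pex_scope with pex.
Notation "a + b" := (PA a b) : pex_scope.
Notation "a * b" := (PM a b) : pex_scope.
Notation "- a" := (PO a) : pex_scope.
Notation "a - b" := (PA a (PO b)) : pex_scope.
Notation "a ^+ n" := (PE a n%N) : pex_scope.

Definition mono := seq nat.
Fixpoint mono_mul (m n : mono) : mono :=
  match m, n with
  | a :: m', b :: n' => (a + b)%N :: mono_mul m' n'
  | [::], _ => n
  | _, [::] => m
  end.
Fixpoint mono_lt (m n : mono) : bool :=
  match m, n with
  | a :: m', b :: n' => if (a < b)%N then true else if (b < a)%N then false else mono_lt m' n'
  | [::], _ :: _ => true
  | _, [::] => false
  end.
Definition nf := seq (mono * int).
Fixpoint nf_add (P : nf) : nf -> nf :=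
  fix addP (R : nf) : nf := match P, R with
  | [::], _ => R
  | _, [::] => P
  | (m, a) :: P', (n, b) :: R' =>
      if m == n then (if (a + b)%R == 0 then nf_add P' R' else (m, (a + b)%R) :: nf_add P' R')
      else if mono_lt m n then (m, a) :: nf_add P' R else (n, b) :: addP R'
  end.
Definition nf_scale (c : mono * int) (P : nf) : nf := [seq (mono_mul c.1 x.1, c.2 * x.2) | x <- P].
Definition nf_mul (P R : nf) : nf := foldr (fun c acc => nf_add (nf_scale c R) acc) [::] P.
Fixpoint norm (e : pex) : nf :=
  match e with
  | PX i => [:: (rcons (nseq i 0%N) 1%N, 1)]
  | PI c => if c == 0 then [::] else [:: ([::], c)]
  | PA a b => nf_add (norm a) (norm b)
  | PM a b => nf_mul (norm a) (norm b)
  | PO a => nf_scale ([::], -1) (norm a)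
  | PE a n => iter n (nf_mul (norm a)) [:: ([::], 1)]
  end.

Fixpoint pex_eqb (a b : pex) : bool :=
  match a, b with
  | PX i, PX j => i == j | PI c, PI d => c == d
  | PA a1 a2, PA b1 b2 => pex_eqb a1 b1 && pex_eqb a2 b2
  | PM a1 a2, PM b1 b2 => pex_eqb a1 b1 && pex_eqb a2 b2
  | PO a1, PO b1 => pex_eqb a1 b1 | PE a1 m, PE b1 n => pex_eqb a1 b1 && (m == n)
  | _, _ => false
  end.
Lemma pex_eqbP : Equality.axiom pex_eqb.
Proof.
move=> a b; apply: (iffP idP) => [|<-]; last first.
  by elim: a => //= *; rewrite ?eqxx; apply/andP; split; rewrite ?eqxx.
elim: a b => [i|c|a1 IH1 a2 IH2|a1 IH1 a2 IH2|a1 IH1|a1 IH1 m] [] //=.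
- by move=> j /eqP->.
- by move=> d /eqP->.
- by move=> b1 b2 /andP[/IH1-> /IH2->].
- by move=> b1 b2 /andP[/IH1-> /IH2->].
- by move=> b1 /IH1->.
- by move=> b1 n /andP[/IH1-> /eqP->].
Qed.
HB.instance Definition _ := hasDecEq.Build pex pex_eqbP.

Section Evaluation.
Variables (A : comNzRingType) (env : nat -> A).

Fixpoint pev (e : pex) : A :=
  match e with
  | PX i => env i | PI c => c%:~R | PA a b => pev a + pev b | PM a b => pev a * pev b
  | PO a => - pev a | PE a n => pev a ^+ n
  end.
Fixpoint mono_ev (j : nat) (m : mono) : A := if m is a :: m' then env j ^+ a * mono_ev j.+1 m' else 1.
Definition nf_ev (P : nf) : A := \sum_(x <- P) x.2%:~R * mono_ev 0 x.1.

Lemma mono_ev_mul j m n : mono_ev j (mono_mul m n) = mono_ev j m * mono_ev j n.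
Proof.
elim: m j n => [|a m IHm] j [|b n] //=; rewrite ?mul1r ?mulr1//.
by rewrite IHm exprD mulrACA.
Qed.

Lemma nf_ev_add P R : nf_ev (nf_add P R) = nf_ev P + nf_ev R.
Proof.
rewrite /nf_ev; elim: P R => [|[m a] P IHP] R; first by case: R => *; rewrite big_nil add0r.
elim: R => [|[n b] R IHR]; first by rewrite big_nil addr0.
rewrite [nf_add _ _]/=; case: eqP => [<-|_].
  have E : (a + b)%:~R * mono_ev 0 m = a%:~R * mono_ev 0 m + b%:~R * mono_ev 0 m.
    by rewrite rmorphD mulrDl.
  case: eqP => [ab|_]; rewrite !big_cons IHP /= addrACA -E ?ab ?mul0r ?add0r//.
case: mono_lt; first by rewrite big_cons IHP !big_cons addrA.
by rewrite big_cons [in LHS]IHR !big_cons /= addrCA.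
Qed.

Lemma nf_ev_scale c P : nf_ev (nf_scale c P) = c.2%:~R * mono_ev 0 c.1 * nf_ev P.
Proof.
rewrite /nf_ev big_map mulr_sumr; apply: eq_bigr => x _ /=.
by rewrite mono_ev_mul rmorphM mulrACA.
Qed.

Lemma nf_ev_mul P R : nf_ev (nf_mul P R) = nf_ev P * nf_ev R.
Proof.
rewrite {2}/nf_ev; elim: P => [|c P IHP]; first by rewrite /nf_ev !big_nil mul0r.
by rewrite /= nf_ev_add IHP nf_ev_scale big_cons mulrDl.
Qed.

Lemma mono_ev_var i j : mono_ev j (rcons (nseq i 0%N) 1%N) = env (j + i).
Proof.
elim: i j => [|i IHi] j /=; first by rewrite addn0 mulr1.
by rewrite IHi mul1r addSnnS.
Qed.

Lemma nf_ev_norm e : nf_ev (norm e) = pev e.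
Proof.
elim: e => [i|c|a IHa b IHb|a IHa b IHb|a IHa|a IHa n] /=.
- by rewrite /nf_ev big_seq1 /= mul1r mono_ev_var.
- by case: eqP => [->|_]; rewrite /nf_ev ?big_nil// big_seq1 mulr1.
- by rewrite nf_ev_add IHa IHb.
- by rewrite nf_ev_mul IHa IHb.
- by rewrite nf_ev_scale IHa /= mulr1 rmorphN mulN1r.
- elim: n => [|n IHn] /=; first by rewrite /nf_ev big_seq1 mulr1.
  by rewrite nf_ev_mul IHn IHa exprS.
Qed.

Lemma pev_eq0 e : norm e == [::] -> pev e = 0.
Proof. by move=> /eqP h; rewrite -nf_ev_norm h /nf_ev big_nil. Qed.

Lemma pev_eq e f : norm (PA e (PO f)) == [::] -> pev e = pev f.
Proof.
by move=> /pev_eq0 h; apply/eqP; rewrite -subr_eq0; apply/eqP.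
Qed.

Fixpoint comb (c l : seq pex) : pex :=
  match c, l with a :: c', b :: l' => PA (PM a b) (comb c' l') | _, _ => PI 0 end.

Definition mdeg (k : nat) (m : mono) : nat := nth 0%N m k.
Definition var_index (e : pex) : nat := if e is PX k then k else 0%N.
Definition is_var (e : pex) : bool := if e is PX _ then true else false.

(* [e] is the combination of [l] with cofactors [c], up to monomials divisible by a variable in [l]. *)
Definition memcheck (c l : seq pex) (e : pex) : bool :=
  all (fun x => has (fun b => is_var b && (0 < mdeg (var_index b) x.1)%N) l)
    (norm (PA e (PO (comb c l)))).

Lemma comb_span c l : ISpan (map pev l) (pev (comb c l)).
Proof.
elim: c l => [|a c IHc] [|b l]; try exact: (@span_eq0 _ _ 0).
by apply: (span_use (c := pev a)); rewrite addrC addKr; exact: IHc.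
Qed.

Lemma mono_ev_dvd k j m : (0 < mdeg k m)%N -> exists a, mono_ev j m = a * env (j + k).
Proof.
elim: m j k => [|a m IHm] j [|k] //=.
  by rewrite /mdeg /= addn0; case: a => // a _; exists (env j ^+ a * mono_ev j.+1 m); rewrite exprSr mulrAC.
by move=> /(IHm j.+1)[b ->]; exists (env j ^+ a * b); rewrite mulrA addSnnS.
Qed.

Lemma pev_span c l e : memcheck c l e -> ISpan (map pev l) (pev e).
Proof.
move=> /allP h; rewrite -[pev e](subrK (pev (comb c l))).
apply: idealD; [exact: ISpan_ideal| |exact: comb_span].
rewrite -[_ - _]/(pev (PA e (PO (comb c l)))) -nf_ev_norm /nf_ev big_seq_cond.
apply: ideal_sum => [|[m a]]; first exact: ISpan_ideal.
rewrite andbT => /h/hasP/= [] b bl /andP[]; case: b bl => // k kl _ /(@mono_ev_dvd _ 0%N)[x ->].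
rewrite mulrA; apply: idealMl; [exact: ISpan_ideal|apply: ISpan_mem].
elim: l kl {h} => //= b l IHl; rewrite inE => /predU1P[<-|/IHl h]; by rewrite inE ?eqxx ?h ?orbT.
Qed.

End Evaluation.

Lemma pev_rmorph (A B : comNzRingType) (f : {rmorphism A -> B}) env e :
  f (pev env e) = pev (f \o env) e.
Proof.
elim: e => //= [c|a IHa b IHb|a IHa b IHb|a IHa|a IHa n].
- exact: rmorph_int.
- by rewrite rmorphD IHa IHb.
- by rewrite rmorphM IHa IHb.
- by rewrite rmorphN IHa.
- by rewrite rmorphXn IHa.
Qed.

Fixpoint psubst (s : nat -> pex) (e : pex) : pex :=
  match e with
  | PX i => s i | PI c => PI c | PA a b => PA (psubst s a) (psubst s b)
  | PM a b => PM (psubst s a) (psubst s b) | PO a => PO (psubst s a) | PE a n => PE (psubst s a) n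
  end.

Lemma pev_psubst (A : comNzRingType) (env : nat -> A) s e : pev env (psubst s e) = pev (pev env \o s) e.
Proof. by elim: e => //= [a -> b ->|a -> b ->|a ->|a -> n]. Qed.

(** * Regularity tests in eighteen variables *)

Section Variables18.
Variable K : fieldType.
Local Notation S := {mpoly K[18]}.

Definition Xv (k : nat) : S := 'X_(inord k).
Definition ev (e : pex) : S := pev Xv e.

Fixpoint pfree (k : nat) (e : pex) : bool :=
  match e with
  | PX i => (i < 18)%N && (i != k) | PI _ => true
  | PA a b => pfree k a && pfree k b | PM a b => pfree k a && pfree k b
  | PO a => pfree k a | PE a _ => pfree k a
  end.

Lemma vfree_Xv i j : (i < 18)%N -> (j < 18)%N -> i != j -> vfree (inord j : 'I_18) (Xv i).
Proof.
by move=> i18 j18 ij; apply: vfreeX; apply: contra ij => /eqP/(congr1 val); rewrite /= !inordK// => ->.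
Qed.

Lemma tau_int k c : tau (k : 'I_18) (c%:~R : S) = (c%:~R)%:P.
Proof. by rewrite !rmorph_int. Qed.

Lemma pfree_vfree k e : (k < 18)%N -> pfree k e -> vfree (inord k : 'I_18) (ev e).
Proof.
move=> k18; elim: e => [i|c|a IHa b IHb|a IHa b IHb|a IHa|a IHa n] /=.
- by case/andP => i18 ik; exact: vfree_Xv.
- by move=> _; exact: tau_int.
- by case/andP => /IHa ha /IHb hb; exact: vfreeD.
- by case/andP => /IHa ha /IHb hb; exact: vfreeM.
- by move/IHa; exact: vfreeN.
- by move/IHa; exact: vfreeXn.
Qed.

Definition reg (l : seq pex) (e : pex) : Prop := reg_mod (ISpan (map ev l)) (ev e).

Lemma size_tau_mono k j m : (k < 18)%N -> (size m + j <= 18)%N ->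
  (size (tau (inord k : 'I_18) (mono_ev Xv j m)) <= (if (j <= k)%N then nth 0%N m (k - j) else 0).+1)%N.
Proof.
move=> k18; elim: m j => [|a m IHm] j /= sm.
  by rewrite nth_nil if_same rmorph1 size_poly1.
have j18 : (j < 18)%N by apply: leq_trans sm; rewrite addSn ltnS leq_addl.
have sm' : (size m + j.+1 <= 18)%N by rewrite addnS -addSn.
rewrite rmorphM rmorphXn /=; have [jk|kj|jk] := ltngtP j k.
- have -> : tau (inord k) (Xv j) = (Xv j)%:P.
    by apply: vfree_Xv => //; rewrite neq_ltn jk.
  rewrite -polyC_exp mul_polyC (leq_trans (size_scale_leq _ _))//.
  have := IHm _ sm'; rewrite jk -[(k - j)%N]prednK ?subn_gt0//= subnS; exact.
- have -> : tau (inord k) (Xv j) = (Xv j)%:P.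
    by apply: vfree_Xv => //; rewrite neq_ltn kj orbT.
  rewrite -polyC_exp mul_polyC (leq_trans (size_scale_leq _ _))//.
  have := IHm _ sm'; rewrite [(j < k)%N]ltnNge (ltnW kj); exact.
- rewrite -jk subnn /= /Xv tauX eqxx.
  have := IHm _ sm'; rewrite jk ltnn => h.
  rewrite (leq_trans (size_polyMleq _ _))// size_polyXn /= -[X in (_ <= X)%N]addn1.
  rewrite leq_add2l. exact: h.
Qed.

(* [e] has degree [n] in the variable [k], with leading coefficient [a]. *)
Definition topcheck (k n : nat) (a e : pex) : bool :=
  let P := norm e in
  [&& (k < 18)%N, pfree k a, all (fun x => (size x.1 <= 18)%N && (mdeg k x.1 <= n)%N) P
    & [seq x <- P | mdeg k x.1 == n] == norm (PM a (PE (PX k) n))].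

Lemma tau_topc k n a e : topcheck k n a e ->
  exists2 b : {poly S}, (size b <= n)%N & tau (inord k : 'I_18) (ev e) = (ev a)%:P * 'X^n + b.
Proof.
case/and4P => k18 fa /allP Pn /eqP Ph.
pose P := norm e; pose b := \sum_(x <- P | mdeg k x.1 != n) x.2%:~R * mono_ev Xv 0 x.1.
exists (tau (inord k) b).
  rewrite /b big_seq_cond rmorph_sum; apply: (big_ind (fun p : {poly S} => (size p <= n)%N)).
  + by rewrite size_poly0.
  + by move=> p p' sp sp'; rewrite (leq_trans (size_polyD _ _))// geq_max sp.
  + move=> x /andP[/Pn/andP[s18 xn] ne]; rewrite rmorphM /= [tau _ _%:~R]tau_int mul_polyC.
    rewrite (leq_trans (size_scale_leq _ _))// (leq_trans (size_tau_mono _ _))// ?addn0//.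
    by rewrite leq0n subn0 ltn_neqAle ne.
rewrite -{1}/(ev e) /ev -nf_ev_norm /nf_ev (bigID (fun x => mdeg k x.1 == n)) /= rmorphD.
congr (_ + _); rewrite -big_filter Ph.
have -> : \sum_(i <- norm (PM a (PE (PX k) n))) i.2%:~R * mono_ev Xv 0 i.1 = ev a * Xv k ^+ n.
  exact: (nf_ev_norm Xv (PM a (PE (PX k) n))).
rewrite rmorphM rmorphXn /=; congr (_ * _); first exact: pfree_vfree.
by rewrite /Xv tauX eqxx.
Qed.

Lemma coef_topc k n a e : topcheck k n a e -> (tau (inord k : 'I_18) (ev e))`_n = ev a.
Proof.
by case/tau_topc => b sb ->; rewrite coefD coefCM coefXn eqxx mulr1 [b`_n]nth_default ?addr0.
Qed.

Lemma reg_topc k n a l e : topcheck k n a e -> all (pfree k) l -> reg l a -> reg l e.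
Proof.
move=> te fl; have /and4P[k18 fa _ _] := te; have [b sb tE] := tau_topc te.
apply: (@reg_top K 18 (inord k) _ _ (ev a) b n) => //; last exact: pfree_vfree.
move=> x; elim: l fl => //= y l IHl /andP[fy /IHl h].
by rewrite inE => /predU1P[->|//]; exact: pfree_vfree.
Qed.

Lemma reg_topc1 k n l e : topcheck k n (PI 1) e -> all (pfree k) l -> reg l e.
Proof.
move=> te fl; apply: (reg_topc te fl); rewrite /reg /ev /=; exact: reg1.
Qed.

Lemma regm l a b : reg l a -> reg l b -> reg l (PM a b).
Proof. exact: reg_mul. Qed.
Lemma rege l a n : reg l a -> reg l (PE a n).
Proof.
move=> ra; rewrite /reg /ev /=; elim: n => [|n IHn]; first by rewrite expr0; exact: reg1.
by rewrite exprS; exact: reg_mul.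
Qed.
Lemma rego l a : reg l a -> reg l (PO a).
Proof. apply: reg_opp; exact: ISpan_ideal. Qed.
Lemma rexch l x y : reg l x -> reg (x :: l) y -> reg (y :: l) x.
Proof. exact: reg_exchange. Qed.
Lemma rprod l a b y : reg l a -> reg (a :: l) y -> reg (b :: l) y -> reg (PM a b :: l) y.
Proof. exact: reg_prod_gen. Qed.

(** Missing cofactor lists count as empty; such an element must have all its monomials divisible by
    variables occurring in [l']. *)
Fixpoint subcheck (cs : seq (seq pex)) (l l' : seq pex) : bool :=
  match l with
  | [::] => true
  | e :: l1 => memcheck (head [::] cs) l' e && subcheck (behead cs) l1 l'
  end.

Lemma subcheckP cs l l' : subcheck cs l l' ->
  forall x, ISpan (map ev l) x -> ISpan (map ev l') x.
Proof.
move=> h x; apply: ISpan_sub; elim: l cs h => //= e l IHl cs /andP[ce /IHl h] a.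
rewrite inE => /predU1P[->|/h//]; exact: pev_span ce.
Qed.

Lemma reg_sub cs cs' l l' f : subcheck cs l l' -> subcheck cs' l' l -> reg l f -> reg l' f.
Proof.
move=> h h' rf c Ic; apply: (subcheckP h); apply: rf; exact: (subcheckP h').
Qed.

Lemma regc cs l f g : memcheck cs l (PA f (PO g)) -> reg l g -> reg l f.
Proof.
move=> h rg; apply: reg_congr rg; first exact: ISpan_ideal.
exact: (pev_span _ h).
Qed.

Lemma reg_factor l f g : reg l (PM g f) -> reg l f.
Proof. by move=> h; apply: (reg_left h); exact: ISpan_ideal. Qed.

Lemma rperm l l' f : all (mem l') l && all (mem l) l' -> reg l f -> reg l' f.
Proof.
by case/andP=> /allP h /allP h'; apply: reg_subset => _ /mapP[x xl ->]; apply: map_f; [exact: h|exact: h'].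
Qed.

End Variables18.

(** * Regular sequences *)

Module Sg.
Local Open Scope nat_scope.
Local Open Scope pex_scope.
Definition p1 := PX 0.
Definition p2 := PX 1.
Definition p3 := PX 2.
Definition p4 := PX 3.
Definition q1 := PX 4.
Definition q2 := PX 5.
Definition q3 := PX 6.
Definition r := PX 7.
Definition u := PX 8.
Definition s11 := PX 9.
Definition s12 := PX 10.
Definition s13 := PX 11.
Definition s22 := PX 12.
Definition s23 := PX 13.
Definition s33 := PX 14.
Definition t1 := PX 15.
Definition t2 := PX 16.
Definition t3 := PX 17.
Definition pq := p1 * q1 + p2 * q2 + p3 * q3.
Definition pt := p1 * t1 + p2 * t2 + p3 * t3.
Definition m1 := q2 * t3 - q3 * t2.
Definition m2 := q3 * t1 - q1 * t3.
Definition m3 := q1 * t2 - q2 * t1.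
Definition v1 := s11 * p1 + s12 * p2 + s13 * p3 + p4 * t1.
Definition v2 := s12 * p1 + s22 * p2 + s23 * p3 + p4 * t2.
Definition v3 := s13 * p1 + s23 * p2 + s33 * p3 + p4 * t3.
Definition pv := p1 * v1 + p2 * v2 + p3 * v3.
Definition n1 := q2 * v3 - q3 * v2.
Definition n2 := q3 * v1 - q1 * v3.
Definition n3 := q1 * v2 - q2 * v1.
Definition F1 := r * p1 + n1.
Definition F2 := r * p2 + n2.
Definition F3 := r * p3 + n3.
Definition Sm1 := s11 * m1 + s12 * m2 + s13 * m3.
Definition Sm2 := s12 * m1 + s22 * m2 + s23 * m3.
Definition Sm3 := s13 * m1 + s23 * m2 + s33 * m3.
Definition w1 := q2 * Sm3 - q3 * Sm2.
Definition w2 := q3 * Sm1 - q1 * Sm3.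
Definition w3 := q1 * Sm2 - q2 * Sm1.
Definition A1 := r * m1 - w1.
Definition A2 := r * m2 - w2.
Definition A3 := r * m3 - w3.
Definition c11 := s22 * s33 - s23 ^+ 2.
Definition c22 := s11 * s33 - s13 ^+ 2.
Definition c33 := s11 * s22 - s12 ^+ 2.
Definition c12 := s13 * s23 - s12 * s33.
Definition c13 := s12 * s23 - s13 * s22.
Definition c23 := s12 * s13 - s11 * s23.
Definition Q := c11 * q1 ^+ 2 + c22 * q2 ^+ 2 + c33 * q3 ^+ 2 + PI 2%:Z * (c12 * q1 * q2 + c13 * q1 * q3 + c23 * q2 * q3).
Definition rQ := r ^+ 2 + Q.
Definition H1 := u * p1 - A1.
Definition H2 := u * p2 - A2.
Definition H3 := u * p3 - A3.
Definition H4 := u * p4 + rQ.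
Definition TT := s33 * q2 ^+ 2 - PI 2%:Z * s23 * q2 * q3 + s22 * q3 ^+ 2.
(** Resultants that eliminate r: [N2] is the one of [A2] and [rQ], and [Nrm] the one of [F3] and
    [H4] after setting p1 = p2 = q3 = 0. *)
Definition N2 := w2 ^+ 2 + Q * m2 ^+ 2.
Definition Nrm := (q1 * (s23 * p3 + p4 * t2) - q2 * (s13 * p3 + p4 * t1)) ^+ 2 +
  (c11 * q1 ^+ 2 + c22 * q2 ^+ 2 + PI 2%:Z * c12 * q1 * q2 + u * p4) * p3 ^+ 2.
Definition v3' := s33 * p3 + p4 * t3.
(** On p1 = p2 = p4 = q3 = 0 the element [F3] is p3 [r']. *)
Definition r' := r + q1 * s23 - q2 * s13.
End Sg.
Import Sg.
(** Each unprojection puts its new generators in front of the old ones. *)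
Definition I00 := [:: pq; pv].
Definition I0 := [:: F1; F2; F3; pq; pv].
Definition Sig := [:: H1; H2; H3; H4; F1; F2; F3; pq; pv].

Ltac chk := vm_compute; reflexivity.
Tactic Notation "top" constr(k) constr(n) constr(a) :=
  apply: (@reg_topc _ k%N n%N a); [chk|chk|].
Tactic Notation "top1" constr(k) constr(n) := apply: (@reg_topc1 _ k%N n%N); [chk|chk].
Ltac perm l := apply: (@rperm _ l); [chk|].
Ltac exch := apply: rexch.

Section RegularSequences.
Variable K : fieldType.
Local Notation S := {mpoly K[18]}.
Local Notation reg := (@reg K).

Local Open Scope nat_scope.
Local Open Scope pex_scope.

Lemma reg_X l k : (k < 18)%N -> all (pfree k) l -> reg l (PX k).
Proof.
move=> k18 /allP fl; apply: reg_var => _ /mapP[e el ->].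
by apply: pfree_vfree => //; exact: fl.
Qed.

(** A regular sequence read from the right. In the proofs, [top k n a] replaces an element by its
    coefficient a at the n-th power of the k-th variable, [top1] treats the case a = 1, and [exch]
    exchanges the element with the head of the list. *)
Fixpoint creg (l : seq pex) : Prop := if l is a :: l' then reg l' a /\ creg l' else True.

Ltac var := apply: reg_X; [chk|chk].
Ltac cs := rewrite /=; do !split; try var.

(** The same case analysis serves with and without u: it bounds the grade for p2 and, one higher,
    for u. *)
Definition opt_u (e : seq pex) := e = [::] \/ e = [:: u].

Lemma creg_p4_u e : opt_u e -> creg ([:: rQ; N2; p4; p3; p2; p1] ++ e).
Proof.
case=> ->; cs; [by top1 7 2| |by top1 7 2|];
  top 9 2 (q3 ^+ 2 * m1 ^+ 2); apply: regm; apply: rege; first [var | top 16 1 (- q3); apply: rego; var].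
Qed.

Lemma creg_p4_TT : creg [:: rQ; N2; TT; p4; p3; p2; p1].
Proof.
cs; first by top1 7 2.
  top 9 2 (q3 ^+ 2 * m1 ^+ 2); apply: regm; apply: rege.
    by exch; [var|top 14 1 (q2 ^+ 2); apply: rege; var].
  exch; [top 16 1 (- q3); apply: rego; var|top 14 1 (q2 ^+ 2); apply: rege].
  by exch; [var|top 16 1 (- q3); apply: rego; var].
by top 14 1 (q2 ^+ 2); apply: rege; var.
Qed.

Lemma creg_m_u e : opt_u e -> creg ([:: H4; m2; m1; p3; p2; p1] ++ e).
Proof.
case=> ->; cs; try (by top1 7 2); try (by top 16 1 (- q3); apply: rego; var);
  by top 15 1 q3; exch; [var|top 17 1 q2; var].
Qed.

Lemma creg_m_TT : creg [:: H4; TT; m2; m1; p3; p2; p1].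
Proof.
cs; first by top1 7 2.
- top 14 1 (q2 ^+ 2); apply: rege; exch.
    by exch; [var|top 16 1 (- q3); apply: rego; var].
  top 4 1 (- t3); apply: rego; perm [:: m1; q2; p3; p2; p1]; exch; first var.
  by top 16 1 (- q3); apply: rego; var.
- by top 15 1 q3; exch; [var|top 17 1 q2; var].
- by top 16 1 (- q3); apply: rego; var.
Qed.

Lemma creg_v3_u e : opt_u e -> creg ([:: H4; Nrm; v3'; q3; p2; p1] ++ e).
Proof.
case=> ->; cs; try (by top1 7 2); try (by top 17 1 p4; var);
  top 9 1 (s33 * q2 ^+ 2 * p3 ^+ 2); apply: regm; try (apply: rege); try (apply: regm);
  try (apply: rege); first [var | exch; [var|top 17 1 p4; var]].
Qed.

Lemma creg_v3_TT : creg [:: H4; Nrm; v3'; q2; q3; p2; p1].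
Proof.
cs; first by top1 7 2.
  top 8 1 (p4 * p3 ^+ 2); apply: regm; try apply: rege; (exch; [var|]).
    by top 14 1 p3; var.
  by top 17 1 p4; var.
by top 17 1 p4; var.
Qed.

Lemma creg_pq : creg [:: H4; p3; q1; q2; q3; p2; p1].
Proof. by cs; top1 7 2. Qed.

Lemma creg_p3p4 : creg [:: H4; p3; p4; s33; q3; p2; p1].
Proof. by cs; top1 7 2. Qed.

Lemma creg_r' : creg [:: H3; r'; s33; p4; q3; p2; p1].
Proof.
cs; last by top1 7 1.
by top 8 1 p3; exch; [var|top1 7 1].
Qed.

Lemma creg_t3 : creg [:: H4; F3; t3; s33; q3; p2; p1].
Proof.
cs; last by top 7 1 p3; var.
by top 8 1 p4; exch; [var|top 7 1 p3; var].
Qed.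

Lemma creg_I00 : creg I00.
Proof.
cs; last by top 9 1 (p1 ^+ 2); apply: rege; var.
by top 4 1 p1; exch; [var|top 12 1 (p2 ^+ 2); apply: rege; var].
Qed.

Lemma reg_p1_I00 : reg I00 p1.
Proof.
exch; first by exch; [var|top 12 1 (p2 ^+ 2); apply: rege; var].
top 5 1 p2; perm [:: pv; p1]; exch; first var.
by top 14 1 (p3 ^+ 2); apply: rege; var.
Qed.

Lemma creg_p4_I00 : creg [:: rQ; p4; pq; pv].
Proof.
case: creg_I00 => h1 [h2 _]; cs => //; first by top1 7 2.
exch; first by exch; [var|top 9 1 (p1 ^+ 2); apply: rege; var].
top 4 1 p1; perm [:: pv; p4]; exch; first var.
by top 12 1 (p2 ^+ 2); apply: rege; var.
Qed.

Lemma creg_u : creg [:: rQ; pv; pq; N2; u].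
Proof.
have r_N2_m1 : reg [:: m1; u] N2.
  top 12 1 ((q1 ^+ 2 * s33 - PI 2%:Z * q1 * q3 * s13 + q3 ^+ 2 * s11) * m2 ^+ 2).
  apply: regm; first by top 14 1 (q1 ^+ 2); apply: rege; var.
  apply: rege; top 15 1 q3; exch; first var.
  by top 17 1 q2; var.
have r_q2_N2 : reg [:: N2; u] q2.
  exch; first var.
  by top 9 2 (q3 ^+ 2 * m1 ^+ 2); apply: regm; apply: rege; [var|top 16 1 (- q3); apply: rego; var].
have r_N2_m1q2 : reg [:: m1; q2; u] N2.
  (* Modulo q2 the element [m1] is - q3 t2, so regularity is checked modulo q3 and modulo t2
     separately. *)
  apply: (@reg_sub K [:: [:: - (PI 1); t3]] [:: [:: - (PI 1); t3]] [:: q3 * t2; q2; u]); [chk|chk|].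
  apply: rprod; [var| |];
    (top 12 1 ((q1 ^+ 2 * s33 - PI 2%:Z * q1 * q3 * s13 + q3 ^+ 2 * s11) * m2 ^+ 2);
     apply: regm; first by top 14 1 (q1 ^+ 2); apply: rege; var); apply: rege.
    by top 17 1 (- q1); apply: rego; var.
  by top 15 1 q3; var.
have r_m1_q2u : reg [:: q2; u] m1 by top 16 1 (- q3); apply: rego; var.
cs; [by top1 7 2| | |].
(* Multiplication by q2 eliminates p2 from p.t: modulo p.q the product is p3 m1 - p1 m3. *)
- top 3 1 pt; apply: (@reg_factor K _ _ q2).
  apply: (@regc K [:: t2] _ _ (p3 * m1 - p1 * m3)); first chk.
  exch.
    top 2 1 m1; exch; last exact: r_N2_m1.
    by top 16 1 (- q3); apply: rego; var.
  top 1 1 q2; exch; first exact: r_q2_N2.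
  top 2 1 m1; perm [:: N2; q2; u]; exch; first exact: r_m1_q2u.
  exact: r_N2_m1q2.
- by top 1 1 q2.
- by top 9 2 (q3 ^+ 2 * m1 ^+ 2); apply: regm; apply: rege; [var|top 16 1 (- q3); apply: rego; var].
Qed.
End RegularSequences.

(** * Bounds on grades *)

Section Grades.
Variables (K : fieldType) (E : nat -> lmodType {mpoly K[18]}).
Local Notation S := {mpoly K[18]}.
Variables (iE : forall i, inj_ext (E i)) (d : forall i, {linear E i -> E i.+1}).
Hypothesis dd : forall i x, d i.+1 (d i x) = 0.
Hypothesis (triv1 : forall x : E 1, x = 0).
Variable e0 : {linear S^o -> E 2}.
Hypotheses (e0_inj : injective e0) (e0_ex : forall y, d 2 y = 0 <-> exists x, y = e0 x)
  (d_ex : forall i y, d i.+3 y = 0 <-> exists x, y = d i.+2 x).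

Definition gorl g l := gor d g (ISpan (map (ev K) l)).
Definition gr g l := grade d g (ISpan (map (ev K) l)).
Notation creg := (creg K).

Lemma creg_gor l : creg l -> gorl (size l) l.
Proof.
elim: l => [_|a l IHl [ra /IHl gl]].
  apply: gor_equiv (gor0 triv1 e0_inj e0_ex d_ex) => x /=; split=> [->|]; last by [].
  exact: (@span_eq0 _ [::]).
exact: (gor_reg iE dd triv1 gl ra).
Qed.

Lemma gr_creg k l l' cs : creg l -> (k <= size l)%N -> subcheck cs l l' -> gr k l'.
Proof.
move=> cl kl ch; apply: (grade_leq kl).
apply: (gor_grade iE dd triv1 (creg_gor cl)); exact: subcheckP ch.
Qed.

Lemma gr_split k l f s cs : all (fun xc => memcheck xc.2 l (PM f xc.1)) (zip s cs) -> size cs = size s ->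
  gr k (f :: l) -> gr k (s ++ l) -> gr k l.
Proof.
move=> ch scs g1 g2; apply: (grade_mul iE dd triv1 _ _ g1 g2); first exact: ISpan_ideal.
move=> x; rewrite map_cat => /(@Span_cat S S^o)[y Sy Sx].
have -> : ev K f * x = ev K f * (x - y) + ev K f * y by ring.
have il := ISpan_ideal (map (ev K) l); apply: idealD; first exact: il; first exact: idealMl.
have [c ->] := (@Span_sum S S^o _ y).1 Sy.
rewrite mulr_sumr; apply: ideal_sum => // i _; rewrite /GRing.scale /= mulrCA; apply: idealMl => //.
case: i => i /=; rewrite size_map => si; rewrite (nth_map (PI 0)) //.
rewrite -[_ * _]/(ev K (PM f (nth (PI 0) s i))); apply: (@pev_span _ _ (nth [::] cs i)).
have := all_nthP ((PI 0), [::]) ch i; rewrite size_zip scs minnn => /(_ si).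
by rewrite nth_zip.
Qed.

Local Open Scope nat_scope.
Local Open Scope pex_scope.

(* Cofactors for a list consisting of [n] elements followed by those of [Sig]. *)
Let sg n (c : seq pex) : seq pex := nseq n (PI 0%Z) ++ c.
Let O := PI 0%Z.
Let I := PI 1%Z.

Tactic Notation "split_on" constr(f) constr(s) constr(cs) :=
  apply: (@gr_split _ _ f s cs); [chk|chk| |].
Tactic Notation "leaf" constr(c) constr(cs) := apply: (@gr_creg _ _ _ cs c); [by []|chk].

(** On p1 = p2 = 0 the equation p.q is p3 q3. For p3 = 0 the elements [F1], [F2] become p4 m1, p4
    m2; for q3 = 0 the elements [pv], [F1], [F2] become p3, q2, - q1 times v3'. Each of the
    resulting cases contains a long enough regular sequence. *)
Lemma gr_p2p1 e : opt_u e -> gr (6 + size e) ([:: p2; p1] ++ Sig ++ e).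
Proof.
move=> ue; have cp4 := creg_p4_u K ue; have cm := creg_m_u K ue; have cv := creg_v3_u K ue.
have cpq := creg_pq K.
case: ue cp4 cm cv => -> cp4 cm cv.
all: split_on p3 [:: q3] [:: sg 2 [:: O; O; O; O; O; O; O; I]].
1,3: split_on p4 [:: m2; m1] [:: sg 3 [:: O; O; O; O; O; I]; sg 3 [:: O; O; O; O; I]].
1,3: leaf cp4 [:: sg 4 [:: O; O; O; I]; sg 4 [:: O; r * m2 + w2; O; m2 ^+ 2]].
1,2: leaf cm [:: sg 5 [:: O; O; O; I]; [:: I]; [:: O; I]].
all: split_on v3' [:: p3; q1; q2]
  [:: sg 3 [:: O; O; O; O; O; O; O; O; I]; sg 3 [:: O; O; O; O; O; - I]; sg 3 [:: O; O; O; O; I]].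
1,3: leaf cv [:: sg 4 [:: O; O; O; I]; sg 4 [:: O; O; O; p3 ^+ 2; O; O; n3 - r * p3]; [:: I]].
all: leaf cpq [:: sg 6 [:: O; O; O; I]].
Qed.

Lemma gr_sub k l l' : gr k l -> all (mem l') l -> gr k l'.
Proof.
move=> gl /allP h; apply: (grade_mono iE dd triv1 _ gl) => x; apply: ISpan_subset.
by move=> _ /mapP[e /h el ->]; apply: map_f.
Qed.

Lemma gr_TT_q2 : gr 7 ([:: q2; q3; p2; p1] ++ Sig ++ [:: TT]).
Proof.
have cv := creg_v3_TT K; have cpq := creg_pq K.
split_on v3' [:: p3; q1] [:: sg 4 [:: O; O; O; O; O; O; O; O; I]; sg 4 [:: O; O; O; O; O; - I]].
  by leaf cv [:: sg 5 [:: O; O; O; I]; sg 5 [:: O; O; O; p3 ^+ 2; O; O; n3 - r * p3]; [:: I]].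
by leaf cpq [:: sg 6 [:: O; O; O; I]].
Qed.

Lemma gr_TT_s33 : gr 7 ([:: s33; q3; p2; p1] ++ Sig ++ [:: TT]).
Proof.
have cpq := creg_pq K; have c34 := creg_p3p4 K; have cr := creg_r' K; have ct := creg_t3 K.
split_on (p4 * t3) [:: p3; q1; q2]
  [:: sg 4 [:: O; O; O; O; O; O; O; O; I]; sg 4 [:: O; O; O; O; O; - I]; sg 4 [:: O; O; O; O; I]].
  split_on p4 [:: t3] [:: [:: I]].
    split_on p3 [:: r'] [:: sg 6 [:: O; O; O; O; O; O; I]].
      by leaf c34 [:: sg 7 [:: O; O; O; I]].
    by leaf cr [:: sg 7 [:: O; O; I]; [:: I]].
  by leaf ct [:: sg 6 [:: O; O; O; I]; sg 6 [:: O; O; O; O; O; O; I]].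
by leaf cpq [:: sg 7 [:: O; O; O; I]].
Qed.

Lemma gr_p2p1_TT : gr 7 ([:: p2; p1] ++ Sig ++ [:: TT]).
Proof.
have cp4 := creg_p4_TT K; have cm := creg_m_TT K.
split_on p3 [:: q3] [:: sg 2 [:: O; O; O; O; O; O; O; I]].
  split_on p4 [:: m2; m1] [:: sg 3 [:: O; O; O; O; O; I]; sg 3 [:: O; O; O; O; I]].
    by leaf cp4 [:: sg 4 [:: O; O; O; I]; sg 4 [:: O; r * m2 + w2; O; m2 ^+ 2]; sg 13 [:: I]].
  by leaf cm [:: sg 5 [:: O; O; O; I]; sg 14 [:: I]; [:: I]; [:: O; I]].
(* With q3 = 0 the element [TT] is s33 q2^2; q2 is split off twice. *)
split_on q2 [:: s33 * q2] [:: sg 12 [:: I]].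
  by apply: gr_sub gr_TT_q2 _; chk.
split_on q2 [:: s33] [:: [:: I]].
  by apply: gr_sub gr_TT_q2 _; chk.
by apply: gr_sub gr_TT_s33 _; chk.
Qed.

(** adj(S) q, A S and the rows of r I - A S. From (A S)^2 p = (p.q) adj(S) q - Q p one gets rQ p +
    p4 a = (r I - A S) F + (p.q) adj(S) q, for which these are the cofactors. *)
Definition Sdq := [:: c11 * q1 + c12 * q2 + c13 * q3; c12 * q1 + c22 * q2 + c23 * q3;
  c13 * q1 + c23 * q2 + c33 * q3].
Definition AS := [:: [:: q2 * s13 - q3 * s12; q2 * s23 - q3 * s22; q2 * s33 - q3 * s23];
  [:: q3 * s11 - q1 * s13; q3 * s12 - q1 * s23; q3 * s13 - q1 * s33];
  [:: q1 * s12 - q2 * s11; q1 * s22 - q2 * s12; q1 * s23 - q2 * s13]].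
Definition rAS i := [seq (if i == j then r else PI 0%Z) - nth O (nth [::] AS i) j | j <- iota 0 3].

Lemma gr_p4_I0 : gr 4 (p4 :: I0).
Proof.
have c1 := creg_p4_I00 K; have c2 : creg [:: p4; p3; p2; p1].
  by rewrite /=; do !split; apply: reg_X; chk.
split_on rQ [:: p1; p2; p3] [seq O :: rAS i ++ [:: nth O Sdq i] | i <- [:: 0; 1; 2]].
  by leaf c1 [:: [:: I]; [::]; sg 5 [:: I]; sg 6 [:: I]].
by leaf c2 (Nil (seq pex)).
Qed.

Lemma gr_u : gr 5 (u :: Sig).
Proof.
have cu := creg_u K.
by leaf cu [:: sg 1 [:: O; O; O; I]; sg 1 [:: O; O; O; O; O; O; O; O; I]; sg 1 [:: O; O; O; O; O; O; O; I];
  sg 1 [:: O; r * m2 + w2; O; m2 ^+ 2]].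
Qed.

End Grades.

(** * The two unprojections *)

Section Evaluations.
Variables (K : fieldType) (B : comNzRingType) (f : {rmorphism K -> B}) (s : nat -> B).
Definition evalm : {mpoly K[18]} -> B := mmap f (s \o @nat_of_ord 18).
HB.instance Definition _ := GRing.RMorphism.on evalm.

Lemma evalm_C c : evalm c%:MP = f c. Proof. exact: mmapC. Qed.
Lemma evalm_X (i : 'I_18) : evalm 'X_i = s i. Proof. by rewrite /evalm mmapX mmap1U. Qed.

Fixpoint pex_bound (e : pex) : bool :=
  match e with
  | PX i => (i < 18)%N | PI _ => true
  | PA a b => pex_bound a && pex_bound b | PM a b => pex_bound a && pex_bound b
  | PO a => pex_bound a | PE a _ => pex_bound a
  end.

Lemma evalm_ev e : pex_bound e -> evalm (ev K e) = pev s e.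
Proof.
elim: e => /= [i i18|c _|a IHa b IHb /andP[/IHa<- /IHb<-]|a IHa b IHb /andP[/IHa<- /IHb<-]|a IHa /IHa<-|a IHa n /IHa<-].
- by rewrite /ev /= /Xv evalm_X inordK.
- exact: rmorph_int.
- exact: rmorphD.
- exact: rmorphM.
- exact: rmorphN.
- exact: rmorphXn.
Qed.
End Evaluations.

Section Linkage.
Variable K : fieldType.
Local Notation S := {mpoly K[18]}.

Definition zs n k : pex := if (k < n)%N then PI 0 else PX k.
Definition vars n : seq pex := [seq PX i | i <- iota 0 n].
Local Notation sb n := (@sub0 K 18 (fun i => (i < n)%N)).

Lemma sub0_ev n e : pex_bound e -> sb n (ev K e) = ev K (psubst (zs n) e).
Proof.
elim: e => [i i18|c _|a IHa b IHb /andP[/IHa ha /IHb hb]|a IHa b IHb /andP[/IHa ha /IHb hb]|a IHa /IHa ha|a IHa m /IHa ha].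
- by rewrite /ev /= /Xv sub0X inordK// /zs; case: ltnP.
- exact: rmorph_int.
- by rewrite -[ev K (PA a b)]/(ev K a + ev K b) rmorphD /= ha hb.
- by rewrite -[ev K (PM a b)]/(ev K a * ev K b) rmorphM /= ha hb.
- by rewrite -[ev K (PO a)]/(- ev K a) rmorphN /= ha.
- by rewrite -[ev K (PE a m)]/(ev K a ^+ m) rmorphXn /= ha.
Qed.

(** The linked ideals of both unprojections are generated by variables, since the other generators
    vanish with them; membership becomes an equation in the domain S. *)
Lemma sub0P n l x : (n <= 18)%N -> all (fun e => pex_bound e && (norm (psubst (zs n) e) == [::])) l ->
  ISpan (map (ev K) (vars n ++ l)) x <-> sb n x = 0.
Proof.
move=> n18 /allP hl; split=> [|sx].
  apply: sub0_span => _ /mapP[e + ->]; rewrite mem_cat => /orP[|/hl/andP[eb /eqP e0]].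
    case/mapP => i; rewrite mem_iota => /= i_n ->; have i18 := leq_trans i_n n18.
    by rewrite [LHS](@sub0_ev n (PX i)) //= /zs i_n.
  by rewrite [LHS](@sub0_ev n e)// /ev pev_eq0 ?e0.
rewrite -[x]subr0 -{}sx; apply: sub0_congr => i i_n; apply/mapP; exists (PX i).
  by rewrite mem_cat map_f// mem_iota.
by rewrite /ev /= /Xv inord_val.
Qed.

Lemma reg_m2 : reg K [:: m1] m2.
Proof.
apply: (@reg_topc _ 15 1 q3); [chk|chk|].
apply: rexch; first by apply: reg_X; chk.
by apply: (@reg_topc _ 17 1 q2); [chk|chk|apply: reg_X; chk].
Qed.

Lemma ev_neq0 e : reg K [::] e -> ev K e != 0.
Proof. exact: reg_neq0. Qed.

Lemma polyC_factor (R : idomainType) (C L : {poly R}) f : f != 0 -> C * L = f%:P -> exists a, C = a%:P.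
Proof.
move=> f0 CL; have /andP[C0 L0] : (C != 0) && (L != 0).
  by rewrite -negb_or -mulf_eq0 CL polyC_eq0.
have sCL : (size C + size L).-1 = 1 by rewrite -size_mul// CL size_polyC f0.
have sC : (0 < size C)%N by rewrite size_poly_gt0.
have sL : (0 < size L)%N by rewrite size_poly_gt0.
have /size1_polyC CE : (size C <= 1)%N.
  by move: sCL sC sL; case: (size C) (size L) => [|[|c]] [|l] //=; rewrite addnS.
by exists C`_0.
Qed.

Lemma polyX_factor (R : idomainType) (C L : {poly R}) : C * L = 'X ->
  (exists2 a, C = a%:P & a * L`_1 = 1) \/ (exists2 b, L = b%:P & C = C`_1 *: 'X /\ C`_1 * b = 1).
Proof.
move=> CL; have /andP[C0 L0] : (C != 0) && (L != 0).
  by rewrite -negb_or -mulf_eq0 CL polyX_eq0.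
have sCL : (size C + size L).-1 = 2 by rewrite -size_mul// CL size_polyX.
have sC : (0 < size C)%N by rewrite size_poly_gt0.
have sL : (0 < size L)%N by rewrite size_poly_gt0.
have /orP[/size_poly1P[a _ e]|/size_poly1P[b b0 e]] : (size C == 1) || (size L == 1).
  by move: sCL sC sL; case: (size C) (size L) => [|[|[|c]]] [|[|[|l]]] //= []; rewrite ?addnS.
- left; exists a => //; move/(congr1 (fun p : {poly R} => p`_1)): CL.
  by rewrite e coefCM coefX eqxx.
- right; exists b => //; have := CL; rewrite e => CL'.
  have c1 : C`_1 * b = 1 by move/(congr1 (fun p : {poly R} => p`_1)): CL'; rewrite coefMC coefX eqxx.
  split=> //; apply/polyP => i; rewrite coefZ coefX; case: eqP => [->|/eqP i1]; first by rewrite mulr1.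
  move/(congr1 (fun p : {poly R} => p`_i)): CL'; rewrite coefMC coefX (negbTE i1) mulr0.
  by move/eqP; rewrite mulf_eq0 (negbTE b0) orbF => /eqP.
Qed.

Lemma evM a b : ev K (PM a b) = ev K a * ev K b. Proof. by []. Qed.
Lemma ev_eq e f : norm (PA e (PO f)) == [::] -> ev K e = ev K f. Proof. exact: pev_eq. Qed.
Lemma ev_eq0 e : norm e == [::] -> ev K e = 0. Proof. exact: pev_eq0. Qed.

(** The specialization p1 = X, q3 = s11 = s22 = s33 = 1, all other variables 0. It sends [pq], [p2],
    [p4], [m2] to 0, [pv] to X^2 and [F2] to X. *)
Let ps k : pex := if k == 0%N then PX 0 else if k \in [:: 6; 9; 12; 14]%N then PI 1 else PI 0.
Local Notation psi := (@evalm K {poly K} polyC (fun k => pev (fun=> 'X) (ps k))).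

Lemma psi_ev e : pex_bound e -> psi (ev K e) = pev (fun=> 'X) (psubst ps e).
Proof. by move=> be; rewrite [LHS]evalm_ev// pev_psubst. Qed.

Lemma psi_eq e f : pex_bound e -> norm (PA (psubst ps e) (PO f)) == [::] -> psi (ev K e) = pev (fun=> 'X) f.
Proof. by move=> be h; rewrite psi_ev//; exact: pev_eq. Qed.

Lemma sb_sb n x : sb n (sb n x) = sb n x.
Proof.
have := @mpoly_rmorph_ext K 18 S (sb n \o sb n) (sb n); apply => [k|i] /=.
  by rewrite !sub0C.
by rewrite sub0X; case: ifP => i3; rewrite ?rmorph0// sub0X i3.
Qed.

Lemma psi_sub0 x : (psi x)`_0 = (psi (sb 3 x))`_0.
Proof.
apply/eqP; rewrite -subr_eq0 -coefB -rmorphB; apply/eqP.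
have : ISpan (map (ev K) (vars 3)) (x - sb 3 x).
  by apply: sub0_congr => i i3; apply/mapP; exists (PX i);
    [rewrite map_f// mem_iota|rewrite /ev /= /Xv inord_val].
move=> /(@Span_sum S S^o)[c ->]; rewrite rmorph_sum coef_sum big1// => i _.
rewrite /GRing.scale /= rmorphM /= coefM big_ord1 /=.
suff -> : (psi [seq ev K i | i <- vars 3]`_i)`_0 = 0 by rewrite mulr0.
case: i => [[|[|[|i]]] //= _].
- by rewrite (@psi_eq (PX 0) (PX 0))//= coefX.
- by rewrite (@psi_eq (PX 1) (PI 0))//= mulr0z coef0.
- by rewrite (@psi_eq (PX 2) (PI 0))//= mulr0z coef0.
Qed.

Let nthO := nth (PI 0).

(** Modulo p1, p2, p3 each F_j is p4 m_j, so the residue C of c divides p4 m1 and p4 m2, hence p4,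
    as m2 is regular modulo m1. If C is not a unit it is p4 up to a unit, and h_2 reduces to a
    multiple of m2; under [psi] both c and h_2 then vanish at X = 0, so F2 would have order at least
    2 there, but it is sent to X. *)
Lemma km1_unit (c m : S) (h : 'I_3 -> S) :
  (forall j : 'I_3, ISpan (map (ev K) I00) (ev K (nthO [:: F1; F2; F3] j) - c * h j - m * ev K (PX j))) ->
  exists c', sb 3 (c * c' - 1) = 0.
Proof.
move=> Ih.
have e (j : 'I_3) : sb 3 c * sb 3 (h j) = ev K p4 * ev K (nthO [:: m1; m2; m3] j).
  have s0 : sb 3 (ev K (nthO [:: F1; F2; F3] j) - c * h j - m * ev K (PX j)) = 0.
    apply/(@sub0P 3 I00); [by []|chk|].
    by move: (Ih j); apply: ISpan_subset => x xI; rewrite map_cat mem_cat xI orbT.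
  have sF : sb 3 (ev K (nthO [:: F1; F2; F3] j)) = ev K (PM p4 (nthO [:: m1; m2; m3] j)).
    by case: j {s0} => [[|[|[|j]]] j3] //; (etransitivity; [apply: sub0_ev; chk|]); apply: ev_eq; chk.
  have sX : sb 3 (ev K (PX j)) = 0.
    by case: j {s0 sF} => [[|[|[|j]]] j3] //; (etransitivity; [apply: sub0_ev; chk|]); apply: ev_eq0; chk.
  move/eqP: s0; rewrite !rmorphB !rmorphM /= sF sX mulr0 subr0 subr_eq0 => /eqP <-.
  by [].
set C := sb 3 c in e *; set h1 := sb 3 (h ord0) in e; pose h2 := sb 3 (h (inord 1)).
have e1 : C * h1 = ev K p4 * ev K m1 by rewrite /h1 e.
have e2 : C * h2 = ev K p4 * ev K m2 by rewrite /h2 e inordK.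
have p40 : ev K p4 != 0 by apply: ev_neq0; apply: reg_X; chk.
have m10 : ev K m1 != 0.
  by apply: ev_neq0; apply: (@reg_topc _ 17 1 q2); [chk|chk|apply: reg_X; chk].
have m20 : ev K m2 != 0.
  by apply: ev_neq0; apply: (@reg_topc _ 15 1 q3); [chk|chk|apply: reg_X; chk].
have C0 : C != 0 by apply: contraTneq (mulf_neq0 p40 m10) => C0; rewrite -e1 C0 mul0r eqxx.
have m12 : ev K m1 * h2 = ev K m2 * h1.
  apply: (mulfI p40); rewrite !mulrA -e1 -e2; ring.
have [l] : ISpan [:: ev K m1] h1.
  by apply: reg_m2; exists h2; rewrite -m12 /GRing.scale /= mulrC subrr.
move=> /eqP; rewrite subr_eq0 /GRing.scale /= => /eqP h1E.
have Cl : C * l = ev K p4.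
  by apply: (mulIf m10); rewrite -mulrA -h1E.
pose kk : 'I_18 := inord 3.
have tCl : tau kk C * tau kk l = 'X by rewrite -rmorphM /= Cl /ev /= /Xv tauX eqxx.
have [[a Ca ab]|[b lb [CX Cb]]] := polyX_factor tCl.
  have CE : C = a by rewrite -[C](tauK kk) Ca hornerC.
  exists (tau kk l)`_1; rewrite rmorphB rmorphM rmorph1 /= -/C.
  have /(congr1 (sb 3)) : C * (tau kk l)`_1 = 1 by rewrite CE.
  by rewrite rmorphM rmorph1 /= sb_sb => ->; rewrite subrr.
have CE : C = (tau kk C)`_1 * ev K p4.
  by transitivity (tau kk C).['X_kk]; [rewrite tauK|rewrite {1}CX hornerZ hornerX].
have h2E : h2 = b * ev K m2.
  apply: (mulfI C0); rewrite e2 {1}CE.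
  transitivity ((tau kk C)`_1 * b * (ev K p4 * ev K m2)); first by rewrite Cb mul1r.
  ring.
have psic : (psi c)`_0 = 0.
  rewrite psi_sub0 -/C CE rmorphM /= coefM big_ord1 /= [psi (ev K p4)](@psi_eq _ (PI 0))//=.
  by rewrite mulr0z coef0 mulr0.
have psih : (psi (h (inord 1)))`_0 = 0.
  rewrite psi_sub0 -/h2 h2E rmorphM /= coefM big_ord1 /= [psi (ev K m2)](@psi_eq _ (PI 0))//=.
  by rewrite mulr0z coef0 mulr0.
have := Ih (inord 1); rewrite inordK// => /(@Span_sum S S^o)[d dE].
have : psi (ev K F2 - c * h (inord 1) - m * ev K p2) = psi (d ord0) * psi (ev K pq) + psi (d (lift ord0 ord0)) * psi (ev K pv).
  by rewrite [X in psi X]dE rmorph_sum big_ord_recl big_ord1 /GRing.scale /= !rmorphM.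
rewrite !rmorphB !rmorphM /= [psi (ev K F2)](@psi_eq _ (PX 0))// [psi (ev K p2)](@psi_eq _ (PI 0))//.
rewrite [psi (ev K pq)](@psi_eq _ (PI 0))// [psi (ev K pv)](@psi_eq _ (PE (PX 0) 2))//=.
rewrite mulr0z !mulr0 subr0 add0r => /(congr1 (fun p : {poly K} => p`_1)).
rewrite coefB coefMXn coefX /= coefM big_ord_recl big_ord1 /= psic psih mul0r mulr0 addr0 subr0.
by move/eqP; rewrite oner_eq0.
Qed.

(** The residue C of c divides a_1 and rQ. Divisors of rQ are free of t1, so C divides the
    t1-coefficient [TT] of a_1; divisors of [TT] are free of r, so C divides the coefficient 1 of
    r^2 in rQ. *)
Lemma km2_unit (c m : S) (h : 'I_4 -> S) :
  (forall j : 'I_4, ISpan (map (ev K) I0) (ev K (nthO [:: H1; H2; H3; H4] j) - c * h j - m * ev K (PX j))) ->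
  exists c', sb 4 (c * c' - 1) = 0.
Proof.
move=> Ih.
have e (j : 'I_4) : sb 4 c * sb 4 (h j) = ev K (nthO [:: PO A1; PO A2; PO A3; rQ] j).
  have s0 : sb 4 (ev K (nthO [:: H1; H2; H3; H4] j) - c * h j - m * ev K (PX j)) = 0.
    apply/(@sub0P 4 I0); [by []|chk|].
    by move: (Ih j); apply: ISpan_subset => x xI; rewrite map_cat mem_cat xI orbT.
  have sF : sb 4 (ev K (nthO [:: H1; H2; H3; H4] j)) = ev K (nthO [:: PO A1; PO A2; PO A3; rQ] j).
    by case: j {s0} => [[|[|[|[|j]]]] j3] //; (etransitivity; [apply: sub0_ev; chk|]); apply: ev_eq; chk.
  have sX : sb 4 (ev K (PX j)) = 0.
    by case: j {s0 sF} => [[|[|[|[|j]]]] j3] //; (etransitivity; [apply: sub0_ev; chk|]); apply: ev_eq0; chk.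
  move/eqP: s0; rewrite !rmorphB !rmorphM /= sF sX mulr0 subr0 subr_eq0 => /eqP <-.
  by [].
set C := sb 4 c in e *; pose h1 := sb 4 (h ord0); pose h4 := sb 4 (h (inord 3)).
have e1 : C * h1 = - ev K A1 by rewrite /h1 e.
have e4 : C * h4 = ev K rQ by rewrite /h4 e inordK.
have free k x f : (k < 18)%N -> C * x = f -> f != 0 -> vfree (inord k : 'I_18) f -> vfree (inord k : 'I_18) C.
  move=> k18 Cx f0 vf; have := congr1 (tau (inord k)) Cx; rewrite rmorphM /= vf => tE.
  have [a CE] := polyC_factor f0 tE; rewrite /vfree {1}CE; congr (_%:P).
  by rewrite -[RHS](tauK (inord k)) CE hornerC.
have coef k n x f g j : (k < 18)%N -> C * x = f -> vfree (inord k : 'I_18) C ->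
    tau (inord k : 'I_18) f = g -> g`_j = n -> C * (tau (inord k : 'I_18) x)`_j = n.
  by move=> k18 <- vC <- <-; rewrite rmorphM /= [tau _ C]vC coefCM.
have rQ0 : ev K rQ != 0 by apply: ev_neq0; apply: (@reg_topc1 _ 7 2); chk.
have TT0 : ev K TT != 0.
  by apply: ev_neq0; apply: (@reg_topc _ 14 1 (PE q2 2)); [chk|chk|apply: rege; apply: reg_X; chk].
have C15 : vfree (inord 15 : 'I_18) C by apply: free e4 rQ0 _ => //; apply: pfree_vfree; chk.
have [x1 x1E] : exists x1, C * x1 = ev K TT.
  exists (tau (inord 15 : 'I_18) (- h1))`_1; apply: (coef _ _ _ (ev K A1) _ 1%N _ _ C15 erefl) => //.
    by rewrite mulrN e1 opprK.
  by apply: coef_topc; chk.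
have C7 : vfree (inord 7 : 'I_18) C by apply: free x1E TT0 _ => //; apply: pfree_vfree; chk.
have [x2 x2E] : exists x2, C * x2 = 1.
  exists (tau (inord 7 : 'I_18) h4)`_2; apply: (coef _ _ _ _ _ 2%N _ e4 C7 erefl) => //.
  by rewrite (@coef_topc _ 7 2 (PI 1))//; chk.
exists x2; rewrite rmorphB rmorphM rmorph1 /= -/C.
by move/(congr1 (sb 4)): x2E; rewrite rmorphM rmorph1 /= sb_sb => ->; rewrite subrr.
Qed.
End Linkage.

Section SigmaGorenstein.
Variables (K : fieldType) (E : nat -> lmodType {mpoly K[18]}).
Local Notation S := {mpoly K[18]}.
Variables (iE : forall i, inj_ext (E i)) (d : forall i, {linear E i -> E i.+1}).
Hypothesis dd : forall i x, d i.+1 (d i x) = 0.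
Hypothesis (triv1 : forall x : E 1, x = 0).
Variable e0 : {linear S^o -> E 2}.
Hypotheses (e0_inj : injective e0) (e0_ex : forall y, d 2 y = 0 <-> exists x, y = e0 x)
  (d_ex : forall i y, d i.+3 y = 0 <-> exists x, y = d i.+2 x).
Notation creg := (creg K).
Notation gorl := (gorl d).
Notation gr := (gr d).
Notation reg := (@reg K).

Lemma km_pex g l ps as_ (k := size (map (ev K) ps)) (j0 : 'I_k) :
  size as_ = size ps -> gorl g l -> gorl g.+1 (ps ++ l) ->
  (forall i j : 'I_k, ISpan (map (ev K) l)
     (ev K (nth (PI 0) ps i) * ev K (nth (PI 0) as_ j) - ev K (nth (PI 0) ps j) * ev K (nth (PI 0) as_ i))) ->
  reg l (nth (PI 0) ps j0) -> reg l (nth (PI 0) as_ j0) ->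
  (forall m, (forall j : 'I_k, ISpan (map (ev K) (ps ++ l)) (m * ev K (nth (PI 0) as_ j))) ->
     ISpan (map (ev K) (ps ++ l)) m) ->
  (forall c m (h : 'I_k -> S), (forall j : 'I_k, ISpan (map (ev K) l)
     (ev K (nth (PI 0) as_ j) - c * h j - m * ev K (nth (PI 0) ps j))) ->
     exists c', ISpan (map (ev K) (ps ++ l)) (c * c' - 1)) ->
  gorl g.+1 (as_ ++ l).
Proof.
move=> sas gl gpl C1 C2 C2' C3 C4.
have psE (j : 'I_k) : (map (ev K) ps)`_j = ev K (nth (PI 0) ps j).
  by rewrite (nth_map (PI 0))// -(size_map (ev K)).
have asE (j : 'I_k) : (map (ev K) as_)`_j = ev K (nth (PI 0) as_ j).
  by rewrite (nth_map (PI 0))// sas -(size_map (ev K)).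
have adjP x : adj (ISpan (map (ev K) l)) (fun j : 'I_k => (map (ev K) ps)`_j) x <-> ISpan (map (ev K) (ps ++ l)) x.
  by rewrite adj_span map_cat.
have kE : size (map (ev K) as_) = k by rewrite /k !size_map.
have := @kustin_miller S E d iE dd triv1 g (ISpan (map (ev K) l)) k
  (fun j => (map (ev K) ps)`_j) (fun j => (map (ev K) as_)`_j) gl.
move=> /(_ _ _ j0) h.
apply: (gor_equiv _ (h _ _ _ _ _ _)).
- by move=> x; rewrite map_cat -adj_span kE.
- by apply: gor_equiv gpl => x; rewrite adjP.
- by move=> i j; rewrite !psE !asE.
- by rewrite psE.
- by rewrite asE.
- by move=> m hm; apply/adjP; apply: C3 => j; rewrite -asE; apply/adjP.
- move=> c m hh hm; have [j|c' hc'] := C4 c m hh; first by rewrite -asE -psE.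
  by exists c'; apply/adjP.
Qed.

Lemma gor_vars_I00 : gorl 3 (vars 3 ++ I00).
Proof.
apply: (@gor_equiv _ _ _ _ (ISpan (map (ev K) [:: p3; p2; p1]))).
  move=> x; split; [apply: (@subcheckP K [::])|apply: (@subcheckP K [::])]; chk.
have := @creg_gor K E iE d dd triv1 e0 e0_inj e0_ex d_ex [:: p3; p2; p1]; apply.
by rewrite /=; do !split; apply: reg_X; chk.
Qed.

Definition cert1 (n : nat) (l ps as_ : seq pex) (cs : seq (seq (seq pex))) : bool :=
  all (fun i => all (fun j => memcheck (nth [::] (nth [::] cs i) j) l
    (nth (PI 0) ps i * nth (PI 0) as_ j - nth (PI 0) ps j * nth (PI 0) as_ i)%pex) (iota 0 n)) (iota 0 n).

Lemma cert1P n l ps as_ cs : cert1 n l ps as_ cs -> forall i j : nat, (i < n)%N -> (j < n)%N ->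
  ISpan (map (ev K) l)
     (ev K (nth (PI 0) ps i) * ev K (nth (PI 0) as_ j) - ev K (nth (PI 0) ps j) * ev K (nth (PI 0) as_ i)).
Proof.
move=> /allP h i j i_n j_n; have /h/allP/(_ j) : i \in iota 0 n by rewrite mem_iota.
by rewrite mem_iota => /(_ j_n); exact: pev_span.
Qed.

Lemma gor_I0 : gorl 3 I0.
Proof.
have gI00 := @creg_gor K E iE d dd triv1 e0 e0_inj e0_ex d_ex I00 (creg_I00 K).
have sP x : ISpan (map (ev K) (vars 3 ++ I00)) x <-> @sub0 K 18 (fun i => (i < 3)%N) x = 0.
  by apply: sub0P => //; chk.
apply: (@km_pex 2 I00 (vars 3) [:: F1; F2; F3] ord0 erefl gI00 gor_vars_I00).
(* The entries of p x F = (p.v) q - (p.q) v. *)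
- move=> i j; apply: (@cert1P 3 I00 (vars 3) [:: F1; F2; F3]
    [:: [:: [::]; [:: (- v3)%pex; q3]; [:: v2; (- q2)%pex]];
        [:: [:: v3; (- q3)%pex]; [::]; [:: (- v1)%pex; q1]];
        [:: [:: (- v2)%pex; q2]; [:: v1; (- q1)%pex]; [::]]] _ i j) => //; chk.
- exact: reg_p1_I00.
- by apply: (@reg_topc _ 7 1 p1); [chk|chk|exact: reg_p1_I00].
- move=> m /(_ ord0)/sP; rewrite rmorphM /= => /eqP; rewrite mulf_eq0 => /orP[/eqP/sP//|].
  have -> : @sub0 K 18 (fun i => (i < 3)%N) (ev K F1) = ev K (p4 * m1)%pex.
    by etransitivity; [apply: sub0_ev; chk|apply: ev_eq; chk].
  suff /negPf -> : ev K (p4 * m1)%pex != 0 by [].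
  apply: ev_neq0; apply: regm; first by apply: reg_X; chk.
  by apply: (@reg_topc _ 17 1 q2); [chk|chk|apply: reg_X; chk].
- move=> c m h hc; have [|c' c'P] := @km1_unit K c m h; last by exists c'; apply/sP.
  by case=> [[|[|[|j]]] j3] //; exact: hc.
Qed.

Lemma gor_vars_I0 : gorl 4 (vars 4 ++ I0).
Proof.
apply: (@gor_equiv _ _ _ _ (ISpan (map (ev K) [:: p4; p3; p2; p1]))).
  move=> x; split; [apply: (@subcheckP K [::])|apply: (@subcheckP K [::])]; chk.
have := @creg_gor K E iE d dd triv1 e0 e0_inj e0_ex d_ex [:: p4; p3; p2; p1]; apply.
by rewrite /=; do !split; apply: reg_X; chk.
Qed.

Lemma reg_p4_I0 : reg I0 p4.
Proof.
exact: (gor_reg_mod gor_I0 (@gr_p4_I0 K E iE d dd triv1 e0 e0_inj e0_ex d_ex)).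
Qed.

Definition Sm := [:: Sm1; Sm2; Sm3].
(* [p_i A_j - p_j A_i] is the [k]-th entry of [p x A = F x m + (S m) (p . q)]. *)
Definition cert2 : seq (seq (seq pex)) :=
  let O := PI 0 in
  let ms := [:: m1; m2; m3] in
  let c e i j k := [seq (if e then x else PO x) | x <-
    [seq (if l == i then nth O ms j else if l == j then PO (nth O ms i) else O) | l <- iota 0 3] ++ [:: nth O Sm k]] in
  let d i := rAS i ++ [:: nth O Sdq i] in
  [:: [:: [::]; c false 0 1 2; c true 2 0 1; d 0];
      [:: c true 0 1 2; [::]; c false 1 2 0; d 1];
      [:: c false 2 0 1; c true 1 2 0; [::]; d 2];
      [:: map PO (d 0); map PO (d 1); map PO (d 2); [::]]]%N.

Lemma gor_Sig : gorl 4 Sig.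
Proof.
have sP x : ISpan (map (ev K) (vars 4 ++ I0)) x <-> @sub0 K 18 (fun i => (i < 4)%N) x = 0.
  by apply: sub0P => //; chk.
apply: (@km_pex 3 I0 (vars 4) [:: H1; H2; H3; H4] (Ordinal (isT : 3 < 4)%N) erefl gor_I0 gor_vars_I0).
- by move=> i j; apply: (@cert1P 4 I0 (vars 4) [:: H1; H2; H3; H4] cert2 _ i j) => //; chk.
- exact: reg_p4_I0.
- by apply: (@reg_topc _ 8 1 p4); [chk|chk|exact: reg_p4_I0].
- move=> m /(_ (Ordinal (isT : 3 < 4)%N))/sP; rewrite rmorphM /= => /eqP; rewrite mulf_eq0 => /orP[/eqP/sP//|].
  have -> : @sub0 K 18 (fun i => (i < 4)%N) (ev K H4) = ev K rQ.
    by etransitivity; [apply: sub0_ev; chk|apply: ev_eq; chk].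
  suff /negPf -> : ev K rQ != 0 by [].
  by apply: ev_neq0; apply: (@reg_topc1 _ 7 2); chk.
- move=> c m h hc; have [|c' c'P] := @km2_unit K c m h; last by exists c'; apply/sP.
  by case=> [[|[|[|[|j]]]] j3] //; exact: hc.
Qed.

Lemma reg_u_Sig : reg Sig u.
Proof. exact: (gor_reg_mod gor_Sig (@gr_u K E iE d dd triv1 e0 e0_inj e0_ex d_ex)). Qed.

Lemma gorl_reg g l e : gorl g l -> reg l e -> gorl g.+1 (e :: l).
Proof. by move=> gl re; exact: (gor_reg iE dd triv1 gl re). Qed.

Lemma reg_p2_Sig : reg Sig p1 -> reg (p1 :: Sig) p2.
Proof.
move=> /(gorl_reg gor_Sig) g5.
have := @gr_p2p1 K E iE d dd triv1 e0 e0_inj e0_ex d_ex [::] (or_introl erefl).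
by rewrite cats0; exact: (gor_reg_mod g5).
Qed.

Lemma reg_uTT_Sig : reg Sig p1 -> reg [:: p2, p1 & Sig] (PM u TT).
Proof.
move=> r1; have g6 := gorl_reg (gorl_reg gor_Sig r1) (reg_p2_Sig r1).
apply: regm; apply: (gor_reg_mod g6).
  have := @gr_p2p1 K E iE d dd triv1 e0 e0_inj e0_ex d_ex [:: u] (or_intror erefl).
  by move=> h; apply: (@gr_sub K E iE d dd triv1 7 _ [:: u, p2, p1 & Sig] h); chk.
have h := @gr_p2p1_TT K E iE d dd triv1 e0 e0_inj e0_ex d_ex.
by apply: (@gr_sub K E iE d dd triv1 7 _ [:: TT, p2, p1 & Sig] h); chk.
Qed.

End SigmaGorenstein.

(** * Rational charts *)

Fixpoint pall (A : pred nat) (e : pex) : bool :=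
  match e with
  | PX i => A i | PI _ => true
  | PA a b => pall A a && pall A b | PM a b => pall A a && pall A b
  | PO a => pall A a | PE a _ => pall A a
  end.

Lemma pev_pall (R : comNzRingType) (A : pred nat) (s s' : nat -> R) e :
  (forall i, A i -> s i = s' i) -> pall A e -> pev s e = pev s' e.
Proof.
move=> ss; elim: e => //= [a IHa b IHb /andP[/IHa-> /IHb->]|a IHa b IHb /andP[/IHa-> /IHb->]|a IHa /IHa->|a IHa n /IHa->];
  by [].
Qed.

Lemma pall_bound e : pall (fun i => (i < 18)%N) e = pex_bound e.
Proof. by elim: e => //= [a -> b ->|a -> b ->]. Qed.

Lemma pall_sub (A B : pred nat) e : (forall i, A i -> B i) -> pall A e -> pall B e.
Proof.
move=> AB; by elim: e => //= [a IHa b IHb /andP[/IHa-> /IHb->]|a IHa b IHb /andP[/IHa-> /IHb->]].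
Qed.

Lemma mpoly_closed (K : fieldType) v (T : {mpoly K[v]} -> Prop) : (forall c, T c%:MP) -> (forall i, T 'X_i) ->
  (forall x y, T x -> T y -> T (x + y)) -> (forall x y, T x -> T y -> T (x * y)) -> forall x, T x.
Proof.
move=> TC TX TD TM x; rewrite [x]mpolyE; elim/big_ind: _ => [|y z Ty Tz|m _]; [by rewrite -mpolyC0|exact: TD|].
rewrite -mul_mpolyC; apply: (TM) => //; rewrite mpolyXE_id.
elim/big_ind: _ => [|y z Ty Tz|i _]; [by rewrite -mpolyC1|exact: TM|].
by elim: (m i) => [|k IHk]; [rewrite expr0 -mpolyC1|rewrite exprS; exact: TM].
Qed.

Local Notation "x %:F" := (@tofrac _ x) : ring_scope.

Section Chart.
Variables (K : fieldType) (kept : seq nat) (asg : seq (nat * pex * pex)) (l : seq pex) (f : pex).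
Local Notation n := (size kept).
Local Notation S := {mpoly K[18]}.
Local Notation P := {mpoly K[n]}.
Local Notation L := {fraction P}.
Local Notation J := (ISpan (map (ev K) l)).

Definition xP (k : nat) : P := if insub (index k kept) is Some i then 'X_i else 0.
Definition iota_P : P -> S := mmap (@mpolyC 18 K) (fun i => Xv K (nth 0%N kept i)).
HB.instance Definition _ := GRing.RMorphism.on iota_P.

(** An entry (k, g, f) solves the relation f X_k = g: the value g/f is computed from the kept
    variables and those assigned before. *)
Definition upd (s : nat -> L) (a : nat * pex * pex) : nat -> L :=
  fun j => if j == a.1.1 then pev s a.1.2 / pev s a.2 else s j.
Definition chart_env : nat -> L := foldl upd (fun k => (xP k)%:F) asg.
Definition chi := @evalm K L (@tofrac P \o @mpolyC n K) chart_env.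
HB.instance Definition _ := GRing.RMorphism.on chi.

Definition assigned (s : seq (nat * pex * pex)) : seq nat := map (fun a => a.1.1) s.

Fixpoint staged (s : seq (nat * pex * pex)) : bool :=
  if s is a :: s' then
    [&& pall (fun i => i \notin assigned s) a.1.2, pall (mem kept) a.2, a.1.1 \notin assigned s' & staged s']
  else true.

Hypothesis kept_ok : [&& uniq kept, all (fun i => (i < 18)%N) kept & ~~ has (mem kept) (assigned asg)].
Hypothesis asg_staged : staged asg.
Hypothesis asg_reg : forall a, a \in asg -> reg K [::] a.2.

Lemma foldl_upd s s0 i : i \notin assigned s -> foldl upd s0 s i = s0 i.
Proof.
elim: s s0 => //= a s IHs s0; rewrite inE negb_or => /andP[ia /IHs->].
by rewrite /upd (negPf ia).
Qed.

Lemma iota_xP k : k \in kept -> iota_P (xP k) = Xv K k.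
Proof.
move=> kk; rewrite /xP; case: insubP => [i _ e|]; last by rewrite index_mem kk.
by rewrite /iota_P mmapX mmap1U e nth_index.
Qed.

Lemma iota_pev e : pall (mem kept) e -> iota_P (pev xP e) = ev K e.
Proof.
move=> ke; rewrite pev_rmorph; apply: pev_pall ke => i ik /=; exact: iota_xP.
Qed.

Lemma pev_chart_kept e : pall (mem kept) e -> pev chart_env e = (pev xP e)%:F.
Proof.
case/and3P: kept_ok => _ _ /hasPn ka ke; rewrite [RHS]pev_rmorph; apply: pev_pall ke => i /= ik.
by apply: foldl_upd; apply: contraL ik => /ka.
Qed.

Lemma pev_kept_neq0 e : pall (mem kept) e -> reg K [::] e -> pev chart_env e != 0.
Proof.
move=> ke re; rewrite pev_chart_kept// tofrac_eq0; apply: contra_neq (ev_neq0 re) => e0.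
by rewrite -iota_pev// e0 rmorph0.
Qed.

Lemma staged_killed t s a : staged t -> (forall i, i \in kept -> i \notin assigned t) -> a \in t ->
  (pall (mem kept) a.2 -> pev s a.2 != 0) ->
  pev (foldl upd s t) (PA (PM a.2 (PX a.1.1)) (PO a.1.2)) = 0.
Proof.
elim: t s => // b t IHt s /= /and4P[gb fb bt st] ka; rewrite inE => /predU1P[->|at_] fa0; last first.
  have kt i : i \in kept -> i \notin assigned t.
    by move=> /ka; rewrite inE negb_or => /andP[].
  apply: (IHt (upd s b) st kt at_) => kf; rewrite (@pev_pall _ (mem kept) _ s) //; first exact: fa0.
  by move=> i ik; rewrite /upd; case: eqP => // ib; have := ka _ ik; rewrite ib mem_head.
have fE : pev (foldl upd (upd s b) t) b.2 = pev s b.2.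
  apply: pev_pall fb => i /ka; rewrite inE negb_or => /andP[ib it].
  by rewrite foldl_upd// /upd (negPf ib).
have gE : pev (foldl upd (upd s b) t) b.1.2 = pev s b.1.2.
  apply: pev_pall gb => i; rewrite inE negb_or => /andP[ib it].
  by rewrite foldl_upd// /upd (negPf ib).
by rewrite fE gE foldl_upd// /upd eqxx mulrC divfK ?subrr// fa0.
Qed.

Lemma asg_killed a : a \in asg -> pev chart_env (PA (PM a.2 (PX a.1.1)) (PO a.1.2)) = 0.
Proof.
move=> aA; apply: staged_killed => // [i ik|kf].
  by case/and3P: kept_ok => _ _ /hasPn h; apply: contraL ik => /h.
have -> : pev (fun k => (xP k)%:F) a.2 = (pev xP a.2)%:F by exact: esym (pev_rmorph (@tofrac P) xP a.2).
by rewrite -pev_chart_kept//; exact: pev_kept_neq0 (asg_reg aA).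
Qed.

Lemma kill_step t cs m e : (forall x, x \in t -> pev chart_env x = 0) -> memcheck cs t (PM m e) ->
  pev chart_env m != 0 -> pev chart_env e = 0.
Proof.
move=> t0 /(pev_span chart_env)/(@Span_sum L L^o)[c /= cE] m0.
apply/eqP; move/eqP: cE; rewrite big1 ?mulf_eq0 ?(negPf m0)// => i _.
have il : (i < size t)%N by rewrite -(size_map (pev chart_env)).
by rewrite (nth_map (PI 0))// t0 ?mem_nth// scaler0.
Qed.

Hypothesis l_bound : all pex_bound l.
Hypothesis l_killed : forall e, e \in l -> pev chart_env e = 0.

Lemma chi_killed x : J x -> chi x = 0.
Proof.
move=> /(@Span_sum S S^o)[c ->]; rewrite rmorph_sum big1// => i _; rewrite /GRing.scale /= rmorphM /=.
have il : (i < size l)%N by rewrite -(size_map (ev K)).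
have el := mem_nth (PI 0) il.
by rewrite (nth_map (PI 0))// [chi (ev _ _)]evalm_ev ?(allP l_bound)// l_killed// mulr0.
Qed.

Lemma chi_iota y : chi (iota_P y) = y%:F.
Proof.
have [uk /allP k18 _] := and3P kept_ok.
have := @mpoly_rmorph_ext K n L (chi \o iota_P) (@tofrac P); apply => [c|i] /=.
  by rewrite /iota_P mmapC [LHS]evalm_C.
have ik : nth 0%N kept i \in kept by exact: mem_nth.
rewrite /iota_P mmapX mmap1U [LHS]evalm_X inordK ?k18//.
have := @pev_chart_kept (PX (nth 0%N kept i)) ik; rewrite /= => ->; congr (_%:F).
by rewrite /xP index_uniq// insubT ?ltn_ord// => il; congr ('X_ _); exact: val_inj.
Qed.

Lemma chart_inj y : J (iota_P y) -> y = 0.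
Proof. by move/chi_killed/eqP; rewrite chi_iota tofrac_eq0 => /eqP. Qed.

Hypothesis f_kept : pall (mem kept) f.

Definition clr (x : S) := exists N y, J (ev K f ^+ N * x - iota_P y).

Let iJ : ideal J := ISpan_ideal _.
Let fP := pev xP f.
Let fPE : iota_P fP = ev K f. Proof. exact: iota_pev. Qed.

Lemma clrD x y : clr x -> clr y -> clr (x + y).
Proof.
move=> [a [x' hx]] [b [y' hy]]; exists (a + b)%N, (fP ^+ b * x' + fP ^+ a * y').
have -> : ev K f ^+ (a + b) * (x + y) - iota_P (fP ^+ b * x' + fP ^+ a * y') =
    ev K f ^+ b * (ev K f ^+ a * x - iota_P x') + ev K f ^+ a * (ev K f ^+ b * y - iota_P y').
  by rewrite rmorphD !rmorphM !rmorphXn /= fPE exprD; ring.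
by apply: idealD => //; exact: idealMl.
Qed.

Lemma clrM x y : clr x -> clr y -> clr (x * y).
Proof.
move=> [a [x' hx]] [b [y' hy]]; exists (a + b)%N, (x' * y').
have -> : ev K f ^+ (a + b) * (x * y) - iota_P (x' * y') =
    (ev K f ^+ a * x - iota_P x') * (ev K f ^+ b * y) + iota_P x' * (ev K f ^+ b * y - iota_P y').
  by rewrite rmorphM exprD /=; ring.
by apply: idealD => //; [exact: idealMr|exact: idealMl].
Qed.

Lemma clr_iota y : clr (iota_P y).
Proof. by exists 0%N, y; rewrite expr0 mul1r subrr; exact: ideal0. Qed.

Lemma clr_congr x y : J (x - y) -> clr x -> clr y.
Proof.
move=> xy [a [x' hx]]; exists a, x'.
have -> : ev K f ^+ a * y - iota_P x' = (ev K f ^+ a * x - iota_P x') - ev K f ^+ a * (x - y) by ring.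
by apply: idealB => //; exact: idealMl.
Qed.

Lemma clr_div m x : clr (ev K f ^+ m * x) -> clr x.
Proof. by move=> [a [y h]]; exists (a + m)%N, y; rewrite exprD -mulrA. Qed.

Lemma clrC c : clr c%:MP.
Proof. by have := clr_iota c%:MP; rewrite /iota_P mmapC. Qed.

Lemma clr_pex (A : pred nat) e : (forall i, A i -> clr (Xv K i)) -> pall A e -> clr (ev K e).
Proof.
have clrI (c : int) : clr c%:~R by have := clr_iota c%:~R; rewrite rmorph_int.
move=> cA; elim: e => [i /cA//|c _|a IHa b IHb /andP[/IHa ha /IHb hb]|a IHa b IHb /andP[/IHa ha /IHb hb]|a IHa /IHa ha|a IHa m /IHa ha].
- exact: clrI.
- exact: clrD.
- exact: clrM.
- by rewrite -[ev K (PO a)]mulN1r; apply: clrM => //; exact: (clrI (-1)).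
- rewrite /ev /=; elim: m => [|m IHm]; first by rewrite expr0; exact: (clrI 1).
  by rewrite exprS; exact: clrM.
Qed.

(* [cs] lists, for each assignment, a pair [(c, m)] with [c * a.2 = f ^ m]. *)
Fixpoint clearing (okv : seq nat) (s : seq (nat * pex * pex)) (cs : seq (pex * nat)) : bool :=
  match s, cs with
  | a :: s', (c, m) :: cs' =>
      [&& pall (mem okv) a.1.2, pall (mem okv) c, norm (PA (PM c a.2) (PO (PE f m))) == [::]
        & clearing (a.1.1 :: okv) s' cs']
  | [::], _ => all (mem okv) (iota 0 18)
  | _, _ => false
  end.

Hypothesis f_reg0 : reg K [::] f.
Variable cs : seq (pex * nat).
Hypothesis asg_clearing : clearing kept asg cs.
Hypothesis asg_mem : forall a, a \in asg -> J (ev K (PA (PM a.2 (PX a.1.1)) (PO a.1.2))).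

Lemma chart_clear x : clr x.
Proof.
apply: (mpoly_closed (T := clr)) => [|i||]; [exact: clrC| |exact: clrD|exact: clrM].
suff h k : (k < 18)%N -> clr (Xv K k) by have := h i (ltn_ord i); rewrite /Xv inord_val.
have : forall k, k \in kept -> clr (Xv K k) by move=> j jk; rewrite -iota_xP//; exact: clr_iota.
move: k kept cs asg_clearing asg_mem; elim: asg => [|a s IHs] k okv [|[c m] cs'] //.
- by move=> /(allP (a := mem okv)) h _ ok k18; apply: ok; apply: h; rewrite mem_iota.
- by move=> /(allP (a := mem okv)) h _ ok k18; apply: ok; apply: h; rewrite mem_iota.
case/and4P => ga ca /(pev_eq (Xv K)) caf cl' am ok; apply: IHs cl' _ _ => [b bs|j].
  by apply: am; rewrite inE bs orbT.
rewrite inE => /predU1P[->|/ok//].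
apply: (@clr_div m); apply: (@clr_congr (ev K c * ev K a.1.2)); last first.
  by apply: clrM; apply: clr_pex ok _.
have fm : ev K f ^+ m = ev K c * ev K a.2 by rewrite -[LHS]/(ev K (PE f m)) /ev -caf.
rewrite fm -mulrA -mulrBr; apply: idealMl => //; have := am a (mem_head _ _).
by move=> /(idealN iJ); rewrite opprB.
Qed.

(** A power of f moves x into the polynomials in the kept variables, on which [chi] is injective.
    Hence the saturation by f is the kernel of a map to a field. *)
Lemma chart_sat x : chi x = 0 <-> exists N, J (ev K f ^+ N * x).
Proof.
have fb : pex_bound f.
  by rewrite -pall_bound; apply: pall_sub f_kept => i; have [_ /allP k18 _] := and3P kept_ok; exact: k18.
have chf : chi (ev K f) = pev chart_env f by exact: evalm_ev.
split=> [x0|[N /chi_killed]]; last first.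
  rewrite rmorphM rmorphXn => /eqP; rewrite mulf_eq0 expf_eq0 => /orP[/andP[_ f0]|/eqP//].
  by case/eqP: (pev_kept_neq0 f_kept f_reg0); rewrite -chf; exact/eqP.
have [N [y hy]] := chart_clear x.
have y0 : y = 0.
  apply/eqP; rewrite -tofrac_eq0 -chi_iota; have := chi_killed hy.
  by rewrite rmorphB rmorphM /= x0 mulr0 sub0r => /eqP; rewrite oppr_eq0.
by exists N; move: hy; rewrite y0 rmorph0 subr0.
Qed.

End Chart.

(** * Charts on the variety and on the section p1 = 0 *)

Section HasChart.
Variable K : fieldType.
Local Notation S := {mpoly K[18]}.
Local Notation J l := (ISpan (map (ev K) l)).

Definition has_chart (l : seq pex) (f : S) (n : nat) : Prop :=
  exists (io : {rmorphism {mpoly K[n]} -> S}) (fP : {mpoly K[n]}),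
    [/\ forall c, io c%:MP = c%:MP, io fP = f, forall y, J l (io y) -> y = 0 & forall x, exists N y, J l (f ^+ N * x - io y)].

Definition prime_list (l : seq pex) : Prop :=
  ~ J l 1 /\ forall x y, J l (x * y) -> J l x \/ J l y.

Definition asg_rel (a : nat * pex * pex) : pex := PA (PM a.2 (PX a.1.1)) (PO a.1.2).

(* Each item [(e, N, c)] shows that [f ^ N * e] is killed, because it is the combination with cofactors
   [c] of the relations killed before. *)
Fixpoint killing (f : pex) (t : seq pex) (items : seq (pex * nat * seq pex)) : bool :=
  if items is (e, N, c) :: items' then memcheck c t (PM (PE f N) e) && killing f (rcons t e) items' else true.

Lemma killing_killed kept asg f t items : pev (chart_env K kept asg) f != 0 ->
  (forall x, x \in t -> pev (chart_env K kept asg) x = 0) -> killing f t items ->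
  forall e, e \in map (fun i => i.1.1) items -> pev (chart_env K kept asg) e = 0.
Proof.
move=> f0; elim: items t => //= -[[e N] c] items IH t t0 /andP[ce kt].
have e0 : pev (chart_env K kept asg) e = 0.
  by apply: (kill_step t0 ce); rewrite /= expf_neq0.
move=> x; rewrite inE => /predU1P[->//|]; apply: IH kt _ => y.
by rewrite mem_rcons inE => /predU1P[->|/t0].
Qed.

Section Build.
Variables (kept : seq nat) (asg : seq (nat * pex * pex)) (l : seq pex) (f : pex)
  (cs : seq (pex * nat)) (ms : seq (seq pex)) (items : seq (pex * nat * seq pex)).

Definition chart_check : bool :=
  [&& [&& uniq kept, all (fun i => (i < 18)%N) kept & ~~ has (mem kept) (assigned asg)],
    staged kept asg, all pex_bound l, pall (mem kept) f, clearing f kept asg cs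
    & subcheck ms (map asg_rel asg) l] &&
  killing f (map asg_rel asg) items && all (mem (map (fun i => i.1.1) items)) l.

Hypotheses (ok : chart_check) (asg_reg : forall a, a \in asg -> reg K [::] a.2) (f0 : reg K [::] f).

Let killed e : e \in l -> pev (chart_env K kept asg) e = 0.
Proof.
case/andP: ok => /andP[/and5P[kk st lb fk /andP[cl sb]] ki] /allP il /il.
apply: (killing_killed _ _ ki); first exact: pev_kept_neq0.
by move=> _ /mapP[a aA ->]; exact: asg_killed.
Qed.

Lemma build_chart : has_chart l (ev K f) (size kept).
Proof.
case/andP: ok => /andP[/and5P[kk st lb fk /andP[cl sb]] ki] il.
exists (@iota_P K kept), (pev (xP K kept) f); split; [exact: mmapC|exact: iota_pev| |].
  exact: (chart_inj kk lb killed).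
apply: (chart_clear fk cl) => a aA.
by apply: (subcheckP sb); apply: ISpan_mem; apply: map_f; exact: (map_f asg_rel).
Qed.

Definition sat x := exists N, J l (ev K f ^+ N * x).

Lemma build_sat_prime : ~ sat 1 /\ forall x y, sat (x * y) -> sat x \/ sat y.
Proof.
case/andP: ok => /andP[/and5P[kk st lb fk /andP[cl sb]] ki] il.
have am a : a \in asg -> J l (ev K (asg_rel a)).
  by move=> aA; apply: (subcheckP sb); apply: ISpan_mem; apply: map_f; exact: (map_f asg_rel).
have kerP := chart_sat kk lb killed fk f0 cl am.
split=> [/kerP/eqP|x y /kerP/eqP]; first by rewrite rmorph1 oner_eq0.
by rewrite rmorphM mulf_eq0 => /orP[]/eqP/kerP; [left|right].
Qed.

(** When f is regular the ideal equals its saturation by f. *)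
Lemma build_prime : reg K l f -> prime_list l.
Proof.
move=> rf; have [s1 sM] := build_sat_prime.
have satP x : sat x -> J l x.
  by move=> [N]; elim: N => [|N IHN]; [rewrite expr0 mul1r|rewrite exprS -mulrA => /rf].
have satI x : J l x -> sat x by exists 0%N; rewrite expr0 mul1r.
by split=> [/satI//|x y /satI/sM[]/satP]; [left|right].
Qed.
End Build.

Section Points.
Variable pt : nat -> int.
Definition point : {rmorphism S -> K} := @evalm K K idfun (fun k => (pt k)%:~R).

Lemma point_ev x : pex_bound x -> point (ev K x) = pev (fun=> 0) (psubst (PI \o pt) x).
Proof. by move=> bx; rewrite [LHS]evalm_ev// pev_psubst. Qed.

Lemma point_one e : pex_bound e -> norm (PA (psubst (PI \o pt) e) (PO (PI 1))) == [::] -> point (ev K e) = 1.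
Proof. by move=> be e1; rewrite point_ev// (pev_eq _ (f := PI 1) e1). Qed.

Lemma point_zero l x : all (fun e => pex_bound e && (norm (psubst (PI \o pt) e) == [::])) l -> J l x -> point x = 0.
Proof.
move=> /allP l0 /(@Span_sum S S^o)[c ->]; rewrite rmorph_sum big1// => i _; rewrite /GRing.scale /= rmorphM.
have il : (i < size l)%N by rewrite -(size_map (ev K)).
have /andP[bl z] := l0 _ (mem_nth (PI 0) il).
by rewrite (nth_map (PI 0))// [X in _ * X]point_ev// pev_eq0 ?mulr0.
Qed.

Lemma point_notin l e : all (fun x => pex_bound x && (norm (psubst (PI \o pt) x) == [::])) l -> pex_bound e ->
  norm (PA (psubst (PI \o pt) e) (PO (PI 1))) == [::] -> ~ J l (ev K e).
Proof.
by move=> l0 be e1 /(point_zero l0)/eqP; rewrite point_one// oner_eq0.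
Qed.
End Points.

Hypotheses (r_u : reg K Sig u) (r_p2 : reg K Sig p1 -> reg K (p1 :: Sig) p2)
  (r_uTT : reg K Sig p1 -> reg K [:: p2, p1 & Sig] (PM u TT)).

Let O := PI 0.
Let I := PI 1.
Let z n (c : seq pex) : seq pex := nseq n O ++ c.

Definition zero_at (ks : seq nat) (e : pex) : pex := psubst (fun k => if k \in ks then PI 0 else PX k) e.
Definition Sv i := [seq nth O (nth [::] [:: [:: s11; s12; s13]; [:: s12; s22; s23]; [:: s13; s23; s33]] i) j | j <- iota 0 3].
Definition dot (a b : seq pex) : pex := foldr (fun x y => PA (PM x.1 x.2) y) O (zip a b).
Definition As := [:: A1; A2; A3].
Definition rpAS i := [seq PA (if i == j then r else O) (nth O (nth [::] AS i) j) | j <- iota 0 3].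

(* Relations that become consequences of [H1, ..., H4] once [u] is inverted. *)
Definition u_items (m : pex) (n : nat) : seq (pex * nat * seq pex) :=
  [seq (nth O [:: F1; F2; F3] i, 1%N, z n (map (PM m) (rpAS i ++ [:: nth O [:: m1; m2; m3] i]))) | i <- iota 0 3] ++
  [:: (pq, 1%N, z n (map (PM m) [:: q1; q2; q3]));
      (pv, 2%N, z n (map (PM (PM m m)) ([seq PA (PM u (nth O [:: v1; v2; v3] j)) (dot (Sv j) As) | j <- iota 0 3]
         ++ [:: dot As [:: t1; t2; t3]])))].

(** Where u is invertible, [H1], ..., [H4] solve for p1, ..., p4. *)
Definition kept_u := iota 4 14.
Definition asg_u := [:: (0, A1, u); (1, A2, u); (2, A3, u); (3, PO rQ, u)]%N.
Definition items_u := [:: (H1, 0, [:: I]); (H2, 0, z 1 [:: I]); (H3, 0, z 2 [:: I]); (H4, 0, z 3 [:: I])]%N ++ u_items I 4.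

Definition cs_u := [:: (I, 1); (I, 1); (I, 1); (I, 1)]%N.

Lemma check_u : chart_check kept_u asg_u Sig u cs_u [seq z i [:: I] | i <- iota 0 4] items_u.
Proof. chk. Qed.

Definition at_ n : seq pex := z n [:: I].

(* Consequences of the relations at index [j], once [p_j] is inverted: [pq], [pv], [F_j], [H_j] sit at
   positions [n, n + 1, n + 2, n + 3]. *)
Definition c1 i j : seq pex := nth [::] (nth [::]
  [:: [:: [::]; [:: PO v3; q3]; [:: v2; PO q2]];
      [:: [:: v3; PO q3]; [::]; [:: PO v1; q1]];
      [:: [:: PO v2; q2]; [:: v1; PO q1]; [::]]] i) j.
Definition p_items (n i j k : nat) : seq (pex * nat * seq pex) :=
  let p := nth O [:: p1; p2; p3] in
  let F := nth O [:: F1; F2; F3] in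
  let H := nth O [:: H1; H2; H3] in
  (* [F1, F2, F3, pq, pv] of [cert2] rearranged for the list [pq; pv; F_i; H_i; F_j; F_k; H_j; H_k] *)
  let c2 j' := let c := nth [::] (nth [::] cert2 i) j' in
    [:: nth O c 3; nth O c 4; nth O c i; p j'; nth O c j; nth O c k] in
  let c4 := let c := nth [::] (nth [::] cert2 i) 3 in
    [:: nth O c 3; nth O c 4; nth O c i; p4; nth O c j; nth O c k] in
  [:: (F j, 1, z n (c1 i j ++ [:: p j])); (F k, 1, z n (c1 i k ++ [:: p k]));
      (H j, 1, z n (c2 j)); (H k, 1, z n (c2 k)); (H4, 1, z n c4)]%N.

(** Where p1 is invertible, [pq], [pv], [F1], [H1] are successively linear in q1, s11, r, u, with
    coefficients p1, p1^2, p1, p1; the other fourteen variables are free. *)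
Definition kept_p1 := [:: 0; 1; 2; 3; 5; 6; 10; 11; 12; 13; 14; 15; 16; 17]%N.
Definition asg_p1 := [:: (4, PO (PA (PM p2 q2) (PM p3 q3)), p1); (9, PO (zero_at [:: 9%N] pv), PE p1 2);
  (7, PO n1, p1); (8, A1, p1)]%N.
Definition items_p1 := [:: (pq, 0, [:: I]); (pv, 0, at_ 1); (F1, 0, at_ 2); (H1, 0, at_ 3)]%N ++ p_items 4 0 1 2.
Definition cs_p1 := [:: (I, 1); (I, 2); (I, 1); (I, 1)]%N.

Lemma check_p1 : chart_check kept_p1 asg_p1 Sig p1 cs_p1 [:: at_ 7; at_ 8; at_ 4; at_ 0] items_p1.
Proof. chk. Qed.

(** On p1 = 0 with p2 invertible, [pq], [pv], [F2], [H2] solve for q2, s22, r, u. *)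
Definition kept_p2 := [:: 1; 2; 3; 4; 6; 9; 10; 11; 13; 14; 15; 16; 17]%N.
Definition asg_p2 := [:: (0, O, I); (5, PO (PM p3 q3), p2); (12, PO (zero_at [:: 0; 12]%N pv), PE p2 2);
  (7, PO n2, p2); (8, A2, p2)]%N.
Definition items_p2 := [:: (p1, 0, [:: I]); (pq, 0, at_ 1); (pv, 0, at_ 2); (F2, 0, at_ 3); (H2, 0, at_ 4)]%N
  ++ p_items 6 1 0 2.
Definition cs_p2 := [:: (I, 0); (I, 1); (I, 2); (I, 1); (I, 1)]%N.

Lemma check_p2 : chart_check kept_p2 asg_p2 (p1 :: Sig) p2 cs_p2 [:: [::]; at_ 8; at_ 9; at_ 6; at_ 2] items_p2.
Proof. chk. Qed.

(** On p1 = 0 the relation [H1] is - [A1] and solves for t1 once [TT] is inverted; [H2], [H3], [H4]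
    then give p2, p3, p4. *)
Definition kept_uT := [:: 4; 5; 6; 7; 8; 9; 10; 11; 12; 13; 14; 16; 17]%N.
Definition uT := PM u TT.
Definition asg_uT := [:: (0, O, I); (15, zero_at [:: 15%N] (PO A1), TT); (1, A2, u); (2, A3, u); (3, PO rQ, u)]%N.
Definition items_uT := [:: (p1, 0, [:: I]); (H1, 0, z 1 [:: PO I]); (H2, 0, at_ 2); (H3, 0, at_ 3); (H4, 0, at_ 4)]%N
  ++ u_items TT 6.
Definition cs_uT := [:: (I, 0); (u, 1); (TT, 1); (TT, 1); (TT, 1)]%N.

Lemma check_uT : chart_check kept_uT asg_uT (p1 :: Sig) uT cs_uT
  [:: [::]; z 1 [:: PO I]; at_ 2; at_ 3; at_ 4] items_uT.
Proof. chk. Qed.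

Lemma reg_u0 : reg K [::] u. Proof. by apply: reg_X; chk. Qed.
Lemma reg_TT0 : reg K [::] TT.
Proof. by apply: (@reg_topc _ 14 1 (PE q2 2)); [chk|chk|apply: rege; apply: reg_X; chk]. Qed.

Lemma prime_Sig : prime_list Sig.
Proof.
apply: (build_prime check_u _ reg_u0 r_u).
by move=> a; rewrite !inE => /or4P[]/eqP->; exact: reg_u0.
Qed.

Lemma p1_notin : ~ J Sig (ev K p1).
Proof. apply: (point_notin (pt := fun k => (k == 0%N)%:Z)); chk. Qed.

Lemma reg_p1_Sig : reg K Sig p1.
Proof. by move=> x /(proj2 prime_Sig)[/p1_notin|]. Qed.

Lemma prime_p1Sig : prime_list (p1 :: Sig).
Proof.
apply: (build_prime check_p2 _ _ (r_p2 reg_p1_Sig)); last by apply: reg_X; chk.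
move=> a; rewrite !inE => /or4P[/eqP->|/eqP->|/eqP->|/orP[]/eqP->] /=; try by apply: reg_X; chk.
  exact: reg1.
by apply: rege; apply: reg_X; chk.
Qed.

Lemma chart_p1_Sig : has_chart Sig (ev K p1) 14.
Proof.
apply: (build_chart check_p1); last by apply: reg_X; chk.
move=> a; rewrite !inE => /or4P[]/eqP-> /=; try by apply: reg_X; chk.
by apply: rege; apply: reg_X; chk.
Qed.

Lemma chart_p2_p1Sig : has_chart (p1 :: Sig) (ev K p2) 13.
Proof.
apply: (build_chart check_p2); last by apply: reg_X; chk.
move=> a; rewrite !inE => /or4P[/eqP->|/eqP->|/eqP->|/orP[]/eqP->] /=; try by apply: reg_X; chk.
  exact: reg1.
by apply: rege; apply: reg_X; chk.
Qed.

Lemma chart_uT_p1Sig : has_chart (p1 :: Sig) (ev K uT) 13.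
Proof.
apply: (build_chart check_uT); last by apply: regm; [exact: reg_u0|exact: reg_TT0].
move=> a; rewrite !inE => /or4P[/eqP->|/eqP->|/eqP->|/orP[]/eqP->] /=; try exact: reg_u0.
  exact: reg1.
exact: reg_TT0.
Qed.

Lemma p2_notin : ~ J (p1 :: Sig) (ev K p2).
Proof. apply: (point_notin (pt := fun k => (k == 1%N)%:Z)); chk. Qed.

Lemma uT_notin : ~ J (p1 :: Sig) (ev K uT).
Proof. apply: (point_notin (pt := fun k => (k \in [:: 5; 8; 14]%N : nat)%:Z)); chk. Qed.

Section Quotient.
Variables (l : seq pex) (A : comNzRingType) (pr : {rmorphism S -> A}).
Hypotheses (prS : forall a, exists x, pr x = a) (prK : forall x, pr x = 0 <-> J l x).

Lemma quotient_dom : prime_list l -> GRing.integral_domain_axiom A.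
Proof.
move=> [_ lp] a b ab; have [x xE] := prS a; have [y yE] := prS b; subst a b.
by move: ab; rewrite -rmorphM => /prK/lp[]/prK->; rewrite eqxx ?orbT.
Qed.

Lemma quotient_dvd f x : dvd (pr (ev K f)) (pr x) <-> J (f :: l) x.
Proof.
split=> [[a aE]|[c /prK]]; last first.
  by rewrite rmorphB rmorphM => /eqP; rewrite subr_eq0 => /eqP xE; exists (pr c).
have [c cE] := prS a; exists c; apply/prK.
by rewrite rmorphB rmorphM cE /= aE subrr.
Qed.

Lemma quotient_chart f n : has_chart l f n -> exists (phi : {rmorphism {mpoly K[n]} -> A}) fP,
  [/\ phi fP = pr f, injective phi & forall a, exists N y, phi fP ^+ N * a = phi y].
Proof.
move=> [io [fP [_ fPE io_inj cl]]]; exists (pr \o io), fP; split; first by rewrite /= fPE.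
  move=> x y /eqP; rewrite -subr_eq0 -rmorphB => /eqP/prK/io_inj/eqP.
  by rewrite subr_eq0 => /eqP.
move=> a; have [x <-] := prS a; have [N [y /prK]] := cl x.
rewrite rmorphB rmorphM rmorphXn => /eqP; rewrite subr_eq0 => /eqP e.
by exists N, y; rewrite /= fPE.
Qed.

Lemma quotient_chart_closed f n : prime_list l -> ~ J l f -> has_chart l f n ->
  forall m (c : nat -> A) a b, b <> 0 -> hom_eq m c a b = 0 -> exists N, dvd b (pr f ^+ N * a).
Proof.
move=> lp lf /quotient_chart[phi [fP [fPE phi_inj cl]]] m c a b b0 E.
have dom := quotient_dom lp.
have domP : GRing.integral_domain_axiom {mpoly K[n]} by move=> x y /eqP; rewrite mulf_eq0.
have fP0 : fP <> 0 by move=> f0; apply: lf; apply/prK; rewrite -fPE f0 rmorph0.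
have [||||s [[N ->] h]] := @int_closed_clear _ _ phi (fun s => exists N, s = fP ^+ N) dom phi_inj
  (factorial_int_closed domP (@factorial_mpoly K n)) _ _ _ _ m c a b b0 E.
- by exists 0%N; rewrite expr0.
- by move=> _ _ [i ->] [j ->]; exists (i + j)%N; rewrite exprD.
- by move=> [k] /esym; exact: dom_expr_neq0.
- by move=> x; have [i [y e]] := cl x; exists (fP ^+ i), y; rewrite rmorphXn; split=> //; exists i.
by exists N; rewrite -fPE -rmorphXn.
Qed.
End Quotient.

Lemma ufd_Sig (A : comNzRingType) (pr : {rmorphism S -> A}) :
  (forall a, exists x, pr x = a) -> (forall x, pr x = 0 <-> J Sig x) -> factorial A /\ ufd A.
Proof.
move=> prS prK; have dom := quotient_dom prS prK prime_Sig.
have [phi [fP [fPE phi_inj cl]]] := quotient_chart prS prK chart_p1_Sig.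
have [p1n p1p] := prime_p1Sig.
have dP := quotient_dvd prS prK p1.
have pp : prime_elt (phi fP).
  rewrite fPE; split.
  - by move=> /prK/p1_notin.
  - by move=> [y yE]; apply: p1n; apply/dP; exists y; rewrite rmorph1 -yE mulrC.
  move=> a b; have [x <-] := prS a; have [y <-] := prS b.
  by rewrite -rmorphM => /dP/p1p[]/dP; [left|right].
have fA := factorial_nagata dom (Noeth_surj prS (@Noeth_mpoly K 18)) phi_inj (@factorial_mpoly K 14) pp cl.
by split=> //; exact: factorial_ufd.
Qed.

Lemma closed_p1Sig (B : comNzRingType) (pr : {rmorphism S -> B}) :
  (forall a, exists x, pr x = a) -> (forall x, pr x = 0 <-> J (p1 :: Sig) x) ->
  GRing.integral_domain_axiom B /\ int_closed B.
Proof.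
move=> prS prK; have dom := quotient_dom prS prK prime_p1Sig; split=> //.
have rr := r_uTT reg_p1_Sig.
apply: (@int_closed_pair _ (pr (ev K p2)) (pr (ev K uT))) => //.
- by move=> /prK; exact: p2_notin.
- move=> a; have [x <-] := prS a; rewrite -rmorphM.
  by move=> /(quotient_dvd prS prK) h; apply/(quotient_dvd prS prK); exact: rr.
- exact: (quotient_chart_closed prS prK prime_p1Sig p2_notin chart_p2_p1Sig).
- exact: (quotient_chart_closed prS prK prime_p1Sig uT_notin chart_uT_p1Sig).
Qed.

(** The relations solved in the chart at p1, in order. Saturating the first k of them by p1 gives a
    prime, the kernel of the chart that solves only these; four such primes precede I_Sigma in a
    chain. *)
Definition chain_gens := [:: pq; pv; F1; H1].
Definition sat_p1 k := sat (take k chain_gens) p1.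

Lemma check_chain : all (fun k => chart_check (kept_p1 ++ assigned (drop k asg_p1)) (take k asg_p1)
  (take k chain_gens) p1 (take k cs_p1) [seq at_ i | i <- iota 0 k] (take k items_p1)) (iota 0 4).
Proof. chk. Qed.

Lemma sat_p1_prime k : (k < 4)%N -> ~ sat_p1 k 1 /\ forall x y, sat_p1 k (x * y) -> sat_p1 k x \/ sat_p1 k y.
Proof.
move=> k4; have /allP/(_ k) := check_chain; rewrite mem_iota => /(_ k4) ck.
apply: (build_sat_prime ck); last by apply: reg_X; chk.
move=> a /mem_take; rewrite !inE => /or4P[]/eqP-> /=; try by apply: reg_X; chk.
by apply: rege; apply: reg_X; chk.
Qed.

Lemma sat_p1_ideal k : ideal (sat_p1 k).
Proof.
have iJ := ISpan_ideal (map (ev K) (take k chain_gens)).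
split=> [|x y [a xa] [b yb]|a x [b xb]].
- by exists 0%N; rewrite mulr0; exact: ideal0.
- exists (a + b)%N; rewrite exprD mulrDr; apply: idealD => //.
    by rewrite mulrAC; exact: idealMr.
  by rewrite -mulrA; exact: idealMl.
- by exists b; rewrite /GRing.scale /= mulrCA; exact: idealMl.
Qed.

Lemma sat_p1_sub k x : sat_p1 k x -> sat_p1 k.+1 x.
Proof.
move=> [N h]; exists N; move: h; apply: ISpan_subset => _ /mapP[e ek ->]; apply: map_f.
by move: k ek => [|[|[|[|k]]]] //; rewrite /= !inE => h; rewrite ?(orbA, h, orTb) //;
    move: h; do ?[case/orP=> [->|]; rewrite ?orbT //]; move=> ->; rewrite ?orbT.
Qed.

Lemma sat_p1_Sig k x : sat_p1 k x -> J Sig x.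
Proof.
move=> [N h]; have {}h : J Sig (ev K p1 ^+ N * x).
  move: h; apply: ISpan_subset => _ /mapP[e /mem_take ek ->]; apply: map_f.
  by move: ek; rewrite !inE => /or4P[]/eqP->; chk.
by elim: N h => [|N IHN]; [rewrite expr0 mul1r|rewrite exprS -mulrA => /reg_p1_Sig].
Qed.

Definition chain_gen k : pex := nth O chain_gens k.

Lemma chain_gen_in k : (k < 4)%N -> sat_p1 k.+1 (ev K (chain_gen k)).
Proof.
move=> k4; exists 0%N; rewrite expr0 mul1r; apply: ISpan_mem; apply: map_f.
by move: k k4 => [|[|[|[|k]]]] // _; chk.
Qed.

Lemma chain_gen_notin k : (k < 4)%N -> ~ sat_p1 k (ev K (chain_gen k)).
Proof.
(* At the point where p1 and the variable solved by the k-th relation are 1 and all others 0, the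
   earlier relations vanish and this one has value 1. *)
move=> k4 [N]; pose pt i := (i \in [:: 0; nth 0 [:: 4; 9; 7; 8] k]%N : nat)%:Z.
have l0 : all (fun e => pex_bound e && (norm (psubst (PI \o pt) e) == [::])) (take k chain_gens).
  by rewrite /pt; move: k k4 {pt} => [|[|[|[|k]]]] // _; chk.
move=> /(point_zero l0)/eqP; rewrite rmorphM rmorphXn !point_one ?expr1n ?mulr1 ?oner_eq0//.
all: by rewrite /pt; move: k k4 {pt l0} => [|[|[|[|k]]]] // _; chk.
Qed.
End HasChart.

(** * The equations of the variety *)

(** With indices taken cyclically, [s] being the successor modulo 3, the cofactors carry no
    signs. *)
Lemma adj3 (A : comNzRingType) (f : nat -> nat -> A) (i j : 'I_3)
    (s := fun k => nth 0 [:: 1; 2; 0]%N k) :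
  (\adj (\matrix_(i < 3, j < 3) f i j)) i j =
  f (s j) (s i) * f (s (s j)) (s (s i)) - f (s j) (s (s i)) * f (s (s j)) (s i).
Proof.
rewrite mxE /cofactor (expand_det_row _ ord0) !big_ord_recl big_ord0 /cofactor !det_mx11 !mxE /=.
by case: i => [[|[|[|i]]] i3] //; case: j => [[|[|[|j]]] j3] //=; rewrite /s /bump /=; ring.
Qed.

Lemma sum3 (A : comNzRingType) (f : 'I_3 -> A) :
  \sum_(i < 3) f i = f (@Ordinal 3 0 isT) + f (@Ordinal 3 1 isT) + f (@Ordinal 3 2 isT).
Proof. by rewrite !big_ord_recr big_ord0 /= add0r; congr (f _ + f _ + f _); apply: val_inj. Qed.

Section Equations.
Variable R : realType.
Let vE k : var R k = Xv R[i] k. Proof. by []. Qed.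
Ltac reify t :=
  lazymatch t with
  | ?a + ?b => let x := reify a in let y := reify b in constr:(PA x y)
  | ?a * ?b => let x := reify a in let y := reify b in constr:(PM x y)
  | - ?a => let x := reify a in constr:(PO x)
  | ?a ^+ ?n => let x := reify a in constr:(PE x n)
  | Xv _ ?k => constr:(PX k)
  | 0 => constr:(PI 0)
  end.
Ltac entry := let z := fresh "z" in set z := RHS; rewrite !(mxE, sum3);
  rewrite /Defs.p4 /r_ /u_ !vE ?mulr1n ?mulr0n /=;
  lazymatch goal with |- ?t = _ => let e := reify t in transitivity (ev R[i] e); [reflexivity|rewrite /z; apply: ev_eq; vm_compute; reflexivity] end.
Lemma eq1_ev : eq1 R 0 0 = ev R[i] pq.
Proof. by rewrite /eq1 /p_ /q_ /S_Sigma; entry. Qed.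
Lemma eq2_ev (i : 'I_3) : eq2 R i 0 = ev R[i] (nth (PI 0) [:: F1; F2; F3] i).
Proof.
by case: i => [[|[|[|i]]] i3] //; rewrite /eq2 /r_ /A_ /S_ /p_ /p4 /t_ /S_Sigma; entry.
Qed.
Lemma eq3_ev : eq3 R 0 0 = ev R[i] pv.
Proof. by rewrite /eq3 /S_ /p_ /p4 /t_ /S_Sigma; entry. Qed.
Lemma eq4_ev (i : 'I_3) : eq4 R i 0 = ev R[i] (nth (PI 0) [:: H1; H2; H3] i).
Proof.
by case: i => [[|[|[|i]]] i3] //; rewrite /eq4 /r_ /A_ /S_ /p_ /p4 /t_ /S_Sigma; entry.
Qed.

Lemma eq5_ev : eq5 R = ev R[i] H4.
Proof.
rewrite /eq5 mxE.
under eq_bigr => k _.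
  rewrite mxE; under eq_bigr => l _ do rewrite /S_ (@adj3 _ (fun i j =>
    var R (nth 0 (nth [::] [:: [:: 9; 10; 11]; [:: 10; 12; 13]; [:: 11; 13; 14]] i) j))%N).
  over.
rewrite /q_ /S_Sigma; entry.
Qed.
End Equations.

(** * The theorem *)

Section Spectrum.
Variable A : comNzRingType.

Lemma ideal_spanE (s : seq A) x : x \in ideal_span s <-> ISpan s x.
Proof.
split=> [/ideal_spanP[c ->]|/(@Span_sum A A^o)[c ->]]; last by apply/ideal_spanP; exists c.
by apply/(@Span_sum A A^o); exists c.
Qed.

Lemma Noeth_noetherian : Noeth A -> noetherian A.
Proof.
move=> nA J; have [|s sJ] := nA (fun x => x \in J).
  by split=> [|x y|a x]; [exact: rpred0|exact: rpredD|exact: ring_quotient.idealMr].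
by exists s => x; apply/idP/idP => [/sJ/ideal_spanE|/ideal_spanE/sJ].
Qed.

Hypothesis dom : GRing.integral_domain_axiom A.

Lemma dom_spec_irreducible : spec_irreducible A.
Proof.
have [|||Z ZP] := @prime_idealr_of A (fun x => x = 0).
- by split=> [|x y -> ->|a x ->]; rewrite ?addr0 ?scaler0.
- by move/eqP; rewrite oner_eq0.
- by move=> x y /dom/orP[]/eqP; [left|right].
split; first by exists Z.
move=> E F EF; apply: contrapT => /not_orP[/existsNP[P /existsNP[e /not_implyP[Ee eP]]]].
move=> /existsNP[Q /existsNP[f /not_implyP[Ff fQ]]].
have [/(_ e Ee)/ZP e0|/(_ f Ff)/ZP f0] := EF Z.
  by apply: eP; rewrite e0 rpred0.
by apply: fQ; rewrite f0 rpred0.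
Qed.

Lemma dom_spec_reduced : spec_reduced A.
Proof.
move=> P x n xn0; have domP := @localization_dom A (prime_compl P) dom.
elim: n xn0 => [/eqP|n IHn]; first by rewrite expr0 oner_eq0.
by rewrite exprS => /domP/orP[/eqP|/eqP/IHn].
Qed.

Lemma int_closed_spec_normal : int_closed A -> spec_normal A.
Proof.
move=> ic P; apply: int_closed_normal; first exact: localization_dom.
exact: localization_int_closed.
Qed.
End Spectrum.

Section IdealQuotient.
Variables (A : comNzRingType) (I : idealr A).
Local Notation B := {ideal_quot I}.

Lemma ideal_quot_eq0 (x : A) : \pi_B x = 0 <-> x \in I.
Proof.
rewrite -(rmorph0 \pi_B); split=> [/eqP|xI]; first by rewrite -Quotient.idealrBE subr0.
by apply/eqP; rewrite -Quotient.idealrBE subr0.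
Qed.

Lemma ideal_quot_surj (a : B) : exists x : A, \pi_B x = a.
Proof. by exists (repr a); rewrite reprK. Qed.
End IdealQuotient.

Lemma gor_gorenstein_ring (K : fieldType) (v : nat) (A : comNzRingType) (pr : {rmorphism {mpoly K[v]} -> A})
    (E : nat -> lmodType {mpoly K[v]}) (d : forall i, {linear E i -> E i.+1}) (top g : nat) :
  (forall i, inj_ext (E i)) -> (forall i x, d i.+1 (d i x) = 0) ->
  (forall i, (top < i)%N -> forall x : E i, x = 0) ->
  (forall y, exists x, pr x = y) -> gor d g (fun x => pr x = 0) -> gorenstein_ring A.
Proof.
move=> iE dd Etop prS gI; have nA : Noeth A := Noeth_surj prS (@Noeth_mpoly K v).
split=> [|P _]; first exact: Noeth_noetherian.
have lP := localizationP (prime_compl P).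
split; first exact: (Noeth_noetherian (Noeth_loc lP nA)).
apply: (@finite_injective_dimension_ev K _ (to_localization (prime_compl P) \o pr \o @mpolyC v K) top).
apply: (loc_ev_exact lP); exact: (gor_quotient_ev iE dd Etop prS gI).
Qed.

Section SigmaFacts.
Variable K : fieldType.
Local Notation S := {mpoly K[18]}.

Lemma Sigma_regular : [/\ reg K Sig u, reg K Sig p1 -> reg K (p1 :: Sig) p2
  & reg K Sig p1 -> reg K [:: p2, p1 & Sig] (PM u TT)].
Proof.
have [E [d [e [top [[iE dd _ triv1 einj] e0 ex _]]]]] := mpoly_resolution K 18.
split.
- exact: (reg_u_Sig iE dd triv1 einj e0 ex).
- exact: (reg_p2_Sig iE dd triv1 einj e0 ex).
- exact: (reg_uTT_Sig iE dd triv1 einj e0 ex).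
Qed.

Lemma Sigma_gorenstein_ring (A : comNzRingType) (pr : {rmorphism S -> A}) :
  (forall a, exists x, pr x = a) -> (forall x, pr x = 0 <-> ISpan (map (ev K) Sig) x) -> gorenstein_ring A.
Proof.
move=> prS prK; have [E [d [e [top [[iE dd _ triv1 einj] e0 ex Etop]]]]] := mpoly_resolution K 18.
apply: (gor_gorenstein_ring iE dd Etop prS).
by apply: gor_equiv (gor_Sig iE dd triv1 einj e0 ex) => x; rewrite prK.
Qed.

Lemma Sigma_prime_chain (P : prime_idealr S) :
  (forall x, ISpan (map (ev K) Sig) x -> x \in P) -> prime_chain 4 P.
Proof.
move=> SP; have [r_u r_p2 _] := Sigma_regular.
have ex k : (k < 4)%N -> exists C : prime_idealr S, forall x, x \in C <-> sat_p1 k x.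
  by move=> k4; have [s1 sM] := sat_p1_prime K k4; exact: prime_idealr_of (sat_p1_ideal K k) s1 sM.
(* The saturations lie in I_Sigma because p1 is regular modulo it; the chain is closed by the given
   prime [P]. *)
pose C k : prime_idealr S := if pselect (k < 4)%N is left k4 then sval (cid (ex k k4)) else P.
have CE k x : (k < 4)%N -> x \in C k <-> sat_p1 k x.
  by move=> k4; rewrite /C; case: pselect => // k4'; case: cid => D /= DP; exact: DP.
have C4 : C 4 = P by rewrite /C; case: pselect.
exists C; split=> [k k4|x]; last by rewrite C4.
have [k3|k3] := ltnP k 3.
  split=> [x /(CE k x k4)/sat_p1_sub h|]; first exact/(CE k.+1).
  move=> /(_ (ev K (chain_gen k))) h; apply: (chain_gen_notin (K := K) k4); apply/(CE k _ k4)/h/CE => //.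
  exact: chain_gen_in.
have -> : k = 3 by apply/eqP; rewrite eqn_leq k3 andbT -ltnS.
rewrite C4; split=> [x /(CE 3 x isT)/(sat_p1_Sig r_u)/SP//|].
move=> /(_ (ev K H1)) h; apply: (@chain_gen_notin K 3 isT); apply/(CE 3 _ isT)/h/SP.
by apply: ISpan_mem; apply: map_f.
Qed.

Lemma Sigma_height (P : prime_idealr S) m :
  (forall x, x \in P <-> ISpan (map (ev K) Sig) x) -> prime_chain m P -> (m <= 4)%N.
Proof.
move=> PE [C [Cs Cm]].
have [r_u _ _] := Sigma_regular; have [io [fP [ioC _ ioJ _]]] := chart_p1_Sig K.
(* The 14 kept variables of the chart at p1 are independent modulo [P], so 14 + m is at most 18. *)
rewrite -(leq_add2l 14); apply: (prime_chain_indep Cs (io := io)); split=> // y.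
by rewrite Cm => /PE/ioJ.
Qed.
End SigmaFacts.

Theorem proposition2p4 (R : realType) :
  [/\ gorenstein_ideal (I_Sigma R) 4,
      [/\ prime_idealr_closed (I_Sigma R),
          spec_irreducible (R_Sigma R) & spec_reduced (R_Sigma R)],
      spec_normal (R_Sigma R) /\ spec_normal (R_Sigma_p1 R)
    & ufd (R_Sigma R)].
Proof.
pose K : fieldType := R[i]; pose S : comNzRingType := {mpoly K[18]}.
have [r_u r_p2 r_uTT] := Sigma_regular K.
have memE : Sigma_eqs R = map (ev K) ([:: pq; F1; F2; F3; pv; H1; H2; H3; H4]).
  have e2 : [seq eq2 R i 0 | i : 'I_3] = map (ev K) [:: F1; F2; F3].
    transitivity [seq eq2 R i 0 | i <- enum 'I_3]; first by [].
    by rewrite (eq_map (@eq2_ev R)) !enum_ordSl (size0nil (size_enum_ord 0)).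
  have e4 : [seq eq4 R i 0 | i : 'I_3] = map (ev K) [:: H1; H2; H3].
    transitivity [seq eq4 R i 0 | i <- enum 'I_3]; first by [].
    by rewrite (eq_map (@eq4_ev R)) !enum_ordSl (size0nil (size_enum_ord 0)).
  by rewrite /Sigma_eqs e2 e4 eq1_ev eq3_ev eq5_ev.
have IP (x : S) : x \in I_Sigma R <-> ISpan (map (ev K) Sig) x.
  rewrite /I_Sigma memE; apply: (iff_trans (ideal_spanE _ x)).
  by split; apply: ISpan_subset => _ /mapP[e eI ->]; apply: map_f; move: e eI; apply/allP.
have I1P (x : S) : x \in I_Sigma_p1 R <-> ISpan (map (ev K) (p1 :: Sig)) x.
  rewrite /I_Sigma_p1 memE -[var R 0]/(ev K p1) -map_cons; apply: (iff_trans (ideal_spanE _ x)).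
  by split; apply: ISpan_subset => _ /mapP[e eI ->]; apply: map_f; move: e eI; apply/allP.
have surj := @ideal_quot_surj S (I_Sigma R); have surj1 := @ideal_quot_surj S (I_Sigma_p1 R).
have ker x : \pi_(R_Sigma R) x = 0 <-> ISpan (map (ev K) Sig) x.
  exact: iff_trans (ideal_quot_eq0 _ x) (IP x).
have ker1 x : \pi_(R_Sigma_p1 R) x = 0 <-> ISpan (map (ev K) (p1 :: Sig)) x.
  exact: iff_trans (ideal_quot_eq0 _ x) (I1P x).
have [pS1 pSM] := prime_Sig r_u.
have dom := quotient_dom surj ker (prime_Sig r_u).
have [fac ufdR] := ufd_Sig r_u r_p2 surj ker.
have [dom1 ic1] := closed_p1Sig r_u r_p2 r_uTT surj1 ker1.
split=> //.
- split; last exact: (Sigma_gorenstein_ring surj ker).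
  have [|P PE] := @prime_idealr_of S (ISpan (map (ev K) Sig)) _ pS1 pSM; first exact: ISpan_ideal.
  split=> [|Q IQ m [_ hm]].
    exists P; split=> [x /IP/PE//|]; split; first by apply: Sigma_prime_chain => x /PE.
    by move=> m; apply: Sigma_height.
  by apply: hm; apply: Sigma_prime_chain => x /IP/IQ.
- split.
  + by move=> x y /IP/pSM[]/IP ->; rewrite ?orbT.
  + exact: dom_spec_irreducible.
  + exact: dom_spec_reduced.
- split; first exact: int_closed_spec_normal dom (factorial_int_closed dom fac).
  exact: int_closed_spec_normal dom1 ic1.
Qed.
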